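(* Let $\mathcal{C}$ be a cyclic $A_\infty$-category of dimension $d$ and $s$ a splitting of the non-commutative Hodge filtration, and let $\mathcal{K}_m$ $(m\ge1)$ be the Taylor coefficients $\mathcal{K}_s^m$ of the closed trivializing morphism (defined in the context). For $m>1$, $x_1,\dots,x_m\in\mathcal{F}^{c}(\mathcal{C})[6-2d]$ and $1\le i\ne j\le m$ we have $$(-1)^*\mathcal{K}_{m-1}\big((x_i\cdot x_j)\odot x_1\odot\cdots\hat{x_i}\cdots\hat{x_j}\cdots\odot x_m\big)=\gamma\,\mathcal{K}_m(x_1\odot\cdots\odot x_m)+\sum_{\substack{L_1\sqcup L_2=[m]\\ i\in L_1,\ j\in L_2}}(-1)^{\#}\,\mathcal{K}_{|L_1|}\Big(\bigodot_{l\in L_1}x_l\Big)\cdot\mathcal{K}_{|L_2|}\Big(\bigodot_{l\in L_2}x_l\Big),$$ where $(-1)^*$ is the Koszul sign of the permutation moving $x_i,x_j$ to the front and $(-1)^{\#}$ is the Koszul sign of the shuffle $(L_1,L_2)$.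
   Context: Conventions: $k$ is a field of characteristic $0$; $V[1]$ is in degree $-1$ if $V$ is in degree $0$; Koszul signs; $Sym\,V=\bigoplus_{n\ge0}(V^{\otimes n})_{S_n}$; $[m]=\{1,\dots,m\}$. Cyclic $A_\infty$-category of dimension $d$: operations $m_n$ ($n\ge2$) and internal differential $d$ with $(d+m)^2=0$ on the bar construction, and symmetric non-degenerate chain maps $Hom(\mu,\lambda)\otimes Hom(\lambda,\mu)\to k[-d]$ with $\langle(d+m)\_,\_\rangle$ cyclically symmetric. $(CH_*(\mathcal{C}),d_{Hoch})$ is the Hochschild chain complex, $B$ Connes' operator, $u$ a formal variable of homological degree $-2$, $\langle\_,\_\rangle_{Muk}$ the (chain-level) Mukai pairing; $\mathcal{H}=(CH_*(\mathcal{C})[u^{-1}][d-2])^{-*}$ ($-*$: reversed grading); the underlying graded algebra of $\mathcal{F}^c(\mathcal{C})$ is $Sym(\mathcal{H})\llbracket\gamma\rrbracket$, $|\gamma|=6-2d$ ($|\gamma|$ even). The product $\cdot$ and multiplication by $\gamma$ are those of this algebra. Splitting: a chain map $s:(CH_*(\mathcal{C}),d_{Hoch})\to(CH_*(\mathcal{C})\llbracket u\rrbracket,d_{Hoch}+uB)$ which is the identity modulo $u$. Write its $u$-linear extension as $R=\mathrm{id}+R_1u+R_2u^2+\cdots$ and $T=R^{-1}=\mathrm{id}+T_1u+\cdots$; $H_s(\alpha u^{-i},\beta u^{-j})=(-1)^j\sum_{l=0}^j\langle R_lT_{i+j+1-l}\alpha,\beta\rangle_{Muk}$, and $H^{sym}_s:\mathcal{H}^{\otimes2}\to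 k[6-2d]$ is its graded symmetrization, an even graded symmetric bilinear form. Taylor coefficients: $\mathcal{K}_s^m:Sym^m(\mathcal{F}^c(\mathcal{C})[6-2d])\to\mathcal{F}^c(\mathcal{C})[6-2d]$ is $\mathcal{K}^m_s=\sum_{g,n}\sum_{(G,f)}\frac1{|Aut(G,f)|}K_{(G,f)}$, the sum over isomorphism classes of connected marked labeled graphs: graphs $G$ with $n$ leaves and $m$ vertices, a labeling $g(v)\in\mathbb{Z}_{\ge0}$ of the vertices such that $g=\sum_vg(v)+\mathrm{rank}\,H_1(G)$, and a bijection $f:\{1,\dots,m\}\to V_G$ (isomorphisms preserve labels and markings). $K_{(G,f)}(y_1\gamma^{g_1},\dots,y_m\gamma^{g_m})=Z\gamma^g$ is non-zero only if $g_i=g(f(i))$ and $y_i\in Sym^{n_i}(\mathcal{H})$ where $n_i$ is the valence (number of half-edges) of $f(i)$. Then $Z$ is computed as follows: decorate the half-edges at $f(i)$ by the desymmetrization $\sum_{\sigma\in S_{n_i}}\pm x_{\sigma(1)}\otimes\cdots\otimes x_{\sigma(n_i)}$ of $y_i=x_1\cdots x_{n_i}$, tensor over $i=1,\dots,m$ in this order, contract for every internal edge the two corresponding tensor components (moved to the front with Koszul signs) by $H^{sym}_s$, and project the remaining components, at the leaves, to $Sym^n(\mathcal{H})$ (with the appropriate shift). *)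

(* Defs.v *)
From HB Require Import structures.
From mathcomp Require Import all_boot all_order perm all_algebra.
From mathcomp Require Import zify finmap boolp classical_sets functions fsbigop.
From mathcomp Require Import generic_quotient ring_quotient monalg.

Set Implicit Arguments.
Unset Strict Implicit.
Unset Printing Implicit Defensive.

Import Order.TTheory GRing.Theory Num.Theory.
Local Open Scope ring_scope.

Section Span.
Variables (k : fieldType) (M : lmodType k) (S : M -> Prop).

Inductive lspan : M -> Prop :=
| span0 : lspan 0
| spanD c r x : S r -> lspan x -> lspan (c *: r + x).

Lemma spanDD x y : lspan x -> lspan y -> lspan (x + y).
Proof.
by elim=> [|c r z Sr _ IH] Hy; rewrite ?add0r // -addrA; exact: spanD (IH Hy).
Qed.

Lemma spanZ a x : lspan x -> lspan (a *: x).
Proof.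
elim=> [|c r z Sr _ IH]; first by rewrite scaler0; exact: span0.
by rewrite scalerDr scalerA; exact: spanD.
Qed.

Lemma span_gen r : S r -> lspan r.
Proof. by move=> Sr; rewrite -[r]addr0 -[X in X + _]scale1r; apply: spanD span0. Qed.

Definition span_pred : {pred M} := fun x => `[< lspan x >].

Lemma span_zmod_closed : zmod_closed span_pred.
Proof.
split; first exact/asboolP/span0.
move=> x y /asboolP Hx /asboolP Hy; apply/asboolP/spanDD => //.
by rewrite -scaleN1r; exact: spanZ.
Qed.

HB.instance Definition _ := GRing.isZmodClosed.Build M span_pred span_zmod_closed.

(* the quotient [M / lspan S] *)
Definition quotmod : Type := Quotient.quot span_pred.
HB.instance Definition _ := GRing.Zmodule.on quotmod.

Definition qpi (x : M) : quotmod := (\pi_(Quotient.quot span_pred) x)%qT.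
Definition qrepr (y : quotmod) : M := repr (y : Quotient.quot span_pred).

Lemma qreprK y : qpi (qrepr y) = y.
Proof. exact: reprK. Qed.

Lemma qpi_eq x y : (qpi x = qpi y) <-> lspan (x - y).
Proof.
rewrite /qpi; split.
  by move/eqP; rewrite -Quotient.idealrBE => /asboolP.
by move=> Hxy; apply/eqP; rewrite -Quotient.idealrBE; apply/asboolP.
Qed.

Lemma qpiB x y : qpi (x - y) = qpi x - qpi y.
Proof. by rewrite /qpi (raddfB (\pi_(Quotient.quot span_pred)%qT)). Qed.

Lemma qpiD x y : qpi (x + y) = qpi x + qpi y.
Proof. by rewrite /qpi (raddfD (\pi_(Quotient.quot span_pred)%qT)). Qed.

Definition qscale (c : k) (y : quotmod) : quotmod := qpi (c *: qrepr y).

Lemma qscale_pi c x : qscale c (qpi x) = qpi (c *: x).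
Proof.
by apply/qpi_eq; rewrite -scalerBr; apply/spanZ/qpi_eq; rewrite qreprK.
Qed.

Fact qscaleA a b y : qscale a (qscale b y) = qscale (a * b) y.
Proof. by rewrite -[y]qreprK !qscale_pi scalerA. Qed.
Fact qscale1 : left_id 1 qscale.
Proof. by move=> y; rewrite -[y]qreprK qscale_pi scale1r. Qed.
Fact qscaleDr : right_distributive qscale +%R.
Proof.
by move=> a x y; rewrite -[x]qreprK -[y]qreprK -qpiD !qscale_pi scalerDr qpiD.
Qed.
Fact qscaleDl y : {morph qscale^~ y : a b / a + b}.
Proof. by move=> a b; rewrite -[y]qreprK !qscale_pi scalerDl qpiD. Qed.

HB.instance Definition _ :=
  GRing.Zmodule_isLmodule.Build k quotmod qscaleA qscale1 qscaleDr qscaleDl.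

Lemma qpi_linear : linear qpi.
Proof. by move=> c x y; rewrite qpiD -qscale_pi. Qed.

End Span.

Section Presented.
Variables (k : fieldType) (X : choiceType).

Definition linext (M : lmodType k) (F : X -> M) (g : {malg k[X]}) : M :=
  \sum_(x <- msupp g) g@_x *: F x.

Lemma linextEw (M : lmodType k) (F : X -> M) (D : {fset X}) g :
  (msupp g `<=` D)%fset -> linext F g = \sum_(x <- D) g@_x *: F x.
Proof.
move=> sub; rewrite /linext [RHS](big_fsetID _ (mem (msupp g))) /=.
rewrite [X in _ = _ + X]big1_fset ?addr0 => [|x]; last first.
  by rewrite !inE /= => /andP[_] /mcoeff_outdom ->; rewrite scale0r.
apply: eq_fbigl => x; rewrite !inE /=.
by case: (boolP (x \in msupp g)) => [/(fsubsetP sub) ->|]; rewrite ?andbF.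
Qed.

Lemma linext_linear (M : lmodType k) (F : X -> M) : linear (linext F).
Proof.
move=> c g1 g2; pose D := (msupp g1 `|` msupp g2)%fset.
have s1 : (msupp g1 `<=` D)%fset by exact: fsubsetUl.
have s2 : (msupp g2 `<=` D)%fset by exact: fsubsetUr.
have s3 : (msupp (c *: g1 + g2) `<=` D)%fset.
  apply: fsubset_trans (msuppD_le _ _) _; apply: fsetSU; exact: msuppZ_le.
rewrite !(linextEw F s1, linextEw F s2, linextEw F s3) scaler_sumr -big_split.
by apply: eq_bigr => x _; rewrite mcoeffD mcoeffZ scalerDl scalerA.
Qed.

HB.instance Definition _ (M : lmodType k) (F : X -> M) :=
  GRing.isLinear.Build k {malg k[X]} M _ (linext F) (linext_linear F).

Lemma linextU (M : lmodType k) (F : X -> M) x : linext F << x >> = F x.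
Proof.
rewrite (linextEw F (msuppU_le)) big_seq_fset1 mcoeffUU.
by rewrite scale1r.
Qed.

Variable rel : {malg k[X]} -> Prop.

Definition pgen (x : X) : quotmod rel := qpi rel << x >>.

(* The linear map out of the presented module with prescribed values F on the
   generators; it is meaningful when F is compatible with the relations. *)
Definition plift (M : lmodType k) (F : X -> M) (y : quotmod rel) : M :=
  linext F (qrepr y).

Definition compatible (M : lmodType k) (F : X -> M) :=
  forall r, rel r -> linext F r = 0.

Section Compatible.
Variables (M : lmodType k) (F : X -> M).
Hypothesis Fr : compatible F.

Lemma plift_pi g : plift F (qpi rel g) = linext F g.
Proof.
have ker x : lspan rel x -> linext F x = 0.
  by elim=> [|c r z Rr _ IH]; rewrite ?linear0 // linearP /= Fr // scaler0 add0r.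
apply/eqP; rewrite /plift -subr_eq0 -linearB; apply/eqP/ker/qpi_eq.
exact: qreprK.
Qed.

Lemma plift_linear : linear (plift F).
Proof.
move=> c x y; rewrite -[x]qreprK -[y]qreprK -qpi_linear !plift_pi.
exact: linearP.
Qed.

Lemma plift_gen x : plift F (pgen x) = F x.
Proof. by rewrite plift_pi linextU. Qed.

End Compatible.

End Presented.

(* (-1)^p for an integer p *)
Definition ksgn (k : fieldType) (p : int) : k := (-1) ^+ `|p|%N.

Section Arrows.
Variables (k : fieldType) (Ob : choiceType) (mor : Ob -> Ob -> int -> vectType k).

(* homogeneous morphisms, tagged by source, target and degree *)
Definition arrow := {t : Ob * Ob * int & mor t.1.1 t.1.2 t.2}.
HB.instance Definition _ := Choice.on arrow.

Definition arr X Y p (a : mor X Y p) : arrow :=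
  existT (fun t : Ob * Ob * int => mor t.1.1 t.1.2 t.2) (X, Y, p) a.

Definition src (a : arrow) : Ob := (tag a).1.1.
Definition tgt (a : arrow) : Ob := (tag a).1.2.
Definition deg (a : arrow) : int := (tag a).2.

(* degree in Hom[1], and its sum over a word *)
Definition sdeg (a : arrow) : int := deg a - 1.
Definition wsdeg (w : seq arrow) : int := \sum_(a <- w) sdeg a.

Definition composable (a b : arrow) : bool := tgt a == src b.

Definition string_from_to (w : seq arrow) (X Y : Ob) : bool :=
  if w is a :: w' then
    [&& path composable a w', src a == X & tgt (last a w') == Y]
  else false.

(* degree of m_n(a_1, ..., a_n) in Hom: |a_1| + ... + |a_n| + 2 - n *)
Definition odeg (w : seq arrow) : int := wsdeg w + 2.

Variable mu : seq arrow -> forall (X Y : Ob) (p : int), mor X Y p.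

(* m_n(a_1, ..., a_n), as a word with one letter *)
Definition mword (w : seq arrow) : seq arrow :=
  if w is a :: w' then [:: arr (mu w (src a) (tgt (last a w')) (odeg w))]
  else [::].

Definition multilinear_ops : Prop :=
  forall (u v : seq arrow) X Y p (c : k) (a b : mor X Y p) X' Y' q,
    mu (u ++ arr (c *: a + b) :: v) X' Y' q =
    c *: mu (u ++ arr a :: v) X' Y' q + mu (u ++ arr b :: v) X' Y' q.

Definition supported_ops : Prop :=
  forall w X Y p, mu w X Y p != 0 -> string_from_to w X Y && (p == odeg w).

(* (d + m)^2 = 0 on the bar construction *)
Definition ainf_relations : Prop :=
  forall w X Y p,
    \sum_(i < size w) \sum_(n < (size w).+1 | (0 < n)%N && (i + n <= size w)%N)
      ksgn k (wsdeg (take i w)) *: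
        mu (take i w ++ mword (take n (drop i w)) ++ drop (i + n) w) X Y p = 0.

Variable uid : forall X : Ob, mor X X 0.

Definition strict_units : Prop :=
  (forall X Y p (a : mor X Y p),
     mu [:: arr (uid X); arr a] X Y p = a /\
     mu [:: arr a; arr (uid Y)] X Y p = ksgn k p *: a) /\
  (forall (u v : seq arrow) Z X Y p, size (u ++ v) != 1%N ->
     mu (u ++ arr (uid Z) :: v) X Y p = 0).

Variable cpair : forall (X Y : Ob) (p q : int), mor X Y p -> mor Y X q -> k.

(* The functional <(d+m)(a_1, ..., a_n), b> on words of Hom[1]; the sign comes
   from shifting the pairing of Hom to one of Hom[1]. *)
Definition cyc_functional (d : int) (w : seq arrow) (b : arrow) : k :=
  ksgn k (d - deg b - 1) *
    cpair (mu w (tgt b) (src b) (d - deg b)) (tagged b).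

Definition cyclically_symmetric (d : int) : Prop :=
  forall (a : arrow) (w : seq arrow) (b : arrow),
    cyc_functional d (a :: w) b =
    ksgn k (sdeg a * (wsdeg w + sdeg b)) * cyc_functional d (rcons w b) a.

End Arrows.

(* [mu w X Y p] is the component in Hom_p(X, Y) of b(a_1, ..., a_n), for
   w = [:: a_1; ...; a_n] with a_i in Hom(X_(i-1), X_i): the internal
   differential d for n = 1 and m_n for n >= 2, as operations of degree 1 on
   Hom[1].  It vanishes except for composable words and in the one component
   where the value lives ([mu_supported]); in particular there is no m_0.
   Homs are finite-dimensional, as the chain-level Mukai pairing is a trace over
   them, and units are strict, as Connes' operator inserts them.  The cyclic
   symmetry for n = 1 says that the pairing is a chain map. *)
Record cyclicAinf (k : fieldType) (d : int) := CyclicAinf {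
  Ob : choiceType;
  mor : Ob -> Ob -> int -> vectType k;
  mor_bounded : forall X Y, exists N : nat,
    forall p : int, (N < `|p|)%N -> \dim {:mor X Y p} = 0%N;
  mu : seq (arrow mor) -> forall (X Y : Ob) (p : int), mor X Y p;
  mu_multilinear : multilinear_ops mu;
  mu_supported : supported_ops mu;
  mu_ainf : ainf_relations mu;
  uid : forall X, mor X X 0;
  mu_unit : strict_units mu uid;
  cpair : forall (X Y : Ob) (p q : int), mor X Y p -> mor Y X q -> k;
  pair_linearl : forall X Y p q (b : mor Y X q),
    linear_for *%R (fun a : mor X Y p => cpair a b);
  pair_deg : forall X Y p q (a : mor X Y p) (b : mor Y X q),
    cpair a b != 0 -> p + q = d;
  pair_sym : forall X Y p q (a : mor X Y p) (b : mor Y X q),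
    cpair a b = ksgn k (p * q) * cpair b a;
  pair_nondeg : forall X Y p (a : mor X Y p),
    (forall q (b : mor Y X q), cpair a b = 0) -> a = 0;
  mu_cyclic : cyclically_symmetric mu cpair d
}.

Arguments mu {k d} c w X Y p.
Arguments uid {k d} c X.

Section Hochschild.
Variables (k : fieldType) (d : int) (C : cyclicAinf k d).
Local Notation arrow := (arrow (@mor k d C)).
Local Notation mw := (mword (mu C)).

(* a_0|a_1|...|a_n closes up to a cycle *)
Definition cyc_composable (w : seq arrow) : bool :=
  (w != [::]) && cycle (@composable _ _ _) w.

(* CH_*(C) is spanned by the words a_0|a_1|...|a_n, multilinear in the
   letters; words which are not cyclically composable are set to 0. *)
Inductive CHrel : {malg k[seq arrow]} -> Prop :=
| CH_lin (u v : seq arrow) X Y p (c : k) (a b : mor X Y p) :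
    CHrel (<< u ++ arr (c *: a + b) :: v >> - c *: << u ++ arr a :: v >>
             - << u ++ arr b :: v >>)
| CH_cyc w : ~~ cyc_composable w -> CHrel << w >>.

Definition CH : lmodType k := quotmod CHrel.
Definition chw (w : seq arrow) : CH := pgen CHrel w.

(* homological degree n - |a_0| - ... - |a_n| of a_0|a_1|...|a_n *)
Definition hdeg (w : seq arrow) : int := - wsdeg w - 1.
Definition CHgr (p : int) : CH -> Prop :=
  lspan (fun x => exists2 w, hdeg w = p & x = chw w).

(* Koszul sign of the rotation [rotr r w], letters being in Hom[1] *)
Definition rotsgn (r : nat) (w : seq arrow) : k :=
  ksgn k (wsdeg (drop (size w - r) w) * wsdeg (take (size w - r) w)).

(* First sum: operations not involving a_0.  Second sum: operations involving
   a_0, whose inputs are rotated to the front. *)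
Definition dHoch_word (w : seq arrow) : CH :=
  (\sum_(i < size w | (0 < i)%N)
     \sum_(n < (size w).+1 | (0 < n)%N && (i + n <= size w)%N)
       ksgn k (wsdeg (take i w)) *:
         chw (take i w ++ mw (take n (drop i w)) ++ drop (i + n) w))
  + \sum_(r < size w) \sum_(n < (size w).+1 | (r < n)%N)
       rotsgn r w *: chw (mw (take n (rotr r w)) ++ drop n (rotr r w)).

Definition dHoch : CH -> CH := plift dHoch_word.

Definition cons_unit (w : seq arrow) : seq arrow :=
  if w is a :: _ then arr (uid C (src a)) :: w else [::].

(* B = (1 - t) s N, with N the sum of the signed rotations, s the insertion of a
   unit in front and t the signed rotation *)
Definition connesB_word (w : seq arrow) : CH :=
  \sum_(r < size w)
    let v := cons_unit (rotr r w) in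
    rotsgn r w *: (chw v - rotsgn 1 v *: chw (rotr 1 v)).

Definition connesB : CH -> CH := plift connesB_word.

Definition endo_trace (V : vectType k) (f : V -> V) : k :=
  \sum_(i < \dim {:V}) coord (vbasis {:V}) i (f (vbasis {:V})`_i).

(* The supertrace over c in Hom(X, Y) of
     c |-> m(A_1, m(A_2, c, B_1), B_2),  A = A_1 A_2,  B = B_1 B_2,
   with A_1 and B_1 of lengths i and j, and X and Y the first objects of A and
   B; the signs are those of moving c past B, m past A_1, and the supertrace. *)
Definition muk_trace (A : seq arrow) (i : nat) (B : seq arrow) (j : nat) : k :=
  if A is a :: _ then if B is b :: _ then
    \sum_(e \in [set: int])
      ksgn k ((e - 1) * wsdeg B + wsdeg (take i A) + (e - 1)) *
      endo_trace (fun c : mor (src a) (src b) e =>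
        mu C (take i A ++ mw (drop i A ++ arr c :: take j B) ++ drop j B)
          (src a) (src b) e)
  else 0 else 0.

(* Sum over all rotations A of a_0|...|a_n and B of b_0|...|b_m, and all
   splittings such that A_1 contains a_0 and B_1 contains b_0.  The factor
   (-1)^|w| makes this a chain map for the grading of CH. *)
Definition mukai_word (w v : seq arrow) : k :=
  \sum_(r < size w) \sum_(i < (size w).+1 | (r < i)%N)
  \sum_(q < size v) \sum_(j < (size v).+1 | (q < j)%N)
    ksgn k (wsdeg w) * rotsgn r w * rotsgn q v *
      muk_trace (rotr r w) i (rotr q v) j.

Definition mukai (x y : CH) : k :=
  plift (M := k^o) (fun w => plift (M := k^o) (mukai_word w) y) x.

End Hochschild.

(* The formulas for d_Hoch, B and the Mukai pairing respect the relations of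
   CH_*(C): see dHoch_compatible, B_compatible and mukai_words below. *)
Section WellDefined.
Variables (k : fieldType) (d : int) (C : cyclicAinf k d).
Local Notation arrow := (arrow (@mor k d C)).
Local Notation mw := (mword (mu C)).
Implicit Types w u v : seq arrow.

Definition lin3 (c : k) w w1 w2 :=
  exists u v X Y p (a b : @mor k d C X Y p),
    [/\ w = u ++ arr (c *: a + b) :: v, w1 = u ++ arr a :: v & w2 = u ++ arr b :: v].

Lemma lin3_cat c l r w w1 w2 :
  lin3 c w w1 w2 -> lin3 c (l ++ w ++ r) (l ++ w1 ++ r) (l ++ w2 ++ r).
Proof.
move=> [u [v [X [Y [p [a [b [-> -> ->]]]]]]]].
by exists (l ++ u), (v ++ r), X, Y, p, a, b; split; rewrite -!catA.
Qed.
Lemma lin3_catl c l w w1 w2 : lin3 c w w1 w2 -> lin3 c (l ++ w) (l ++ w1) (l ++ w2).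
Proof. by move=> /(@lin3_cat c l [::]); rewrite !cats0. Qed.
Lemma lin3_catr c r w w1 w2 : lin3 c w w1 w2 -> lin3 c (w ++ r) (w1 ++ r) (w2 ++ r).
Proof. exact: (@lin3_cat c [::] r). Qed.

Lemma lin3_split c w w1 w2 n : lin3 c w w1 w2 ->
  (lin3 c (take n w) (take n w1) (take n w2) /\ drop n w1 = drop n w /\ drop n w2 = drop n w)
  \/ (take n w1 = take n w /\ take n w2 = take n w /\ lin3 c (drop n w) (drop n w1) (drop n w2)).
Proof.
move=> [u [v [X [Y [p [a [b [-> -> ->]]]]]]]].
case: (leqP n (size u)) => Hn.
  right; rewrite !takel_cat //; split=> //; split=> //.
  rewrite !drop_cat; move: Hn; rewrite leq_eqVlt => /orP[/eqP->|->].
    by rewrite ltnn subnn !drop0; exists [::], v, X, Y, p, a, b.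
  by exists (drop n u), v, X, Y, p, a, b.
left; rewrite !take_cat !drop_cat ltnNge (ltnW Hn) /=.
case: (n - size u)%N (subn_gt0 (size u) n) => [|q _] /=; first by rewrite Hn.
by split=> //; exists u, (take q v), X, Y, p, a, b.
Qed.

Lemma lin3_size c w w1 w2 : lin3 c w w1 w2 -> size w1 = size w /\ size w2 = size w.
Proof. by move=> [u [v [X [Y [p [a [b [-> -> ->]]]]]]]]; rewrite !size_cat. Qed.
Lemma lin3_wsdeg c w w1 w2 : lin3 c w w1 w2 -> wsdeg w1 = wsdeg w /\ wsdeg w2 = wsdeg w.
Proof.
move=> [u [v [X [Y [p [a [b [-> -> ->]]]]]]]].
by rewrite /wsdeg !big_cat !big_cons.
Qed.

Lemma lin3_single c X Y p (e a b : @mor k d C X Y p) : e = c *: a + b ->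
  lin3 c [:: arr e] [:: arr a] [:: arr b].
Proof. by move=> ->; exists [::], [::], X, Y, p, a, b. Qed.

Lemma lin3_mw c w w1 w2 : lin3 c w w1 w2 -> lin3 c (mw w) (mw w1) (mw w2).
Proof.
move=> H; have [d1 d2] := lin3_wsdeg H; move: d1 d2.
move: H => [u [v [X [Y [p [a [b [E E1 E2]]]]]]]] d1 d2.
case: u E E1 E2 => [|z u] /= E E1 E2; subst; rewrite /mword /= /odeg ?d1 ?d2.
  set q := wsdeg _ + 2; rewrite /odeg in q *.
  have -> : tgt (last (arr a) v) = tgt (last (arr (c *: a + b)) v) by case: (v).
  have -> : tgt (last (arr b) v) = tgt (last (arr (c *: a + b)) v) by case: (v).
  by apply: lin3_single; exact: (mu_multilinear [::] v c a b).
rewrite !last_cat /=.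
have -> : tgt (last (arr a) v) = tgt (last (arr (c *: a + b)) v) by case: (v).
have -> : tgt (last (arr b) v) = tgt (last (arr (c *: a + b)) v) by case: (v).
by apply: lin3_single; exact: (mu_multilinear (z :: u) v c a b).
Qed.

Lemma lin3_rotr c r w w1 w2 : lin3 c w w1 w2 -> lin3 c (rotr r w) (rotr r w1) (rotr r w2).
Proof.
move=> H; have [s1 s2] := lin3_size H; rewrite /rotr s1 s2 /rot.
case: (lin3_split (size w - r) H) => [[H1 [-> ->]]|[-> [-> H1]]].
  exact: lin3_catl.
exact: lin3_catr.
Qed.

Lemma lin3_take_wsdeg c n w w1 w2 : lin3 c w w1 w2 ->
  wsdeg (take n w1) = wsdeg (take n w) /\ wsdeg (take n w2) = wsdeg (take n w).
Proof.
by move=> /(lin3_split n)[[/lin3_wsdeg H _]|[-> [-> _]]].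
Qed.
Lemma lin3_drop_wsdeg c n w w1 w2 : lin3 c w w1 w2 ->
  wsdeg (drop n w1) = wsdeg (drop n w) /\ wsdeg (drop n w2) = wsdeg (drop n w).
Proof.
by move=> /(lin3_split n)[[_ [-> ->]]|[_ [_ /lin3_wsdeg H]]].
Qed.

Lemma lin3_rotsgn c r w w1 w2 : lin3 c w w1 w2 ->
  rotsgn r w1 = rotsgn r w /\ rotsgn r w2 = rotsgn r w.
Proof.
move=> H; have [s1 s2] := lin3_size H; rewrite /rotsgn s1 s2.
by have [-> ->] := lin3_take_wsdeg (size w - r) H; have [-> ->] := lin3_drop_wsdeg (size w - r) H.
Qed.

Lemma chw_lin3 c w w1 w2 : lin3 c w w1 w2 -> chw w = c *: chw w1 + chw w2.
Proof.
move=> [u [v [X [Y [p [a [b [-> -> ->]]]]]]]].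
rewrite /chw /pgen -qpi_linear; apply/qpi_eq.
by rewrite opprD addrA; apply/span_gen/CH_lin.
Qed.
Lemma chw_cyc w : ~~ cyc_composable w -> chw w = 0.
Proof.
move=> H; have E : qpi (@CHrel k d C) 0 = 0 by rewrite -(subrr 0) qpiB subrr.
by rewrite /chw /pgen -E; apply/qpi_eq; rewrite subr0; exact/span_gen/CH_cyc.
Qed.

Definition goodw (M : lmodType k) (F : seq arrow -> M) :=
  (forall c w w1 w2, lin3 c w w1 w2 -> F w = c *: F w1 + F w2) /\
  (forall w, ~~ cyc_composable w -> F w = 0).

Lemma goodw_compatible (M : lmodType k) (F : seq arrow -> M) :
  goodw F -> compatible (@CHrel k d C) F.
Proof.
move=> [H1 H2] _ [u v X Y p c a b|w Hw].
  rewrite !linearB linearZ /= !linextU (H1 c _ (u ++ arr a :: v) (u ++ arr b :: v)).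
    by rewrite -addrA -opprD subrr.
  by exists u, v, X, Y, p, a, b.
by rewrite linextU H2.
Qed.

Lemma lin3_insert c i n w w1 w2 : lin3 c w w1 w2 ->
  let f w := take i w ++ mw (take n (drop i w)) ++ drop (i + n) w in
  lin3 c (f w) (f w1) (f w2).
Proof.
move=> H /=; rewrite !(addnC i n) -!drop_drop.
case: (lin3_split i H) => [[H1 [-> ->]]|[-> [-> H1]]]; first exact: lin3_catr.
apply: lin3_catl; case: (lin3_split n H1) => [[H2 [-> ->]]|[-> [-> H2]]].
  exact/lin3_catr/lin3_mw.
exact: lin3_catl.
Qed.

Lemma lin3_front c n w w1 w2 : lin3 c w w1 w2 ->
  let f w := mw (take n w) ++ drop n w in
  lin3 c (f w) (f w1) (f w2).
Proof.
move=> H; have := lin3_insert 0 n H.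
by rewrite /= !take0 !drop0.
Qed.

Lemma sum_lin (I : Type) (r : seq I) (P : pred I) (M : lmodType k) c (f f1 f2 : I -> M) :
  (forall i, f i = c *: f1 i + f2 i) ->
  \sum_(i <- r | P i) f i = c *: (\sum_(i <- r | P i) f1 i) + \sum_(i <- r | P i) f2 i.
Proof.
by move=> H; rewrite scaler_sumr -big_split; apply: eq_bigr => i _; exact: H.
Qed.

Lemma dHoch_lin c w w1 w2 : lin3 c w w1 w2 ->
  dHoch_word w = c *: dHoch_word w1 + dHoch_word w2.
Proof.
move=> H; have [s1 s2] := lin3_size H; rewrite /dHoch_word s1 s2.
rewrite scalerDr addrACA; congr (_ + _).
  apply: sum_lin => i; apply: sum_lin => n.
  have [-> ->] := lin3_take_wsdeg i H.
  by rewrite (chw_lin3 (lin3_insert i n H)) scalerDr scalerA mulrC -scalerA.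
apply: sum_lin => r; apply: sum_lin => n.
have [-> ->] := lin3_rotsgn r H.
by rewrite (chw_lin3 (lin3_front n (lin3_rotr r H))) scalerDr scalerA mulrC -scalerA.
Qed.

Lemma lin3_cons_unit c w w1 w2 : lin3 c w w1 w2 ->
  lin3 c (cons_unit w) (cons_unit w1) (cons_unit w2).
Proof.
move=> [u [v [X [Y [p [a [b [-> -> ->]]]]]]]].
case: u => [|z u] /=.
  by exists [:: arr (uid C X)], v, X, Y, p, a, b.
by exists [:: arr (uid C (src z)), z & u], v, X, Y, p, a, b.
Qed.

Lemma B_lin c w w1 w2 : lin3 c w w1 w2 ->
  connesB_word w = c *: connesB_word w1 + connesB_word w2.
Proof.
move=> H; have [s1 s2] := lin3_size H; rewrite /connesB_word s1 s2.
apply: sum_lin => r /=; have [-> ->] := lin3_rotsgn r H.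
have H1 := lin3_cons_unit (lin3_rotr r H).
have [-> ->] := lin3_rotsgn 1 H1.
rewrite (chw_lin3 H1) (chw_lin3 (lin3_rotr 1 H1)).
move: (chw _) (chw _) (chw _) (chw _) (rotsgn _ _) (rotsgn _ _) => A1 A2 B1 B2 t1 t2.
rewrite (_ : _ - _ = c *: (B2 - t1 *: A2) + (B1 - t1 *: A1)).
  by rewrite scalerDr !scalerA [c * _]mulrC.
by rewrite scalerBr scalerDr !scalerA [t1 * c]mulrC opprD addrACA.
Qed.

Fixpoint chained (X : Ob C) w (Y : Ob C) : bool :=
  if w is a :: w' then (src a == X) && chained (tgt a) w' Y else X == Y.

Lemma chain_cat X u v Y : chained X (u ++ v) Y -> exists2 Z, chained X u Z & chained Z v Y.
Proof.
elim: u X => [|a u IH] X /=; first by exists X.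
by move=> /andP[-> /IH[Z HZ]]; exists Z.
Qed.
Lemma cat_chain X u v Y Z : chained X u Z -> chained Z v Y -> chained X (u ++ v) Y.
Proof. by elim: u X => [|a u IH] X /=; [move/eqP-> | move=> /andP[-> /IH H] /H]. Qed.

Lemma string_chain X w Y : string_from_to w X Y -> chained X w Y.
Proof.
case: w => //= a w /and3P[P -> /eqP <-] /=.
elim: w a P => [|b w IH] a //= /andP[Hab /IH ->].
by rewrite andbT eq_sym.
Qed.

Lemma chain_cyc X w : w != [::] -> chained X w X -> cyc_composable w.
Proof.
rewrite /cyc_composable; case: w => //= a w _ /andP[/eqP <-].
elim: w {1 3}a => [|b w IH] c //=; first by rewrite andbT.
by move=> /andP[H /IH ->]; rewrite /composable eq_sym H.
Qed.

Lemma cyc_chain w : cyc_composable w -> exists X, chained X w X.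
Proof.
case: w => //= a w /= H; exists (src a) => /=; rewrite eqxx /=.
move: H; rewrite /cyc_composable /=.
elim: w {1 3}a => [|b w IH] c /=; first by rewrite andbT.
by move=> /andP[H /IH ->]; rewrite andbT eq_sym.
Qed.

Lemma chain_rotr r X w : chained X (rotr r w) X -> exists Y, chained Y w Y.
Proof.
rewrite /rotr /rot => /chain_cat[Z H1 H2]; exists Z.
by rewrite -(cat_take_drop (size w - r) w); exact: cat_chain H2 H1.
Qed.

Lemma rotr_cyc r w : cyc_composable (rotr r w) -> cyc_composable w.
Proof.
move=> H; have [X /chain_rotr[Y]] := cyc_chain H; apply: chain_cyc.
by move/andP: H => [H _]; rewrite -size_eq0 -(size_rotr r) size_eq0.
Qed.

Lemma mu_zero u v X Y p A B q : mu C (u ++ arr (0 : @mor k d C X Y p) :: v) A B q = 0.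
Proof.
have := mu_multilinear u v (-1) (0 : @mor k d C X Y p) 0 A B q.
by rewrite scaler0 addr0 scaleN1r addNr.
Qed.
Lemma chw_zero u v X Y p : chw (C:=C) (u ++ arr (0 : @mor k d C X Y p) :: v) = 0.
Proof.
have := @chw_lin3 (-1) (u ++ arr (0 : @mor k d C X Y p) :: v) (u ++ arr (0 : @mor k d C X Y p) :: v) (u ++ arr (0 : @mor k d C X Y p) :: v).
rewrite scaleN1r addNr; apply; exists u, v, X, Y, p, 0, 0.
by split=> //; rewrite scaler0 addr0.
Qed.

Lemma mwP w : w != [::] ->
  (exists P Q q, mw w = [:: arr (0 : @mor k d C P Q q)]) \/
  (exists P Q q (z : @mor k d C P Q q), mw w = [:: arr z] /\ chained P w Q).
Proof.
case: w => // a w _; rewrite /mword.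
have [->|nz] := eqVneq (mu C (a :: w) (src a) (tgt (last a w)) (odeg (a :: w))) 0.
  by left; do 3 eexists.
right; do 4 eexists; split; first reflexivity.
by apply: string_chain; move/mu_supported: nz => /andP[].
Qed.

Lemma insert_zero l seg r : seg != [::] -> ~~ cyc_composable (l ++ seg ++ r) ->
  chw (l ++ mw seg ++ r) = 0.
Proof.
move=> ns; have [[P [Q [q ->]]] _|[P [Q [q [z [-> H]]]]] ncyc] := mwP ns.
  exact: chw_zero.
apply: chw_cyc; apply: contra ncyc => /cyc_chain[X /chain_cat[Z H1 /= /andP[/eqP E H2]]].
apply: (@chain_cyc X).
  by case: l {H1} => //; case: (seg) ns.
rewrite /src /tgt /= in E H2; subst.
exact: cat_chain H1 (cat_chain H H2).
Qed.

Lemma dHoch_good : goodw (@dHoch_word k d C).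
Proof.
split; first exact: dHoch_lin.
move=> w ncyc; rewrite /dHoch_word !big1 ?addr0 // => r.
  move=> _; apply: big1 => n Hn; rewrite -[_ ++ _]cat0s insert_zero ?scaler0 //=.
    rewrite -size_eq0 size_takel ?size_rotr -1?ltnS ?ltn_ord // -lt0n.
    exact: leq_ltn_trans Hn.
  by rewrite cat_take_drop; apply: contra ncyc; exact: rotr_cyc.
move=> r0; apply: big1 => n /andP[n0 Hn].
rewrite insert_zero ?scaler0 //.
  rewrite -size_eq0 size_takel ?size_drop -?lt0n //.
  by rewrite leq_subRL // ltnW.
by rewrite addnC -drop_drop !cat_take_drop.
Qed.

Lemma B_good : goodw (@connesB_word k d C).
Proof.
split; first exact: B_lin.
move=> w ncyc; rewrite /connesB_word big1 // => r _ /=.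
have nv : ~~ cyc_composable (cons_unit (rotr r w)).
  apply: contra ncyc => /cyc_chain[X].
  case E : (rotr r w) => [|a v] /=.
    move=> _; have := congr1 size E; rewrite size_rotr => s0.
    by have := leq_ltn_trans (leq0n r) (ltn_ord r); rewrite s0.
  rewrite /src /tgt /= => /andP[/eqP <-] H.
  apply: (@rotr_cyc r); rewrite E; exact: (@chain_cyc (src a)).
rewrite !chw_cyc ?scaler0 ?subrr ?scaler0 //.
by apply: contra nv; exact: rotr_cyc.
Qed.

Lemma dHoch_compatible : compatible (@CHrel k d C) (@dHoch_word k d C).
Proof. exact/goodw_compatible/dHoch_good. Qed.
Lemma B_compatible : compatible (@CHrel k d C) (@connesB_word k d C).
Proof. exact/goodw_compatible/B_good. Qed.

Definition muk_endo A i B j X Y e : @mor k d C X Y e -> @mor k d C X Y e := fun c =>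
  mu C (take i A ++ mw (drop i A ++ arr c :: take j B) ++ drop j B) X Y e.

Lemma muk_endo_chain A i B j X Y e c : muk_endo A i B j c != 0 :> @mor k d C X Y e ->
  chained X A X /\ chained Y B Y.
Proof.
rewrite /muk_endo.
have ns : drop i A ++ arr c :: take j B != [::] by case: (drop i A).
case: (mwP ns) => [[P [Q [q ->]]]|[P [Q [q [z [-> Hin]]]]]].
  by rewrite cat1s mu_zero eqxx.
move=> /mu_supported/andP[/string_chain/chain_cat[Z H1 /= /andP[/eqP EP H2]] _].
move/chain_cat: Hin => [Z' H3 /= /andP[/eqP EX H4]].
rewrite /src /tgt /= in EP EX H2 H4; subst.
rewrite -{1}(cat_take_drop i A) -{1}(cat_take_drop j B).
by split; [exact: cat_chain H1 H3 | exact: cat_chain H4 H2].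
Qed.

Lemma trace0 (V : vectType k) (f : V -> V) : (forall x, f x = 0) -> endo_trace f = 0.
Proof. by move=> H; rewrite /endo_trace big1 // => i _; rewrite H linear0. Qed.

Lemma trace_lin c (V : vectType k) (f f1 f2 : V -> V) :
  (forall x, f x = c *: f1 x + f2 x) ->
  endo_trace f = c * endo_trace f1 + endo_trace f2.
Proof.
move=> H; rewrite /endo_trace mulr_sumr -big_split; apply: eq_bigr => i _.
by rewrite H linearP.
Qed.

Lemma fsum_lin c X Y (F F1 F2 : int -> k) :
  (forall e, \dim {:@mor k d C X Y e} = 0%N -> [/\ F e = 0, F1 e = 0 & F2 e = 0]) ->
  (forall e, F e = c * F1 e + F2 e) ->
  \sum_(e \in [set: int]) F e =
  c * (\sum_(e \in [set: int]) F1 e) + \sum_(e \in [set: int]) F2 e.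
Proof.
move=> H0 H; have [N HN] := @mor_bounded _ _ C X Y.
pose A : {fset int} := seq_fset tt [seq (n%:Z - N%:Z) | n <- iota 0 (N + N).+1].
have HA e : e \notin A -> [/\ F e = 0, F1 e = 0 & F2 e = 0].
  move=> nA; apply/H0/HN; rewrite ltnNge; apply: contra nA => le.
  rewrite seq_fsetE; apply/mapP; exists (absz (e + N%:Z)); first by rewrite mem_iota; lia.
  lia.
rewrite (@fsbigTE _ _ _ _ A F) ?(@fsbigTE _ _ _ _ A F1) ?(@fsbigTE _ _ _ _ A F2); try by move=> i /HA[].
by rewrite mulr_sumr -big_split; apply: eq_bigr.
Qed.

Lemma lin3_src c a w1 w2 w : lin3 c (a :: w) w1 w2 ->
  exists a1 w1' a2 w2', [/\ w1 = a1 :: w1', w2 = a2 :: w2', src a1 = src a & src a2 = src a].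
Proof.
move=> [u [v [X [Y [p [x [y [E -> ->]]]]]]]].
by case: u E => [|b u] [-> _]; do 4 eexists; split; reflexivity.
Qed.

Lemma mu_lin3 c w w1 w2 X Y e : lin3 c w w1 w2 ->
  mu C w X Y e = c *: mu C w1 X Y e + mu C w2 X Y e.
Proof. by move=> [u [v [X' [Y' [p [a [b [-> -> ->]]]]]]]]; exact: mu_multilinear. Qed.

Lemma trace_dim0 (V : vectType k) (f : V -> V) : \dim {:V} = 0%N -> endo_trace f = 0.
Proof.
by move=> H; rewrite /endo_trace big1 // => i; have := ltn_ord i; rewrite {2}H.
Qed.

Lemma muk_trace_linA c A A1 A2 i B j : lin3 c A A1 A2 ->
  muk_trace A i B j = c * muk_trace A1 i B j + muk_trace A2 i B j.
Proof.
case: A => [|a A] H; first by case: H => [[|? ?] [? [? [? [? [? [? [[]]]]]]]]].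
have [a1 [w1 [a2 [w2 [E1 E2 s1 s2]]]]] := lin3_src H; subst.
case: B => [|b B]; first by rewrite /= mulr0 addr0.
rewrite /muk_trace s1 s2; apply: (@fsum_lin c (src a) (src b)) => e.
  by move=> D0; rewrite !trace_dim0 ?mulr0.
have [-> ->] := lin3_take_wsdeg i H.
rewrite mulrCA -mulrDr; congr (_ * _); apply: trace_lin => x; apply: mu_lin3.
case: (lin3_split i H) => [[H1 [-> ->]]|[-> [-> H1]]]; first exact: lin3_catr.
exact/lin3_catl/lin3_catr/lin3_mw/lin3_catr.
Qed.

Lemma muk_trace_linB c A i B B1 B2 j : lin3 c B B1 B2 ->
  muk_trace A i B j = c * muk_trace A i B1 j + muk_trace A i B2 j.
Proof.
case: A => [|a A] H; first by rewrite /= mulr0 addr0.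
case: B H => [|b B] H; first by case: H => [[|? ?] [? [? [? [? [? [? [[]]]]]]]]].
have [a1 [w1 [a2 [w2 [E1 E2 s1 s2]]]]] := lin3_src H; subst.
rewrite /muk_trace s1 s2; apply: (@fsum_lin c (src a) (src b)) => e.
  by move=> D0; rewrite !trace_dim0 ?mulr0.
have [-> ->] := lin3_wsdeg H.
rewrite mulrCA -mulrDr; congr (_ * _); apply: trace_lin => x; apply: mu_lin3.
apply: lin3_catl; case: (lin3_split j H) => [[H1 [-> ->]]|[-> [-> H1]]].
  apply/lin3_catr/lin3_mw/lin3_catl; exact: (lin3_catl [:: arr x] H1).
exact: lin3_catl.
Qed.

Lemma muk_trace_cyc A i B j :
  ~~ (cyc_composable A && cyc_composable B) -> muk_trace (C := C) A i B j = 0.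
Proof.
case: A => [|a A]; case: B => [|b B] // H.
rewrite /muk_trace fsbig1 // => e _; rewrite trace0 ?mulr0 // => c.
apply/eqP; apply: contraR H => /muk_endo_chain[cA cB].
by rewrite (chain_cyc _ cA) // (chain_cyc _ cB).
Qed.

Lemma sum_linr (I : Type) (r : seq I) (P : pred I) (c : k) (f f1 f2 : I -> k) :
  (forall i, f i = c * f1 i + f2 i) ->
  \sum_(i <- r | P i) f i = c * (\sum_(i <- r | P i) f1 i) + \sum_(i <- r | P i) f2 i.
Proof.
by move=> H; rewrite mulr_sumr -big_split; apply: eq_bigr => i _; exact: H.
Qed.

Lemma mukai_lin1 c w w1 w2 v : lin3 c w w1 w2 ->
  mukai_word w v = c * mukai_word w1 v + mukai_word w2 v.
Proof.
move=> H; have [s1 s2] := lin3_size H; have [d1 d2] := lin3_wsdeg H.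
rewrite /mukai_word s1 s2 d1 d2.
apply: sum_linr => r; apply: sum_linr => i; apply: sum_linr => q; apply: sum_linr => j.
have [-> ->] := lin3_rotsgn r H.
by rewrite (muk_trace_linA _ _ _ (lin3_rotr _ H)) mulrDr mulrCA.
Qed.

Lemma mukai_lin2 c w v v1 v2 : lin3 c v v1 v2 ->
  mukai_word w v = c * mukai_word w v1 + mukai_word w v2.
Proof.
move=> H; have [s1 s2] := lin3_size H.
rewrite /mukai_word s1 s2.
apply: sum_linr => r; apply: sum_linr => i; apply: sum_linr => q; apply: sum_linr => j.
have [-> ->] := lin3_rotsgn q H.
by rewrite (muk_trace_linB _ _ _ (lin3_rotr _ H)) mulrDr mulrCA.
Qed.

Lemma mukai_cyc w v : ~~ (cyc_composable w && cyc_composable v) -> mukai_word (C := C) w v = 0.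
Proof.
move=> H; rewrite /mukai_word; do 4 (apply: big1 => ? _).
rewrite muk_trace_cyc ?mulr0 //; apply: contra H => /andP[].
by move=> /rotr_cyc -> /rotr_cyc ->.
Qed.

Lemma mukai_compatible2 w : compatible (M := k^o) (@CHrel k d C) (mukai_word w).
Proof.
apply: goodw_compatible; split; first by move=> *; exact: mukai_lin2.
by move=> v H; apply: mukai_cyc; rewrite negb_and H orbT.
Qed.

Lemma mukai_compatible1 y :
  compatible (M := k^o) (@CHrel k d C) (fun w => plift (rel := @CHrel k d C) (M := k^o) (mukai_word w) y).
Proof.
apply: goodw_compatible; split.
  move=> c w w1 w2 H; rewrite /plift /linext (@sum_lin _ _ _ k^o c _ (fun x => (qrepr y)@_x *: (mukai_word w1 x : k^o)) (fun x => (qrepr y)@_x *: (mukai_word w2 x : k^o))) //.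
  by move=> x; rewrite (mukai_lin1 _ H) /GRing.scale /= mulrDr mulrCA.
move=> w H; rewrite /plift /linext big1 // => x _.
by rewrite mukai_cyc ?scaler0 // negb_and H.
Qed.

Lemma mukai_words w v : mukai (chw (C := C) w) (chw v) = mukai_word w v.
Proof.
by rewrite /mukai (plift_gen (@mukai_compatible1 _)) (plift_gen (@mukai_compatible2 _)).
Qed.

Lemma mukai_linear1 y : linear_for *%R (mukai (C := C) ^~ y).
Proof. exact: plift_linear (@mukai_compatible1 y). Qed.

End WellDefined.

Section Splitting.
Variables (k : fieldType) (d : int) (C : cyclicAinf k d).

(* s(x) = sum_l R_l(x) u^l, with u of homological degree -2 *)
Record splitting := Splitting {
  spl_R : nat -> {linear CH C -> CH C};
  spl_id : forall x, spl_R 0 x = x;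
  spl_deg : forall l p x, CHgr p x -> CHgr (p + 2 * l%:Z) (spl_R l x);
  spl_chain : forall l x,
    dHoch (spl_R l x) + (if l is l'.+1 then connesB (spl_R l' x) else 0) =
    spl_R l (dHoch x)
}.

Variable s : splitting.

(* T = R^{-1}: T_0 = id and T_n = - sum_(a = 1)^n R_a T_(n - a) *)
Fixpoint spl_T_upto (n : nat) : nat -> CH C -> CH C :=
  if n is n'.+1 then
    let T := spl_T_upto n' in
    fun j => if (j <= n')%N then T j
             else fun x => - \sum_(a < n'.+1) spl_R s a.+1 (T (n' - a)%N x)
  else fun _ x => x.

Definition spl_T (n : nat) : CH C -> CH C := spl_T_upto n n.

End Splitting.

Section UPoly.
Variables (k : fieldType) (M : lmodType k).

(* M[u^{-1}], with [x@_i] the coefficient of u^{-i} *)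
Definition upoly : Type := {malg M[nat]}.
HB.instance Definition _ := GRing.Zmodule.on upoly.
Implicit Types x y : upoly.

Definition uscale (c : k) x : upoly := [malg i in msupp x => c *: x@_i].

Fact uscaleE c x i : (uscale c x)@_i = c *: x@_i.
Proof. by rewrite mcoeffE; case: msuppP; rewrite ?scaler0. Qed.

Fact uscaleA a b x : uscale a (uscale b x) = uscale (a * b) x.
Proof. by apply/malgP => i; rewrite !uscaleE scalerA. Qed.
Fact uscale1 : left_id 1 uscale.
Proof. by move=> x; apply/malgP => i; rewrite uscaleE scale1r. Qed.
Fact uscaleDr : right_distributive uscale +%R.
Proof.
by move=> a x y; apply/malgP => i; rewrite mcoeffD !uscaleE mcoeffD scalerDr.
Qed.
Fact uscaleDl x : {morph uscale^~ x : a b / a + b}.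
Proof.
by move=> a b; apply/malgP => i; rewrite mcoeffD !uscaleE scalerDl.
Qed.
HB.instance Definition _ :=
  GRing.Zmodule_isLmodule.Build k upoly uscaleA uscale1 uscaleDr uscaleDl.

End UPoly.

Section FormH.
Variables (k : fieldType) (d : int) (C : cyclicAinf k d) (s : splitting C).

(* Underlying module of H = (CH_*(C)[u^{-1}][d-2])^{-*}.  If alpha has
   homological degree p, then alpha u^{-i} has degree -(p + 2i + d - 2) in H. *)
Definition Hmod : lmodType k := upoly (CH C).
Definition Hgr (n : int) (x : Hmod) : Prop :=
  forall i : nat, CHgr (2 - d - n - 2 * i%:Z) x@_i.

Definition Hs_mon (alpha : CH C) (i : nat) (beta : CH C) (j : nat) : k :=
  (-1) ^+ j *
    \sum_(l < j.+1) mukai (spl_R s l (spl_T s (i + j + 1 - l)%N alpha)) beta.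

Definition Hs (x y : Hmod) : k :=
  \sum_(i <- msupp x) \sum_(j <- msupp y) Hs_mon x@_i i y@_j j.

End FormH.

(* The Koszul sign of the permutation taking the tensor with factors indexed
   by s to the one with factors indexed by t (s and t list the same indices,
   without repetition; p gives the degrees): the product over inversions. *)
Definition koszul (k : fieldType) (T : eqType) (p : T -> int) (s t : seq T) : k :=
  \prod_(a <- s)
    \prod_(b <- s | (index a s < index b s)%N && (index b t < index a t)%N)
      ksgn k (p a * p b).

Section SymAlg.
Variables (k : fieldType) (V : lmodType k) (gr : int -> V -> Prop).

(* homogeneous elements, tagged by their degree *)
Definition letter := {x : int * V | `[< gr x.1 x.2 >]}.
Definition ldeg (l : letter) : int := (val l).1.
Definition lval (l : letter) : V := (val l).2.

(* SymAlg V is spanned by words in homogeneous elements, multilinear in the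
   letters and graded commutative. *)
Inductive Symrel : {malg k[seq letter]} -> Prop :=
| Sym_lin (u v : seq letter) (c : k) (l l1 l2 : letter) :
    ldeg l1 = ldeg l -> ldeg l2 = ldeg l ->
    lval l = c *: lval l1 + lval l2 ->
    Symrel (<< u ++ l :: v >> - c *: << u ++ l1 :: v >> - << u ++ l2 :: v >>)
| Sym_swap (u v : seq letter) (l1 l2 : letter) :
    Symrel (<< u ++ l1 :: l2 :: v >>
              - ksgn k (ldeg l1 * ldeg l2) *: << u ++ l2 :: l1 :: v >>).

Definition SymAlg : lmodType k := quotmod Symrel.
Definition symw (w : seq letter) : SymAlg := pgen Symrel w.

Definition symmul (x y : SymAlg) : SymAlg :=
  plift (fun w => plift (fun v => symw (w ++ v)) y) x.

Definition Symgr (n : int) : SymAlg -> Prop :=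
  lspan (fun x => exists2 w, \sum_(l <- w) ldeg l = n & x = symw w).

(* Multilinear extension of a function of tuples of words; the tuple of
   arguments is a list. *)
Fixpoint multilift (F : seq (seq letter) -> SymAlg) (ys : seq SymAlg) : SymAlg :=
  if ys is y :: ys' then plift (fun w => multilift (fun ws => F (w :: ws)) ys') y
  else F [::].

(* SymAlg(V)[[gamma]] *)
Definition pser : lmodType k := nat -> SymAlg.
Definition psmul (x y : pser) : pser :=
  fun g => \sum_(i < g.+1) symmul (x i) (y (g - i)%N).
Definition psgamma (x : pser) : pser := fun g => if g is g'.+1 then x g' else 0.

End SymAlg.

(* Half-edges 'I_h, vertices 'I_m; each half-edge is attached to a vertex; the
   2-cycles of the involution are the internal edges and its fixed points the
   leaves; the labels are < N; the marking f : [m] -> V_G is a bijection. *)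
Record mgraph (h m N : nat) := MGraph {
  mg_at : {ffun 'I_h -> 'I_m};
  mg_inv : {ffun 'I_h -> 'I_h};
  mg_label : {ffun 'I_m -> 'I_N};
  mg_mark : {perm 'I_m}
}.

Section MGraphFin.
Variables h m N : nat.
Local Notation code :=
  ({ffun 'I_h -> 'I_m} * {ffun 'I_h -> 'I_h} * {ffun 'I_m -> 'I_N} *
   {perm 'I_m})%type.
Definition mg_encode (G : mgraph h m N) : code :=
  (mg_at G, mg_inv G, mg_label G, mg_mark G).
Definition mg_decode (c : code) : mgraph h m N :=
  let: (a, i, l, f) := c in MGraph a i l f.
Fact mg_encodeK : cancel mg_encode mg_decode.
Proof. by case. Qed.
HB.instance Definition _ := Finite.copy (mgraph h m N) (can_type mg_encodeK).
End MGraphFin.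

Section Graphs.
Variables h m N : nat.
Implicit Types G : mgraph h m N.

Definition mg_valence G (v : 'I_m) : nat := #|[set e : 'I_h | mg_at G e == v]|.

Definition mg_adj G : rel 'I_m :=
  fun v w => [exists e, (mg_at G e == v) && (mg_at G (mg_inv G e) == w)].

Definition mg_connected G : bool := [forall v, forall w, connect (mg_adj G) v w].

(* each internal edge is represented by the smaller of its two half-edges *)
Definition mg_edges G : {set 'I_h} := [set e : 'I_h | (e < mg_inv G e)%N].

(* the cellular boundary map Q^E -> Q^V, acting on row vectors *)
Definition mg_boundary G : 'M[rat]_(#|mg_edges G|, m) :=
  \matrix_(i, v) ((mg_at G (mg_inv G (enum_val i)) == v)%:R
                    - (mg_at G (enum_val i) == v)%:R).

(* rank H_1(G) *)
Definition mg_b1 G : nat := \rank (kermx (mg_boundary G)).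

Definition mg_genus G : nat := (\sum_v mg_label G v + mg_b1 G)%N.

Definition mg_iso_set G G' : {set {perm 'I_h} * {perm 'I_m}} :=
  [set p : {perm 'I_h} * {perm 'I_m} | [&& [forall e, mg_at G' (p.1 e) == p.2 (mg_at G e)],
               [forall e, mg_inv G' (p.1 e) == p.1 (mg_inv G e)],
               [forall v, mg_label G' (p.2 v) == mg_label G v]
             & [forall i, mg_mark G' i == p.2 (mg_mark G i)]]].

Definition mg_iso : rel (mgraph h m N) := fun G G' => (0 < #|mg_iso_set G G'|)%N.
Definition mg_aut_card G : nat := #|mg_iso_set G G|.

Definition mg_of_genus (g : nat) : {set mgraph h m N} :=
  [set G | [&& [forall e, mg_inv G (mg_inv G e) == e], mg_connected G
             & mg_genus G == g]].

(* one graph in each isomorphism class *)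
Definition mg_classes (g : nat) : {set mgraph h m N} :=
  transversal (equivalence_partition mg_iso (mg_of_genus g)) (mg_of_genus g).

(* the half-edges at f(1), then those at f(2), ... *)
Definition mg_half_edges G : seq 'I_h :=
  flatten [seq [seq e <- enum 'I_h | mg_at G e == mg_mark G i] | i <- enum 'I_m].

Definition mg_leaves G : seq 'I_h := [seq e <- mg_half_edges G | mg_inv G e == e].

Definition mg_contraction_order G : seq 'I_h :=
  flatten [seq [:: e; mg_inv G e] | e <- enum (mg_edges G)] ++ mg_leaves G.

End Graphs.

Section GraphSums.
Variables (k : fieldType) (V : lmodType k) (gr : int -> V -> Prop).
Variable form : letter gr -> letter gr -> k.
Local Notation letter := (letter gr).
Local Notation SymAlg := (SymAlg gr).

Section OneGraph.
Variables (h m N : nat) (G : mgraph h m N).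

(* The letter at the half-edge e, when the half-edges in the order
   [mg_half_edges G] are decorated by w 0, w 1, ... *)
Definition deco (w : 'I_h -> letter) (e : 'I_h) : letter :=
  nth (w e) (codom w) (index e (mg_half_edges G)).

(* Contraction along the internal edges, and projection of the remaining
   factors to SymAlg. *)
Definition contract (w : 'I_h -> letter) : SymAlg :=
  (koszul k (fun e => ldeg (deco w e))
      (mg_half_edges G) (mg_contraction_order G) *
   \prod_(e in mg_edges G) form (deco w e) (deco w (mg_inv G e)))
  *: symw [seq deco w e | e <- mg_leaves G].

End OneGraph.

(* The coefficient Z of K_(G,f)(y_1 gamma^(g_1), ..., y_m gamma^(g_m)), for
   words y_i.  The sum is over the products of the symmetric groups permuting
   the letters of each y_i, i.e. the permutations of all letters preserving
   the block [reshape_index _ j] of each position j. *)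
Definition graph_op (ws : seq (seq letter)) (gs : seq nat) (N : nat)
    (G : mgraph (size (flatten ws)) (size ws) N) : SymAlg :=
  let x := tnth (in_tuple (flatten ws)) in
  let blk (j : 'I_(size (flatten ws))) := reshape_index (shape ws) j in
  if [forall i : 'I_(size ws),
        (nth 0%N gs i == mg_label G (mg_mark G i)) &&
        (size (nth [::] ws i) == mg_valence G (mg_mark G i))]
  then
    \sum_(t : {perm 'I_(size (flatten ws))} | [forall j, blk (t j) == blk j])
      koszul k (fun j => ldeg (x j)) (enum 'I_(size (flatten ws)))
        [seq t j | j <- enum 'I_(size (flatten ws))]
      *: contract G (fun j => x (t j))
  else 0.

(* The coefficient of gamma^g in the sum of K_(G,f) / |Aut(G,f)| over the
   isomorphism classes of connected graphs, evaluated at the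
   w_i gamma^(g_i), i = 1, ..., m.  Only graphs with as many half-edges as
   there are letters contribute, and the labels are at most the genus. *)
Definition taylor_words (ws : seq (seq letter)) (gs : seq nat) (g : nat) : SymAlg :=
  \sum_(G in mg_classes (size (flatten ws)) (size ws) g.+1 g)
    (mg_aut_card G)%:R^-1 *: graph_op gs G.

Definition taylor (xs : seq (pser gr)) : pser gr :=
  fun g => \sum_(gs : (size xs).-tuple 'I_g.+1)
    multilift (fun ws => taylor_words ws [seq val i | i <- gs] g)
      [seq xi.1 (val xi.2) | xi <- zip xs gs].

End GraphSums.

Section Trivializing.
Variables (k : fieldType) (d : int) (C : cyclicAinf k d) (s : splitting C).

(* graded symmetrization: the projection of H_s to symmetric forms *)
Definition Hsym (a b : letter (@Hgr k d C)) : k :=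
  2%:R^-1 * (Hs s (lval a) (lval b)
               + ksgn k (ldeg a * ldeg b) * Hs s (lval b) (lval a)).

Definition Fc : lmodType k := pser (@Hgr k d C).

(* homogeneous elements of F^c(C)[6-2d] of degree n, with |gamma| = 6 - 2d *)
Definition Fc_shift_deg (n : int) (x : Fc) : Prop :=
  forall g : nat, Symgr (n + (6 - 2 * d) - g%:Z * (6 - 2 * d)) (x g).

(* K_s^m(x_1 o ... o x_m) for xs = [:: x_1; ...; x_m] *)
Definition Kcoef (xs : seq Fc) : Fc := taylor Hsym xs.

End Trivializing.

(* Main.v *)
(* The sum over isomorphism classes of marked graphs, weighted by 1/|Aut|, of the
   sums over all decorations collapses: evaluated on words, the Taylor coefficient
   K_m is the sum, with all weights equal to 1, over the involutions of the set of
   all letters (2-cycles are edges, fixed points are leaves) for which the graph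
   on the m words is connected of the given genus.  Multiplying two arguments x_i
   and x_j keeps the set of letters and merges two vertices.  An involution which
   is connected after merging is either connected before, with first Betti number
   lower by one, which gives the factor gamma, or it has exactly two components,
   one containing i and the other containing j, which gives the products.  The
   symmetry and the evenness of the form make the signs match. *)
Require Import Defs.
From HB Require Import structures.
From mathcomp Require Import all_boot all_order perm all_algebra.
From mathcomp Require Import zify finmap boolp monalg.
From mathcomp Require fsbigop.

Set Implicit Arguments.
Unset Strict Implicit.
Unset Printing Implicit Defensive.

Import GRing.Theory.
Local Open Scope ring_scope.

(** * Koszul signs *)

(** The weights collapse because the isomorphisms from a graph to an isomorphic one form a torsor
    under its automorphism group; inverting $|Aut|$ is where characteristic 0 enters. The genus is
    awkward to compare as the rank of a matrix. For connected graphs the Euler characteristic turns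
    it into a linear equation in the number of half-edges moved by the involution, and all three
    kinds of terms then obey the same equation, [total_genus]. To compare pairings of different
    sublists of words, all of them live on one type of letter positions and fix the letters outside
    the vertices concerned. Passing from words to elements is a separate obstacle: the coefficients
    evaluate chosen representatives, so compatibility with the relations has to be proved, and the
    pairing description is what proves it. Arguments are infinite series in $\gamma$, but the
    coefficient of $\gamma^g$ sees only their coefficients up to $g$, so they may be truncated to
    finite sums of monomials. *)

Section Koszul.
Variable k : fieldType.

Lemma ksgnE p : ksgn k p = (-1) ^+ odd `|p|%N.
Proof. by rewrite /ksgn signr_odd. Qed.

Lemma ksgnD p q : ksgn k (p + q) = ksgn k p * ksgn k q.
Proof.
rewrite /ksgn -exprD -signr_odd -[in RHS]signr_odd; congr (_ ^+ nat_of_bool _).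
lia.
Qed.

Lemma ksgn_even p : ~~ odd `|p|%N -> ksgn k p = 1.
Proof. by move=> /negPf; rewrite ksgnE => ->. Qed.

Lemma ksgnK p : ksgn k p * ksgn k p = 1.
Proof. by rewrite -ksgnD ksgn_even //; lia. Qed.

Lemma ksgnM a b : ksgn k (a * b) = ksgn k a ^+ `|b|%N.
Proof. by rewrite /ksgn abszM exprM. Qed.

(** Degrees of arguments and of their words agree only up to an even shift, so products of degrees
    are compared through [ksgn]: each factor acts as an exponent on the sign of the other. *)
Lemma ksgnM_eq a b a' b' : ksgn k a = ksgn k a' -> ksgn k b = ksgn k b' ->
  ksgn k (a * b) = ksgn k (a' * b').
Proof. by move=> Ea Eb; rewrite (ksgnM a) Ea -ksgnM [a' * b]mulrC (ksgnM b) Eb -ksgnM mulrC. Qed.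

Variables (T : eqType) (p : T -> int).
Implicit Types s t u : seq T.
Local Notation koszul := (koszul k).

Lemma koszulE s t : koszul p s t = \prod_(a <- s) \prod_(b <- s | (index a s < index b s)%N)
   (if (index b t < index a t)%N then ksgn k (p a * p b) else 1).
Proof.
rewrite /Defs.koszul; apply: eq_bigr => a _.
by rewrite big_mkcondr.
Qed.

Lemma ltn_indexN s a b : a \in s -> b \in s -> a != b ->
  (index a s < index b s)%N = ~~ (index b s < index a s)%N.
Proof.
move=> ha hb nab; rewrite -leqNgt [RHS]leq_eqVlt; case: eqP => //= E.
by case/eqP: nab; exact: (index_inj a ha hb E).
Qed.

(** Each unordered pair enters once for either order, and [f] is symmetric. Pairs on which [s] and
    [t] agree match directly; the others match after exchanging the two product variables. *)
Lemma prod_lt_perm (f : T -> T -> k) s t : perm_eq s t -> uniq s ->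
    {in s &, forall a b, f a b = f b a} ->
  \prod_(a <- s) \prod_(b <- s | (index a s < index b s)%N) f a b =
  \prod_(a <- s) \prod_(b <- s | (index a t < index b t)%N) f a b.
Proof.
move=> pst us fC.
have ut : uniq t by rewrite -(perm_uniq pst).
have H (r r' : seq T) : \prod_(a <- s) \prod_(b <- s | (index a r < index b r)%N) f a b =
    (\prod_(a <- s) \prod_(b <- s | (index a r < index b r)%N && (index a r' < index b r')%N) f a b) *
    \prod_(a <- s) \prod_(b <- s | (index a r < index b r)%N && ~~ (index a r' < index b r')%N) f a b.
  rewrite -big_split; apply: eq_bigr => a _.
  by rewrite (bigID (fun b => index a r' < index b r')%N).
rewrite (H s t) (H t s); congr (_ * _).
  by apply: eq_bigr => a _; apply: eq_bigl => b; rewrite andbC.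
rewrite big_seq [RHS]big_seq.
under eq_bigr => a _ do rewrite big_seq_cond.
under [RHS]eq_bigr => a _ do rewrite big_seq_cond.
rewrite [RHS](exchange_big_dep (fun b => b \in s)) /=; last by move=> a b _ /andP[].
apply: eq_bigr => a ha; apply: eq_big => [b|b /andP[hb _]]; last by rewrite fC.
rewrite ha /=; case hb: (b \in s) => //=.
have [->|nab] := eqVneq a b; first by rewrite !ltnn.
rewrite (ltn_indexN ha hb nab) (@ltn_indexN t a b) -?(perm_mem pst) //.
by rewrite negbK andbC.
Qed.

(** Cocycle rule: a pair is inverted between [s] and [u] exactly when one of the two steps inverts
    it, and a pair inverted twice contributes a square, equal to 1. *)
Lemma koszul_trans s t u : uniq s -> perm_eq s t -> perm_eq s u ->
  koszul p s t * koszul p t u = koszul p s u.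
Proof.
move=> us pst psu.
(* [f a b] is the factor of a pair whose order differs between [t] and [u]. Being symmetric, it can
   be multiplied over the pairs ordered by [s] instead of by [t]. *)
pose f a b := if (index a t < index b t)%N != (index a u < index b u)%N then ksgn k (p a * p b) else 1.
have ut : uniq t by rewrite -(perm_uniq pst).
have nr r a b : perm_eq s r -> a \in s -> b \in s -> (index a s < index b s)%N ->
    (index a r < index b r)%N = ~~ (index b r < index a r)%N.
  move=> psr ha hb ab; apply: ltn_indexN; rewrite -?(perm_mem psr) //.
  by apply: contraTneq ab => ->; rewrite ltnn.
have ptu : perm_eq t u by rewrite -(permPl pst).
have -> : koszul p t u = \prod_(a <- s) \prod_(b <- s | (index a s < index b s)%N) f a b.
  transitivity (\prod_(a <- s) \prod_(b <- s | (index a t < index b t)%N) f a b).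
    rewrite koszulE (perm_big s) 1?perm_sym //=; apply: eq_bigr => a _.
    rewrite (perm_big s) 1?perm_sym //= big_seq_cond [RHS]big_seq_cond.
    apply: eq_bigr => b /andP[hb ab].
    have nab : a != b by apply: contraTneq ab => ->; rewrite ltnn.
    have ha : a \in s.
      rewrite (perm_mem pst) -index_mem; apply: leq_trans ab _; exact: index_size.
    rewrite /f ab (@ltn_indexN u a b) -?(perm_mem psu) //.
    by case: (_ < _)%N.
  symmetry; apply: prod_lt_perm => // a b ha hb.
  have [->//|nab] := eqVneq a b.
  rewrite /f [p a * _]mulrC; congr (if _ then _ else _).
  by rewrite (@ltn_indexN t a b) -?(perm_mem pst) // (@ltn_indexN u a b) -?(perm_mem psu) //; do 2 case: (_ < _)%N.
rewrite !koszulE -big_split /= big_seq [RHS]big_seq; apply: eq_bigr => a ha.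
rewrite -big_split /= big_seq_cond [RHS]big_seq_cond; apply: eq_bigr => b /andP[hb ab].
rewrite /f (nr t a b) // (nr u a b) //; have := ksgnK (p a * p b).
by case: (_ < _)%N; case: (_ < _)%N; rewrite /= ?mul1r ?mulr1.
Qed.


(** The head [x] is inverted exactly with the letters of [t1], and removing it keeps the relative
    order of the rest. Inductions on signs run through this recursion. *)
Lemma koszul_cons x s t1 t2 : uniq (x :: s) -> perm_eq s (t1 ++ t2) ->
  koszul p (x :: s) (t1 ++ x :: t2) = ksgn k (p x * \sum_(b <- t1) p b) * koszul p s (t1 ++ t2).
Proof.
move=> /= /andP[xs us] ps.
have ut : uniq (t1 ++ t2) by rewrite -(perm_uniq ps).
have xt1 : x \notin t1 by move: xs; rewrite (perm_mem ps) mem_cat negb_or => /andP[].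
rewrite !koszulE big_cons; congr (_ * _).
  rewrite big_cons /= eqxx ltnn -big_filter.
  have -> : [seq b <- s | (0 < (if x == b then 0 else (index b s).+1))%N] = s.
    by apply/all_filterP/allP => b bs; case: eqP => // E; rewrite E bs in xs.
  rewrite (perm_big _ ps) big_cat /= [X in _ * X]big_seq [X in _ * X]big1 ?mulr1.
    rewrite mulr_sumr; elim: (t1) xt1 ut {ps} => [|b t IH]; first by rewrite !big_nil.
    rewrite inE negb_or => /andP[xb xt] /= /andP[bt ut].
    rewrite !big_cons ksgnD eqxx [b == x]eq_sym (negPf xb) /= -IH //; congr (_ * _).
    rewrite big_seq [RHS]big_seq; apply: eq_bigr => c ct.
    case: eqP => // E; by rewrite E mem_cat ct in bt.
  move=> b bt2; rewrite !index_cat (negPf xt1) /=.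
  have -> : b \in t1 = false.
    by apply/negP => bt1; move: ut; rewrite cat_uniq => /and3P[_ /hasP[]]; exists b.
  by rewrite eqxx addn0 ltnNge leq_addr.
rewrite big_seq [RHS]big_seq; apply: eq_bigr => a ha.
have xa : (x == a) = false by apply/eqP => E; rewrite E ha in xs.
rewrite big_cons /= xa eqxx /= big_seq_cond [RHS]big_seq_cond.
have I c : c \in s -> index c (t1 ++ x :: t2) = bump (size t1) (index c (t1 ++ t2)).
  move=> hc; have xc : (x == c) = false by apply/eqP => E; rewrite E hc in xs.
  rewrite !index_cat /= xc /bump; case: (boolP (c \in t1)) => ct.
    by rewrite leqNgt index_mem ct.
  by rewrite leq_addr add1n addnS.
apply: eq_big => [b|b /andP[hb _]]; last by rewrite !I // ltnNge leq_bump2 -ltnNge.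
case hb: (b \in s) => //=; have xb : (x == b) = false by apply/eqP => E; rewrite E hb in xs.
by rewrite xb.
Qed.

Lemma koszulxx s : koszul p s s = 1.
Proof.
rewrite koszulE big1 // => a _; rewrite big1 // => b ab.
by rewrite ltnNge ltnW.
Qed.

Lemma koszul_catl r s t : uniq (r ++ s) -> perm_eq s t ->
  koszul p (r ++ s) (r ++ t) = koszul p s t.
Proof.
elim: r => //= x r IH /andP[xr ur] ps.
rewrite (@koszul_cons x (r ++ s) [::] (r ++ t)) //=; last by rewrite perm_cat2l.
  by rewrite big_nil mulr0 mul1r IH.
by rewrite xr.
Qed.

Lemma perm_cons_split (x : T) s t : perm_eq (x :: s) t ->
  exists t1 t2, t = t1 ++ x :: t2 /\ perm_eq s (t1 ++ t2).
Proof.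
move=> ps; have xt : x \in t by rewrite -(perm_mem ps) mem_head.
case/splitPr: xt ps => t1 t2 ps; exists t1, t2; split=> //.
by rewrite -(perm_cons x) (permPl ps); apply: permEl (perm_catCA t1 [:: x] t2).
Qed.

Lemma koszul_catr r s t : uniq (s ++ r) -> perm_eq s t ->
  koszul p (s ++ r) (t ++ r) = koszul p s t.
Proof.
elim: s t => [|x s IH] t /=.
  by move=> ur; rewrite perm_sym => /perm_nilP ->; rewrite !koszulxx.
move=> /andP[xr ur] /perm_cons_split[t1 [t2 [-> ps]]].
rewrite -catA /= !koszul_cons //= ?catA ?perm_cat2r ?IH ?xr //.
by move: xr ur; rewrite mem_cat negb_or cat_uniq => /andP[-> _] /and3P[->].
Qed.

Lemma koszul_catC s t : uniq (s ++ t) ->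
  koszul p (s ++ t) (t ++ s) = ksgn k ((\sum_(a <- s) p a) * (\sum_(b <- t) p b)).
Proof.
elim: s => [|x s IH] /=; first by rewrite cats0 koszulxx big_nil mul0r.
move=> /andP[xst ust]; rewrite koszul_cons //= ?xst //; last by rewrite perm_catC.
by rewrite IH // big_cons mulrDl ksgnD.
Qed.

End Koszul.
Arguments koszul_trans {k T p s t u}.
Arguments koszul_catl {k T p r s t}.
Arguments koszul_catr {k T p r s t}.
Arguments koszul_catC {k T p s t}.
Arguments koszul_cons {k T p x s t1 t2}.

Lemma eq_koszul (k : fieldType) (T : eqType) (p q : T -> int) s t :
  {in s, p =1 q} -> koszul k p s t = koszul k q s t.
Proof.
move=> E; rewrite /koszul big_seq [RHS]big_seq; apply: eq_bigr => a ha.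
rewrite big_seq_cond [RHS]big_seq_cond; apply: eq_bigr => b /andP[hb _].
by rewrite !E.
Qed.

Lemma koszul_map (k : fieldType) (T U : eqType) (f : T -> U) (p : U -> int) s t :
  injective f -> koszul k p (map f s) (map f t) = koszul k (p \o f) s t.
Proof.
move=> fI; rewrite /koszul big_map; apply: eq_bigr => a _.
by rewrite big_map; apply: eq_bigl => b; rewrite !index_map.
Qed.

(** A block moves with the sum of the degrees of its letters, up to parity. This turns signs of
    permuting arguments into signs on letters, where the pairings live. *)
Lemma koszul_blocks (k : fieldType) (T I : eqType) (p : T -> int) (dx : I -> int)
    (B : I -> seq T) s t :
  (forall l, l \in s -> ksgn k (dx l) = ksgn k (\sum_(a <- B l) p a)) ->
  uniq (flatten [seq B l | l <- s]) -> uniq s -> perm_eq s t ->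
  koszul k dx s t = koszul k p (flatten [seq B l | l <- s]) (flatten [seq B l | l <- t]).
Proof.
elim: s t => [|x s IH] t dB.
  by move=> _ _; rewrite perm_sym => /perm_nilP ->; rewrite !koszulxx.
rewrite cons_uniq => uB /andP[xs us] /perm_cons_split[t1 [t2 [-> ps]]].
rewrite koszul_cons ?cons_uniq ?xs //.
have psB : perm_eq (flatten [seq B l | l <- s]) (flatten [seq B l | l <- t1] ++ flatten [seq B l | l <- t2]).
  by rewrite -flatten_cat -map_cat; apply/perm_flatten/perm_map.
rewrite map_cat flatten_cat /=.
set b1 := flatten [seq B l | l <- t1]; set b2 := flatten [seq B l | l <- t2].
rewrite -/b1 -/b2 in psB.
rewrite /= in uB.
(* Intermediate arrangement: the block of [x] still in front, the other blocks already in their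
   final order. *)
rewrite -(@koszul_trans _ _ _ _ (B x ++ b1 ++ b2)) //.
- rewrite koszul_catl // (IH (t1 ++ t2)) //.
  + rewrite map_cat flatten_cat -/b1 -/b2 mulrC; congr (_ * _).
    have u12 : uniq ((B x ++ b1) ++ b2).
      rewrite -catA; have : perm_eq (B x ++ flatten [seq B l | l <- s]) (B x ++ b1 ++ b2) by rewrite perm_cat2l.
      by move/perm_uniq; rewrite uB.
    have u1 : uniq (B x ++ b1) by move: u12; rewrite cat_uniq => /and3P[].
    rewrite catA [in RHS]catA (koszul_catr u12); last exact: permEl (perm_catC _ _).
    rewrite (koszul_catC u1).
    apply: ksgnM_eq; first by rewrite dB ?mem_head.
    rewrite /b1; have : {subset t1 <= s} by move=> z zt; rewrite (perm_mem ps) mem_cat zt.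
    elim: (t1) => [|y t' IHt] sub; first by rewrite !big_nil.
    rewrite big_cons /= big_cat /= !ksgnD IHt; last by move=> z zt; apply: sub; rewrite inE zt orbT.
    by rewrite dB // inE sub ?mem_head ?orbT.
  + by move=> l ls; apply: dB; rewrite inE ls orbT.
  + by move: uB; rewrite cat_uniq => /and3P[].
- by rewrite perm_cat2l.
- rewrite perm_sym; apply: perm_trans (permEl (perm_catCA _ _ _)) _.
  by rewrite perm_cat2l perm_sym.
Qed.

(** * Graded symmetric algebras *)

Section PliftFun.
Variables (k : fieldType) (X : choiceType) (rel : {malg k[X]} -> Prop).

(** [plift] evaluates a fixed representative of [y], which gives linearity in the prescribed values;
    linearity in [y] is what compatibility is for. *)
Lemma plift_funP (M : lmodType k) (c : k) (F F1 F2 : X -> M) (y : quotmod rel) :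
  (forall x, F x = c *: F1 x + F2 x) -> plift F y = c *: plift F1 y + plift F2 y.
Proof. by move=> E; rewrite /plift /linext; apply: sum_lin => x; rewrite E scalerDr scalerA mulrC -scalerA. Qed.

Lemma plift_fun0 (M : lmodType k) (F : X -> M) (y : quotmod rel) :
  (forall x, F x = 0) -> plift F y = 0.
Proof. by move=> E; rewrite /plift /linext big1 // => x _; rewrite E scaler0. Qed.

End PliftFun.

Section SymAlgebra.
Variables (k : fieldType) (V : lmodType k) (gr : int -> V -> Prop).
Local Notation letter := (letter gr).
Local Notation SymAlg := (SymAlg gr).
Local Notation symw := (@symw k V gr).

(** The relations [Symrel] read on functions of words, so that such a function descends to
    [SymAlg]. *)
Definition graded_multilinear (M : lmodType k) (F : seq letter -> M) :=
  (forall u v c l l1 l2, ldeg l1 = ldeg l -> ldeg l2 = ldeg l ->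
     lval l = c *: lval l1 + lval l2 ->
     F (u ++ l :: v) = c *: F (u ++ l1 :: v) + F (u ++ l2 :: v)) /\
  (forall u v l1 l2,
     F (u ++ l1 :: l2 :: v) = ksgn k (ldeg l1 * ldeg l2) *: F (u ++ l2 :: l1 :: v)).

Lemma graded_multilinearP (M : lmodType k) (F : seq letter -> M) :
  graded_multilinear F -> compatible (@Symrel k V gr) F.
Proof.
move=> [H1 H2] _ [u v c l l1 l2 d1 d2 E|u v l1 l2].
  by rewrite !linearB linearZ /= !linextU (H1 u v c l l1 l2) // -addrA -opprD subrr.
by rewrite linearB linearZ /= !linextU H2 subrr.
Qed.

Lemma symw_multilinear : graded_multilinear symw.
Proof.
split=> [u v c l l1 l2 d1 d2 E|u v l1 l2].
  rewrite /Defs.symw /pgen -qpi_linear; apply/qpi_eq.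
  by rewrite opprD addrA; apply/span_gen/Sym_lin.
rewrite /Defs.symw /pgen -[_ *: qpi _ _]addr0 -(subrr (qpi (@Symrel k V gr) 0)) -qpiB subr0 -qpi_linear.
by apply/qpi_eq; rewrite addr0; exact/span_gen/Sym_swap.
Qed.

Lemma symmul_compatible2 w : compatible (@Symrel k V gr) (fun v => symw (w ++ v)).
Proof.
apply: graded_multilinearP; have [H1 H2] := symw_multilinear.
by split=> *; rewrite !catA; [exact: H1 | exact: H2].
Qed.

Lemma symmul_compatible1 (y : SymAlg) :
  compatible (@Symrel k V gr) (fun w => plift (fun v => symw (w ++ v)) y).
Proof.
apply: graded_multilinearP; have [H1 H2] := symw_multilinear; split.
  by move=> u v c l l1 l2 d1 d2 E; apply: plift_funP => x; rewrite -!catA; exact: H1.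
move=> u v l1 l2.
rewrite -[RHS]addr0 -(@plift_fun0 _ _ (@Symrel k V gr) SymAlg (fun=> 0) y) //.
by apply: plift_funP => x; rewrite -!catA addr0; exact: H2.
Qed.

Lemma symmul_words w v : symmul (symw w) (symw v) = symw (w ++ v).
Proof.
by rewrite /symmul (plift_gen (symmul_compatible1 _)) (plift_gen (symmul_compatible2 _)).
Qed.

Lemma symmul_linl (y : SymAlg) : linear (fun x => symmul x y).
Proof. exact: plift_linear (symmul_compatible1 y). Qed.

Lemma symmul_linr (x : SymAlg) : linear (symmul x).
Proof.
move=> c y z; apply: plift_funP => w; exact: (plift_linear (symmul_compatible2 w)).
Qed.

Lemma symmul0l (y : SymAlg) : symmul 0 y = 0.
Proof. by have := symmul_linl y (-1) 0 0; rewrite scaler0 addr0 scaleN1r addNr. Qed.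

Lemma symmul0r (x : SymAlg) : symmul x 0 = 0.
Proof. by have := symmul_linr x (-1) 0 0; rewrite scaler0 addr0 scaleN1r addNr. Qed.

Lemma symmulDl (x y z : SymAlg) : symmul (x + y) z = symmul x z + symmul y z.
Proof. by have := symmul_linl z 1 x y; rewrite !scale1r. Qed.

Lemma symmulDr (x y z : SymAlg) : symmul x (y + z) = symmul x y + symmul x z.
Proof. by have := symmul_linr x 1 y z; rewrite !scale1r. Qed.

Lemma symmulZl c (x y : SymAlg) : symmul (c *: x) y = c *: symmul x y.
Proof. by have := symmul_linl y c x 0; rewrite symmul0l !addr0. Qed.

Lemma symmulZr c (x y : SymAlg) : symmul x (c *: y) = c *: symmul x y.
Proof. by have := symmul_linr x c y 0; rewrite symmul0r !addr0. Qed.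

Lemma symmul_suml (I : Type) (r : seq I) (P : pred I) (F : I -> SymAlg) y :
  symmul (\sum_(i <- r | P i) F i) y = \sum_(i <- r | P i) symmul (F i) y.
Proof. exact: (big_morph (fun x => symmul x y) (fun a b => symmulDl a b y) (symmul0l y)). Qed.

Lemma symmul_sumr (I : Type) (r : seq I) (P : pred I) (F : I -> SymAlg) x :
  symmul x (\sum_(i <- r | P i) F i) = \sum_(i <- r | P i) symmul x (F i).
Proof. exact: (big_morph (symmul x) (symmulDr x) (symmul0r x)). Qed.

Section Perm.
Variables (T : eqType) (lt : T -> letter).
Local Notation dl := (fun a => ldeg (lt a)).

Lemma graded_move (M : lmodType k) (F : seq letter -> M) : graded_multilinear F ->
  forall r x t u,
  F (r ++ lt x :: map lt t ++ u) =
    ksgn k (dl x * \sum_(b <- t) dl b) *: F (r ++ map lt t ++ lt x :: u).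
Proof.
move=> [_ H2] r x t; elim: t r => [|y t IH] r u.
  by rewrite big_nil mulr0 scale1r.
rewrite /= H2 big_cons mulrDr ksgnD -scalerA; congr (_ *: _).
by rewrite -(cat_rcons (lt y) r) IH cat_rcons.
Qed.

(** Letters may repeat in a word, whereas a Koszul sign needs distinct indices: permutations act on
    positions, and [lt] reads off the letters. *)
Lemma graded_perm (M : lmodType k) (F : seq letter -> M) : graded_multilinear F ->
  forall r s t, uniq s -> perm_eq s t ->
  F (r ++ map lt s) = koszul k dl s t *: F (r ++ map lt t).
Proof.
move=> gF r s; elim: s r => [|x s IH] r t.
  by rewrite perm_sym => _ /perm_nilP ->; rewrite koszulxx scale1r.
move=> us /perm_cons_split[t1 [t2 [-> ps]]].
rewrite koszul_cons // map_cat /=.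
rewrite -cat_rcons (IH _ (t1 ++ t2)) //; last by case/andP: us.
by rewrite cat_rcons map_cat (graded_move gF) scalerA mulrC.
Qed.

End Perm.
End SymAlgebra.

(** * Pairings of the letters of a word *)

(* A graph whose half-edges are decorated by letters is encoded by an involution
   [iota] of the positions of these letters: the 2-cycles of [iota] are the
   internal edges and its fixed points are the leaves. *)
Section Pairings.
Variables (k : fieldType) (V : lmodType k) (gr : int -> V -> Prop).
Variable form : letter gr -> letter gr -> k.
Local Notation letter := (letter gr).

Definition form_linear := forall (l l1 l2 : letter) c b,
  ldeg l1 = ldeg l -> ldeg l2 = ldeg l -> lval l = c *: lval l1 + lval l2 ->
  form l b = c * form l1 b + form l2 b.
Definition form_symmetric := forall a b, form a b = ksgn k (ldeg a * ldeg b) * form b a.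
Definition form_even := forall a b, form a b != 0 -> ~~ odd `|(ldeg a + ldeg b)%R|%N.

Definition edge_word (P : eqType) (iota : P -> P) (E : seq P) : seq P :=
  flatten [seq [:: e; iota e] | e <- E].

Definition involution_on (P : eqType) (s : seq P) (iota : P -> P) :=
  {in s, forall p, iota p \in s /\ iota (iota p) = p}.

Definition pairing_edges (P : eqType) (s : seq P) (iota : P -> P) : seq P :=
  [seq p <- s | (index p s < index (iota p) s)%N].
Definition pairing_leaves (P : eqType) (s : seq P) (iota : P -> P) : seq P :=
  [seq p <- s | iota p == p].

(** [E] contains one half-edge of each internal edge, in any order and orientation, and [F] the
    leaves in any order. This freedom is needed because graphs, merged words and subwords produce
    different lists for the same involution. *)
Definition pairing_list (P : eqType) (iota : P -> P) (s E F : seq P) :=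
  perm_eq s (edge_word iota E ++ F) && all (fun p => iota p == p) F.

Section Lists.
Variable (P : eqType).
Implicit Types (s E F : seq P) (iota : P -> P).

Lemma edge_word_cat iota E1 E2 : edge_word iota (E1 ++ E2) = edge_word iota E1 ++ edge_word iota E2.
Proof. by rewrite /edge_word map_cat flatten_cat. Qed.

Lemma edge_word_perm iota E : perm_eq (edge_word iota E) (E ++ map iota E).
Proof.
elim: E => //= e E IH.
rewrite -[edge_word iota (e :: E)]/(e :: iota e :: edge_word iota E) perm_cons.
apply: (@perm_trans _ (iota e :: (E ++ map iota E))); first by rewrite perm_cons.
exact: permEl (perm_catCA [:: iota e] E (map iota E)).
Qed.

(** The canonical choice: each 2-cycle is represented by its earlier half-edge. *)
Lemma pairing_listP iota s : uniq s -> involution_on s iota ->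
  pairing_list iota s (pairing_edges s iota) (pairing_leaves s iota).
Proof.
move=> us inv; apply/andP; split; last by apply/allP => p; rewrite mem_filter => /andP[].
set A := pairing_edges s iota; set F := pairing_leaves s iota.
(* [A'] collects the later half-edges, the images of [A]; then [s] splits into [A], [A'] and the
   fixed points. *)
pose A' := [seq p <- s | (index (iota p) s < index p s)%N].
have pA : perm_eq (map iota A) A'.
  apply: uniq_perm; [rewrite map_inj_in_uniq|exact: filter_uniq|].
  - exact: filter_uniq.
  - move=> p q; rewrite !mem_filter => /andP[_ ps] /andP[_ qs] E.
    by rewrite -(inv p ps).2 E (inv q qs).2.
  move=> p; apply/mapP/idP => [[q]|].
    rewrite !mem_filter => /andP[lt qs] ->; have [-> ->] := inv q qs.
    by rewrite lt.
  rewrite mem_filter => /andP[lt ps]; exists (iota p); last by rewrite (inv p ps).2.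
  by rewrite mem_filter (inv p ps).1 (inv p ps).2 lt.
apply: (@perm_trans _ (A ++ A' ++ F)); last first.
  rewrite catA perm_cat2r perm_sym; apply: perm_trans (edge_word_perm _ _) _.
  by rewrite perm_cat2l.
rewrite perm_sym -(permPr (permEl (perm_filterC (fun p => index p s < index (iota p) s)%N s))).
rewrite perm_cat2l.
set B := filter (predC _) s.
rewrite -(permPr (permEl (perm_filterC (fun p => index (iota p) s < index p s)%N B))).
have -> : [seq x <- B | (index (iota x) s < index x s)%N] = A'.
  rewrite -filter_predI; apply: eq_filter => p /=.
  by case: (ltngtP (index p s)).
rewrite perm_cat2l.
suff -> : [seq x <- B | predC (fun p => index (iota p) s < index p s)%N x] = F by [].
rewrite -filter_predI; apply: eq_in_filter => p ps /=.
rewrite -!leqNgt -eqn_leq; apply/eqP/eqP => [|->//].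
move=> E; apply: (index_inj p (inv p ps).1 ps); first [exact: E | exact: esym E].
Qed.

Lemma pairing_edges_cat iota s1 s2 E1 E2 F1 F2 :
  pairing_list iota s1 E1 F1 -> pairing_list iota s2 E2 F2 ->
  pairing_list iota (s1 ++ s2) (E1 ++ E2) (F1 ++ F2).
Proof.
move=> /andP[p1 a1] /andP[p2 a2]; apply/andP; split; last by rewrite all_cat a1.
rewrite edge_word_cat; apply: perm_trans (perm_cat p1 p2) _.
by rewrite -!catA perm_cat2l perm_catCA.
Qed.

End Lists.

Section Values.
Variables (P : eqType) (lt : P -> letter).
Implicit Types (s E F : seq P) (iota : P -> P).
Local Notation dl := (fun p => ldeg (lt p)).

(** The formula of [contract], for arbitrary lists of edges and leaves over an arbitrary type of
    positions. *)
Definition pairing_term iota s E F : SymAlg gr :=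
  (koszul k dl s (edge_word iota E ++ F) *
     \prod_(e <- E) form (lt e) (lt (iota e))) *: symw [seq lt p | p <- F].

Definition pairing_value s iota := pairing_term iota s (pairing_edges s iota) (pairing_leaves s iota).

Hypotheses (formS : form_symmetric) (formE : form_even).

Lemma edge_even a b c : form a b != 0 -> ksgn k ((ldeg a + ldeg b) * c) = 1.
Proof. by move=> /formE H; apply: ksgn_even; rewrite abszM oddM negb_and H. Qed.

Lemma pairing_term_cons iota s s1 e E F :
  uniq s -> perm_eq s [:: e, iota e & s1] -> perm_eq s1 (edge_word iota E ++ F) ->
  pairing_term iota s (e :: E) F =
    (koszul k dl s [:: e, iota e & s1] * form (lt e) (lt (iota e))) *:
      pairing_term iota s1 E F.
Proof.
move=> us ps ps1; rewrite /pairing_term scalerA; congr (_ *: _).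
rewrite big_cons -[edge_word iota (e :: E) ++ F]/([:: e; iota e] ++ (edge_word iota E ++ F)).
have p2 : perm_eq s ([:: e; iota e] ++ (edge_word iota E ++ F)).
  by rewrite (permPl ps) -cat1s -[X in perm_eq X]/([:: e; iota e] ++ s1) perm_cat2l.
rewrite -(koszul_trans us ps p2).
rewrite -[e :: iota e :: s1]/([:: e; iota e] ++ s1) koszul_catl //.
  by rewrite !mulrA; congr (_ * _); rewrite -!mulrA; congr (_ * _); rewrite mulrC.
by rewrite -(perm_uniq ps).
Qed.

(** If the form vanishes on the edge, both sides are zero; otherwise its two letters have even total
    degree and move to the front without sign. *)
Lemma pairing_term_front iota s e E1 E2 F :
  uniq s -> perm_eq s (edge_word iota (E1 ++ e :: E2) ++ F) ->
  pairing_term iota s (E1 ++ e :: E2) F = pairing_term iota s (e :: E1 ++ E2) F.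
Proof.
move=> us ps; rewrite /pairing_term; congr (_ *: _).
have -> : \prod_(p <- E1 ++ e :: E2) form (lt p) (lt (iota p)) = \prod_(p <- e :: E1 ++ E2) form (lt p) (lt (iota p)).
  by apply: perm_big; rewrite -cat1s perm_catCA.
rewrite big_cons; have [->|nz] := eqVneq (form (lt e) (lt (iota e))) 0; first by rewrite mul0r !mulr0.
congr (_ * _).
set t := edge_word iota (E1 ++ e :: E2) ++ F in ps *; set t' := _ ++ F.
have Et : t = (edge_word iota E1 ++ [:: e; iota e]) ++ (edge_word iota E2 ++ F).
  by rewrite /t edge_word_cat -!catA.
have Et' : t' = ([:: e; iota e] ++ edge_word iota E1) ++ (edge_word iota E2 ++ F).
  by rewrite /t' -[e :: E1 ++ E2]cat1s !edge_word_cat -!catA.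
have pt : perm_eq t t' by rewrite Et Et' perm_cat2r perm_catC.
have ut : uniq t by rewrite -(perm_uniq ps).
rewrite -(koszul_trans us ps (perm_trans ps pt)).
rewrite -[LHS]mulr1; congr (_ * _); rewrite Et Et' koszul_catr; first last.
- exact: permEl (perm_catC _ _).
- by rewrite -Et.
rewrite koszul_catC; last by move: ut; rewrite Et cat_uniq => /and3P[].
by rewrite mulrC !big_cons big_nil addr0 edge_even.
Qed.

(** Exchanging the two letters of an edge produces the same sign in the Koszul factor and in the
    form. *)
Lemma pairing_term_flip iota s e E F :
  uniq s -> perm_eq s (edge_word iota (e :: E) ++ F) -> iota (iota e) = e ->
  pairing_term iota s (e :: E) F = pairing_term iota s (iota e :: E) F.
Proof.
move=> us ps inv; rewrite /pairing_term; congr (_ *: _).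
rewrite !big_cons inv [form (lt e) _]formS !mulrA; congr (_ * _); rewrite -!mulrA.
rewrite mulrA; congr (_ * _).
have Et : edge_word iota (e :: E) ++ F = [:: e; iota e] ++ (edge_word iota E ++ F) by [].
have Et' : edge_word iota (iota e :: E) ++ F = [:: iota e; e] ++ (edge_word iota E ++ F) by rewrite /edge_word /= inv.
have pt : perm_eq (edge_word iota (e :: E) ++ F) (edge_word iota (iota e :: E) ++ F).
  rewrite Et Et' perm_cat2r; exact: permEl (perm_catC [:: e] [:: iota e]).
rewrite -(koszul_trans us ps (perm_trans ps pt)); congr (_ * _).
have ut : uniq (edge_word iota (e :: E) ++ F) by rewrite -(perm_uniq ps).
rewrite Et in ut *; rewrite Et' koszul_catr //.
  rewrite (@koszul_catC _ _ _ [:: e] [:: iota e]) ?big_seq1 //.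
  by move: ut; rewrite cat_uniq => /and3P[].
exact: permEl (perm_catC [:: e] [:: iota e]).
Qed.

(* Moving an edge past letters costs no sign since the form is even, and the
   sign of reversing an edge is absorbed by the symmetry of the form. *)
Lemma pairing_term_indep iota s E F E' F' :
  uniq s -> involution_on s iota -> pairing_list iota s E F -> pairing_list iota s E' F' ->
  pairing_term iota s E F = pairing_term iota s E' F'.
Proof.
elim: E s E' => [|e E IH] s E' us inv /andP[pEF aF] /andP[pEF' aF'].
  case: E' pEF' => [|e' E'] pEF'.
    have pF := pEF; rewrite /= in pF pEF'.
    have pFF' : perm_eq F F' by rewrite -(permPl pF).
    have uF : uniq F by rewrite -(perm_uniq pF).
    rewrite /pairing_term !big_nil !mulr1 /edge_word /=.
    have -> := graded_perm lt (@symw_multilinear k V gr) [::] uF pFF'.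
    by rewrite scalerA koszul_trans.
  exfalso; have uE : uniq (edge_word iota (e' :: E') ++ F') by rewrite -(perm_uniq pEF').
  have : e' \in F by rewrite -(perm_mem pEF) (perm_mem pEF') mem_head.
  move/(allP aF)/eqP => fx; by move: uE; rewrite /edge_word /= fx mem_head.
have ueE : uniq (edge_word iota (e :: E) ++ F) by rewrite -(perm_uniq pEF).
have es : e \in s by rewrite (perm_mem pEF) mem_head.
have nfix : iota e != e.
  by apply/eqP => fx; move: ueE; rewrite /edge_word /= fx mem_head.
have [E1 [E2 [p2 H]]] : exists E1 E2, perm_eq s (edge_word iota (e :: E1 ++ E2) ++ F')
    /\ pairing_term iota s E' F' = pairing_term iota s (e :: E1 ++ E2) F'.
  have : e \in edge_word iota E'.
    have := es; rewrite (perm_mem pEF') mem_cat => /orP[//|/(allP aF')].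
    by rewrite (negPf nfix).
  have fr E1 x E2 : perm_eq (edge_word iota (x :: E1 ++ E2) ++ F') (edge_word iota (E1 ++ x :: E2) ++ F').
    rewrite perm_cat2r -cat1s !edge_word_cat -[x :: E2]cat1s edge_word_cat.
    exact: permEl (perm_catCA _ _ _).
  move/flatten_mapP => [x xE']; rewrite !inE => /orP[] /eqP Ex.
    subst x; case/splitPr: xE' pEF' => E1 E2 pEF'; exists E1, E2; split.
      by rewrite (permPl pEF') perm_sym.
    exact: pairing_term_front.
  have ix : iota e = x.
    have xs : x \in s.
      rewrite (perm_mem pEF') mem_cat; apply/orP; left; apply/flatten_mapP.
      by exists x => //; rewrite mem_head.
    by rewrite Ex; case: (inv x xs).
  case/splitPr: xE' pEF' => E1 E2 pEF'; exists E1, E2.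
  have p1 : perm_eq s (edge_word iota (x :: E1 ++ E2) ++ F') by rewrite (permPl pEF') perm_sym.
  split.
    rewrite (permPl p1) perm_cat2r /edge_word /= -Ex ix.
    exact: permEl (perm_catCA [:: x] [:: e] _).
  by rewrite (pairing_term_front us pEF') (pairing_term_flip us p1) -Ex.
rewrite {}H.
pose s1 := edge_word iota E ++ F.
have ps1 : perm_eq s [:: e, iota e & s1] by [].
have us1 : uniq [:: e, iota e & s1] by rewrite -(perm_uniq ps1).
have p3 : perm_eq s1 (edge_word iota (E1 ++ E2) ++ F').
  by rewrite -(perm_cons (iota e)) -(perm_cons e) -(permPl ps1).
rewrite (pairing_term_cons us ps1 (perm_refl _)) (pairing_term_cons us ps1 p3); congr (_ *: _); apply: IH.
- by move: us1; rewrite !cons_uniq => /and3P[].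
- move=> p ps; have pss : p \in s by rewrite (perm_mem ps1) !inE ps !orbT.
  have [ip iip] := inv p pss; split=> //.
  move: ip; rewrite (perm_mem ps1) !inE => /or3P[/eqP E0|/eqP E0|//].
    by move: us1; rewrite -E0 iip /= ps andbF.
  have E3 : p = e by rewrite -iip E0; case: (inv e es).
  by move: us1; rewrite -E3 /= !inE ps orbT.
- by apply/andP; split.
- by apply/andP; split.
Qed.

Lemma pairing_valueE iota s E F :
  uniq s -> involution_on s iota -> pairing_list iota s E F ->
  pairing_value s iota = pairing_term iota s E F.
Proof. by move=> us inv v; apply: pairing_term_indep => //; exact: pairing_listP. Qed.

Lemma pairing_value_perm iota s s' : uniq s -> involution_on s iota -> perm_eq s s' ->
  pairing_value s iota = koszul k dl s s' *: pairing_value s' iota.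
Proof.
move=> us inv ps.
have us' : uniq s' by rewrite -(perm_uniq ps).
have inv' : involution_on s' iota by move=> p; rewrite -!(perm_mem ps); exact: inv.
have /andP[p1 a1] := pairing_listP us inv.
have v' : pairing_list iota s' (pairing_edges s iota) (pairing_leaves s iota).
  by apply/andP; split=> //; rewrite -(permPl ps).
rewrite (pairing_valueE us' inv' v') /pairing_value /pairing_term scalerA mulrA.
by rewrite koszul_trans.
Qed.

(** In the concatenation all edges precede all leaves, so the leaves of [s1] have to pass the edges
    of [s2]. This costs no sign, these edges being even unless the product of forms vanishes. *)
Lemma pairing_value_cat iota s1 s2 : uniq (s1 ++ s2) ->
  involution_on s1 iota -> involution_on s2 iota ->
  pairing_value (s1 ++ s2) iota = symmul (pairing_value s1 iota) (pairing_value s2 iota).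
Proof.
move=> us i1 i2; have := us; rewrite cat_uniq => /and3P[us1 _ us2].
have v1 := pairing_listP us1 i1; have v2 := pairing_listP us2 i2.
have i12 : involution_on (s1 ++ s2) iota.
  move=> p; rewrite mem_cat => /orP[/i1[H ->]|/i2[H ->]]; by rewrite mem_cat H ?orbT.
have v := pairing_edges_cat v1 v2.
rewrite (pairing_valueE us i12 v) /pairing_value /pairing_term.
set E1 := pairing_edges s1 _ in v1 v *; set F1 := pairing_leaves s1 _ in v1 v *.
set E2 := pairing_edges s2 _ in v2 v *; set F2 := pairing_leaves s2 _ in v2 v *.
rewrite symmulZl symmulZr symmul_words -map_cat scalerA; congr (_ *: _).
rewrite big_cat /=.
rewrite [RHS]mulrACA; have [E0|nz] := eqVneq (\prod_(e <- E2) form (lt e) (lt (iota e))) 0.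
  by rewrite E0 !mulr0.
congr (_ * _).
move/andP: v1 => [p1 _]; move/andP: v2 => [p2 _]; move/andP: v => [p _].
have p' : perm_eq (s1 ++ s2) ((edge_word iota E1 ++ F1) ++ (edge_word iota E2 ++ F2)).
  exact: perm_cat.
have -> : koszul k dl (s1 ++ s2) (edge_word iota (E1 ++ E2) ++ F1 ++ F2) =
   koszul k dl (s1 ++ s2) ((edge_word iota E1 ++ F1) ++ (edge_word iota E2 ++ F2)).
  rewrite -(koszul_trans us p' p) -[RHS]mulr1; congr (_ * _).
  have u' := us; rewrite (perm_uniq p') in u'.
  rewrite edge_word_cat -!catA koszul_catl; last 2 first.
  - by move: u'; rewrite -catA.
  - by rewrite perm_catCA.
  have u3 : uniq ((F1 ++ edge_word iota E2) ++ F2).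
    by move: u'; rewrite -!catA cat_uniq => /and3P[].
  rewrite !catA koszul_catr //; last exact: permEl (perm_catC _ _).
  rewrite koszul_catC; last by move: u3; rewrite cat_uniq => /and3P[].
  rewrite mulrC; elim: (E2) nz => [|e E IH]; first by rewrite /edge_word /= !big_nil mul0r.
  rewrite big_cons mulf_eq0 negb_or => /andP[ne nE].
  rewrite -[edge_word iota (e :: E)]/([:: e; iota e] ++ edge_word iota E) big_cat /= mulrDl ksgnD IH // mulr1.
  by rewrite !big_cons big_nil addr0 edge_even.
have u' := us; rewrite (perm_uniq p') in u'.
have p12 : perm_eq (s1 ++ s2) ((edge_word iota E1 ++ F1) ++ s2) by rewrite perm_cat2r.
rewrite -(koszul_trans us p12 p') koszul_catr // koszul_catl //.
by rewrite -(perm_uniq p12).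
Qed.

Lemma eq_pairing_value iota iota' s : {in s, iota =1 iota'} ->
  pairing_value s iota = pairing_value s iota'.
Proof.
move=> E; rewrite /pairing_value.
have -> : pairing_edges s iota = pairing_edges s iota' by apply: eq_in_filter => p ps; rewrite E.
have -> : pairing_leaves s iota = pairing_leaves s iota' by apply: eq_in_filter => p ps; rewrite E.
have sub : {subset pairing_edges s iota' <= s} by apply: mem_subseq; exact: filter_subseq.
rewrite /pairing_term; congr (_ *: _); congr (_ * _).
  congr (koszul k _ _ (_ ++ _)); rewrite /edge_word; congr flatten.
  by apply/eq_in_map => p /sub ps; rewrite E.
by rewrite big_seq [RHS]big_seq; apply: eq_bigr => p /sub ps; rewrite E.
Qed.

End Values.

Lemma pairing_value_map (P Q : eqType) (f : P -> Q) (lt : Q -> letter) iota iota' s :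
  injective f -> {in s, forall p, iota' (f p) = f (iota p)} ->
  pairing_value lt (map f s) iota' = pairing_value (lt \o f) s iota.
Proof.
move=> fI E; rewrite /pairing_value.
have -> : pairing_edges (map f s) iota' = map f (pairing_edges s iota).
  rewrite /pairing_edges filter_map; congr map; apply: eq_in_filter => p ps /=.
  by rewrite E // !index_map.
have -> : pairing_leaves (map f s) iota' = map f (pairing_leaves s iota).
  rewrite /pairing_leaves filter_map; congr map; apply: eq_in_filter => p ps /=.
  by rewrite E // (inj_eq fI).
have sub : {subset pairing_edges s iota <= s} by apply: mem_subseq; exact: filter_subseq.
rewrite /pairing_term -map_comp; congr (_ *: _); congr (_ * _).
  rewrite -(koszul_map _ (fun q => ldeg (lt q)) _ _ fI) map_cat; congr (koszul k _ _ (_ ++ _)).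
  rewrite /edge_word map_flatten -!map_comp; congr flatten.
  by apply/eq_in_map => p /sub ps /=; rewrite E.
by rewrite big_map big_seq [RHS]big_seq; apply: eq_bigr => p /sub ps /=; rewrite E.
Qed.

End Pairings.

(** * Graphs *)

Section Connect.
Variables (T U : finType).

Lemma connect_closed (r : rel T) (A : {pred T}) x y :
  (forall v w, r v w -> v \in A -> w \in A) -> connect r x y -> x \in A -> y \in A.
Proof.
move=> cl /connectP[p]; elim: p x => [|z p IH] x /=; first by move=> _ ->.
by move=> /andP[xz pz] E /(cl _ _ xz); exact: IH pz E.
Qed.

Lemma connect_homo (r : rel T) (r' : rel U) (f : T -> U) x y :
  (forall v w, r v w -> connect r' (f v) (f w)) -> connect r x y -> connect r' (f x) (f y).
Proof.
move=> H xy; have := @connect_closed r [pred z | connect r' (f x) (f z)] x y.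
by rewrite !inE connect0 => ->// v w /H vw; rewrite !inE => /connect_trans; exact.
Qed.

End Connect.

Section PairingGraph.
Variables (P W : finType) (at_ : P -> W).

Definition pairing_adj (iota : P -> P) : rel W :=
  fun v w => [exists e, (at_ e == v) && (at_ (iota e) == w)].
Definition pairing_connected (D : {set W}) (iota : P -> P) : bool :=
  [forall v in D, forall w in D, connect (pairing_adj iota) v w].
Definition moved (iota : P -> P) : {set P} := [set e | iota e != e].

Lemma pairing_adjP iota e : pairing_adj iota (at_ e) (at_ (iota e)).
Proof. by apply/existsP; exists e; rewrite !eqxx. Qed.

Lemma pairing_adj_sym iota : involutive iota -> symmetric (pairing_adj iota).
Proof.
move=> inv; suff H v w : pairing_adj iota v w -> pairing_adj iota w v by move=> v w; apply/idP/idP => /H.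
by move=> /existsP[e /andP[/eqP <- /eqP <-]]; apply/existsP; exists (iota e); rewrite inv !eqxx.
Qed.

End PairingGraph.

(** The injective rank [r] selects one element of each 2-cycle; the moved points are the selected
    elements and their images. *)
Lemma card_moved (P : finType) (iota : P -> P) (r : P -> nat) : injective r -> involutive iota ->
  #|moved iota| = (2 * #|[set e | r e < r (iota e)]|)%N.
Proof.
move=> rI inv; set E := [set e | _].
have -> : moved iota = E :|: iota @: E.
  apply/setP => e; rewrite !inE; apply/idP/idP => [ne|/orP[]].
  - have [lt|gt|E'] := ltngtP (r e) (r (iota e)) => //=.
      by apply/imsetP; exists (iota e); rewrite ?inE inv.
    by rewrite -(rI _ _ E') eqxx in ne.
  - by apply: contraTneq => ->; rewrite ltnn.
  - by move=> /imsetP[e']; rewrite inE => lt ->; apply: contraTneq lt; rewrite inv => <-; rewrite ltnn.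
rewrite cardsU card_imset; last exact: inv_inj.
suff -> : E :&: iota @: E = set0 by rewrite cards0 subn0 mul2n addnn.
apply/setP => e; rewrite !inE; apply/negP => /andP[lt /imsetP[e']].
by rewrite inE => lt' E'; move: lt lt'; rewrite E' inv; case: ltngtP.
Qed.

(** * Euler characteristic and isomorphism classes of graphs *)

Section MGraphs.
Variables h n N : nat.
Implicit Types G : mgraph h n N.

Definition mg_involutive G := [forall e, mg_inv G (mg_inv G e) == e].

Lemma mg_involutiveP G : reflect (involutive (mg_inv G)) (mg_involutive G).
Proof. exact: 'forall_eqP. Qed.

Lemma mg_connectedE G : mg_connected G = pairing_connected (mg_at G) [set: 'I_n] (mg_inv G).
Proof.
apply/forallP/forallP => H v.
  by apply/implyP => _; apply/forallP => w; apply/implyP => _; exact: (forallP (H v)).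
by apply/forallP => w; move: (H v); rewrite inE => /forallP /(_ w); rewrite inE.
Qed.

Lemma card_mg_edges G : mg_involutive G -> #|moved (mg_inv G)| = (2 * #|mg_edges G|)%N.
Proof. by move=> /mg_involutiveP inv; exact: card_moved val_inj inv. Qed.

(* The left kernel of the transposed boundary map consists of the functions on
   the vertices which are constant on connected components. *)
Lemma rank_mg_boundary G : mg_involutive G -> mg_connected G -> (0 < n)%N ->
  (\rank (mg_boundary G)).+1 = n.
Proof.
move=> /mg_involutiveP inv conn n0; set M := mg_boundary G.
pose z := Ordinal n0.
have [H1 H2] : (\rank (kermx M^T) <= 1)%N /\ (1 <= \rank (kermx M^T))%N.
  pose ones : 'rV[rat]_n := const_mx 1.
  have kerP (u : 'rV[rat]_n) : (u <= kermx M^T)%MS -> u = u 0 z *: ones.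
    move=> /sub_kermxP E.
    have ue e : u 0 (mg_at G (mg_inv G e)) = u 0 (mg_at G e).
      have ue' (e' : 'I_h) : e' \in mg_edges G -> u 0 (mg_at G (mg_inv G e')) = u 0 (mg_at G e').
        move=> he; pose i := enum_rank_in he e'.
        have := congr1 (fun A : 'rV_ _ => A 0 i) E; rewrite !mxE.
        under eq_bigr => v _ do rewrite !mxE /i (enum_rankK_in he he) mulrBr.
        rewrite sumrB.
        have sd (w : 'I_n) : \sum_(v < n) u 0 v * (w == v)%:R = u 0 w.
          rewrite (bigD1 w) //= eqxx mulr1 big1 ?addr0 // => v nv.
          by rewrite eq_sym (negPf nv) mulr0.
        by rewrite !sd => /eqP; rewrite subr_eq0 => /eqP.
      have [lt|gt|E'] := ltngtP e (mg_inv G e).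
      - by apply: ue'; rewrite inE.
      - by rewrite -[in RHS](inv e) (ue' (mg_inv G e)) // inE inv.
      - by rewrite -(val_inj E').
    apply/rowP => v; rewrite !mxE mulr1.
    have := @connect_closed _ (mg_adj G) [pred w | u 0 w == u 0 z] z v.
    rewrite !inE eqxx => H; apply/eqP; apply: H => //.
      by move=> a b /existsP[e /andP[/eqP <- /eqP <-]]; rewrite !inE ue.
    exact: (forallP (forallP conn z) v).
  split.
    apply: leq_trans (rank_leq_row ones); apply: mxrankS.
    apply/row_subP => i; rewrite [row i _]kerP ?row_sub //; exact: scalemx_sub.
  rewrite lt0n mxrank_eq0; apply/eqP => K0.
  have : (ones <= kermx M^T)%MS.
    apply/sub_kermxP/rowP => i; rewrite !mxE.
    under eq_bigr => v _ do rewrite !mxE mul1r.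
    rewrite sumrB.
    have sd (w : 'I_n) : \sum_(v < n) (w == v)%:R = 1 :> rat.
      rewrite (bigD1 w) //= eqxx big1 ?addr0 // => v nv.
      by rewrite eq_sym (negPf nv).
    by rewrite !sd subrr.
  rewrite K0 submx0 => /eqP /rowP /(_ z); rewrite !mxE => /eqP.
  by rewrite oner_eq0.
have E : \rank (kermx M^T) = 1%N by apply/eqP; rewrite eqn_leq H1 H2.
move: E; rewrite mxrank_ker mxrank_tr => E.
have := rank_leq_col M; lia.
Qed.

(** Euler characteristic of a connected graph, $n-|E|=1-b_1$, doubled so that edges are counted by
    half-edges, and arranged without subtraction of natural numbers. *)
Lemma mg_genusE G : mg_involutive G -> mg_connected G -> (0 < n)%N ->
  (2 * (mg_genus G + n) = 2 * (\sum_v mg_label G v) + 2 + #|moved (mg_inv G)|)%N.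
Proof.
move=> inv conn n0; rewrite card_mg_edges //.
have := rank_mg_boundary inv conn n0; rewrite /mg_genus /mg_b1 mxrank_ker.
have := rank_leq_row (mg_boundary G).
move: (\rank _) (\sum_v _)%N => r s; lia.
Qed.

Lemma mg_isoP G G' (p : {perm 'I_h} * {perm 'I_n}) :
  reflect [/\ forall e, mg_at G' (p.1 e) = p.2 (mg_at G e),
              forall e, mg_inv G' (p.1 e) = p.1 (mg_inv G e),
              forall v, mg_label G' (p.2 v) = mg_label G v
            & forall i, mg_mark G' i = p.2 (mg_mark G i)] (p \in mg_iso_set G G').
Proof.
rewrite inE; apply: (iffP and4P) => [[H1 H2 H3 H4]|[H1 H2 H3 H4]].
  by split=> z; apply/eqP; [exact: (forallP H1)|exact: (forallP H2)|exact: (forallP H3)|exact: (forallP H4)].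
by split; apply/forallP => z; apply/eqP.
Qed.

Lemma mg_iso1 G : (1%g, 1%g) \in mg_iso_set G G.
Proof. by apply/mg_isoP; split=> z /=; rewrite !perm1. Qed.

Lemma mg_isoM G1 G2 G3 p q : p \in mg_iso_set G1 G2 -> q \in mg_iso_set G2 G3 ->
  ((p.1 * q.1)%g, (p.2 * q.2)%g) \in mg_iso_set G1 G3.
Proof.
move=> /mg_isoP[a1 a2 a3 a4] /mg_isoP[b1 b2 b3 b4]; apply/mg_isoP; split=> z /=; rewrite !permM.
- by rewrite b1 a1.
- by rewrite b2 a2.
- by rewrite b3 a3.
- by rewrite b4 a4.
Qed.

Lemma mg_isoV G1 G2 p : p \in mg_iso_set G1 G2 -> ((p.1)^-1%g, (p.2)^-1%g) \in mg_iso_set G2 G1.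
Proof.
move=> /mg_isoP[a1 a2 a3 a4]; apply/mg_isoP; split=> z /=.
- by apply: (@perm_inj _ p.2); rewrite -a1 !permKV.
- by apply: (@perm_inj _ p.1); rewrite -a2 !permKV.
- by rewrite -a3 permKV.
- by rewrite a4 permK.
Qed.

Lemma mg_iso_gt0 G G' p : p \in mg_iso_set G G' -> mg_iso G G'.
Proof. by move=> H; rewrite /mg_iso card_gt0; apply/set0Pn; exists p. Qed.

Lemma mg_isoE G G' : mg_iso G G' -> exists p, p \in mg_iso_set G G'.
Proof. by rewrite /mg_iso card_gt0 => /set0Pn. Qed.

Lemma mg_iso_refl G : mg_iso G G.
Proof. exact: mg_iso_gt0 (mg_iso1 G). Qed.

Lemma mg_iso_trans G1 G2 G3 : mg_iso G1 G2 -> mg_iso G2 G3 -> mg_iso G1 G3.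
Proof. by move=> /mg_isoE[p Hp] /mg_isoE[q Hq]; exact: mg_iso_gt0 (mg_isoM Hp Hq). Qed.

Lemma mg_iso_symm G1 G2 : mg_iso G1 G2 = mg_iso G2 G1.
Proof. by apply/idP/idP => /mg_isoE[p Hp]; exact: mg_iso_gt0 (mg_isoV Hp). Qed.

(** Composition with one isomorphism is a bijection from the automorphisms of [G] to the
    isomorphisms. *)
Lemma card_mg_iso G G' : mg_iso G G' -> #|mg_iso_set G G'| = mg_aut_card G.
Proof.
move=> /mg_isoE[p Hp]; rewrite /mg_aut_card.
pose f (q : {perm 'I_h} * {perm 'I_n}) := ((q.1 * p.1)%g, (q.2 * p.2)%g).
have fI : injective f by move=> [q1 q2] [r1 r2] [] /mulIg -> /mulIg ->.
rewrite -[RHS](card_imset _ fI); apply: eq_card => q; apply/idP/imsetP => [Hq|[r Hr ->]].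
  exists ((q.1 * p.1^-1)%g, (q.2 * p.2^-1)%g); first exact: mg_isoM Hq (mg_isoV Hp).
  by rewrite /f /= -!mulgA !mulVg !mulg1; case: q {Hq}.
exact: mg_isoM Hr Hp.
Qed.

(** The matrix [mg_boundary] depends on the numbering of the half-edges through [mg_edges].
    Invariance is therefore derived from [mg_genusE], whose other terms are preserved by
    isomorphisms. *)
Lemma mg_iso_genus G G' g : (0 < n)%N -> mg_iso G G' ->
  G \in mg_of_genus h n N g -> G' \in mg_of_genus h n N g.
Proof.
move=> n0 /mg_isoE[p /mg_isoP[a1 a2 a3 a4]]; rewrite !inE => /and3P[inv conn /eqP gen].
have inv' : mg_involutive G'.
  apply/forallP => e; rewrite -(permKV p.1 e) !a2; apply/eqP; congr (p.1 _); exact/eqP/(forallP inv).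
have conn' : mg_connected G'.
  apply/forallP => v; apply/forallP => w; rewrite -(permKV p.2 v) -(permKV p.2 w).
  apply: (@connect_homo _ _ (mg_adj G)); last exact: (forallP (forallP conn _)).
  move=> a b /existsP[e /andP[/eqP <- /eqP <-]]; apply: connect1; apply/existsP; exists (p.1 e).
  by rewrite a2 !a1 !eqxx.
apply/and3P; split=> //; have := mg_genusE inv' conn' n0; have := mg_genusE inv conn n0.
have -> : (\sum_v mg_label G' v = \sum_v mg_label G v)%N.
  rewrite (reindex_inj (@perm_inj _ p.2)) /=; apply: eq_bigr => v _; by rewrite a3.
have -> : #|moved (mg_inv G')| = #|moved (mg_inv G)|.
  rewrite -[RHS](card_imset _ (@perm_inj _ p.1)); apply: eq_card => e; apply/idP/imsetP.
    rewrite inE => ne; exists (p.1^-1 e)%g; last by rewrite permKV.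
    rewrite inE -(inj_eq (@perm_inj _ p.1)) -a2 permKV //.
  by move=> [e' He' ->]; move: He'; rewrite !inE a2 (inj_eq (@perm_inj _ p.1)).
rewrite -gen => <-; move: (mg_genus _) (mg_genus _) => *; lia.
Qed.

Lemma mg_iso_equiv g : {in mg_of_genus h n N g & &, equivalence_rel (@mg_iso h n N)}.
Proof.
move=> x y z _ _ _; split; first exact: mg_iso_refl.
move=> xy; apply/idP/idP => H; last exact: mg_iso_trans xy H.
by rewrite mg_iso_symm in xy; exact: mg_iso_trans xy H.
Qed.

Lemma mg_classes_transversal g :
  is_transversal (mg_classes h n N g)
    (equivalence_partition (@mg_iso h n N) (mg_of_genus h n N g)) (mg_of_genus h n N g).
Proof. exact: transversalP (equivalence_partitionP (@mg_iso_equiv g)). Qed.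

Lemma mg_classes_genus g G : G \in mg_classes h n N g -> G \in mg_of_genus h n N g.
Proof. by apply/subsetP; case/and3P: (mg_classes_transversal g). Qed.

(** If [G0] lies in [mg_of_genus], exactly one representative is isomorphic to it, with as many
    isomorphisms to [G0] as automorphisms; otherwise there is none. Characteristic 0 makes $|Aut|$
    invertible. *)
Lemma mg_classes_sum (k : fieldType) (char_k : [pchar k] =i pred0) G0 g : (0 < n)%N ->
  \sum_(G in mg_classes h n N g) (mg_aut_card G)%:R^-1 * (#|mg_iso_set G G0|)%:R
   = (G0 \in mg_of_genus h n N g)%:R :> k.
Proof.
move=> n0; set D := mg_of_genus h n N g.
have eqR := @mg_iso_equiv g; have part := equivalence_partitionP eqR.
have := mg_classes_transversal g; have := @mg_classes_genus g.
move: (mg_classes h n N g) => X sub trv.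
rewrite (eq_bigr (fun G => (mg_iso G G0)%:R)); last first.
  move=> G _; case: (boolP (mg_iso G G0)) => [iso|]; last first.
    by rewrite /mg_iso -eqn0Ngt => /eqP ->; rewrite mulr0.
  rewrite card_mg_iso // mulVf // (proj1 (pcharf0P k) char_k) -lt0n; exact: mg_iso_refl.
rewrite -natr_sum -big_mkcondr /= sum1_card.
case: (boolP (G0 \in D)) => [GD'|nGD]; last first.
  rewrite eq_card0 // => G; rewrite inE; apply/negP => /andP[/sub GD iso].
  by case/negP: nGD; exact: mg_iso_genus iso GD.
have BP : pblock (equivalence_partition (@mg_iso h n N) D) G0 \in equivalence_partition (@mg_iso h n N) D.
  by rewrite pblock_mem // (cover_partition part).
case/and3P: trv => _ _ /forallP /(_ (pblock (equivalence_partition (@mg_iso h n N) D) G0)).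
rewrite BP /= => /eqP <-; congr _%:R; apply: eq_card => G; rewrite !inE.
have [GX|GX] := boolP (G \in X); rewrite -[LHS]topredE /= ?GX ?(negPf GX) //; have GD := sub G GX.
by rewrite (pblock_equivalence_partition eqR GD' GD) mg_iso_symm.
Qed.

End MGraphs.

Lemma perm_enum_map (T : finType) (phi : {perm T}) : perm_eq (enum T) (map phi (enum T)).
Proof.
apply: uniq_perm; [exact: enum_uniq|by rewrite (map_inj_uniq (@perm_inj _ phi)) enum_uniq|].
by move=> p; rewrite mem_enum; apply/esym/mapP; exists (phi^-1 p)%g; rewrite ?mem_enum ?permKV.
Qed.

(** * Decorated graphs as bijections from half-edges to letters *)

Section GraphOperation.
Variables (k : fieldType) (V : lmodType k) (gr : int -> V -> Prop).
Variable form : letter gr -> letter gr -> k.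
Local Notation letter := (letter gr).
Hypotheses (formS : form_symmetric form) (formE : form_even form).

Lemma card_reshape_index (T : Type) (ss : seq (seq T)) i :
  #|[set j : 'I_(size (flatten ss)) | reshape_index (shape ss) j == i]| = size (nth [::] ss i).
Proof.
pose sh := shape ss.
have nsh : nth 0 sh i = size (nth [::] ss i).
  rewrite /sh /shape; have [lt|ge] := ltnP i (size ss); first by rewrite (nth_map [::]).
  by rewrite !nth_default ?size_map.
rewrite -nsh.
have lt_c (c : 'I_(nth 0 sh i)) : (flatten_index sh i c < size (flatten ss))%N.
  by rewrite size_flatten; apply: flatten_indexP.
have fI : injective (fun c : 'I_(nth 0 sh i) => Ordinal (lt_c c)).
  by move=> c c' [] /(congr1 (reshape_offset sh)); rewrite !flatten_indexKr // => /val_inj.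
rewrite -[RHS]card_ord -[RHS](card_imset _ fI); apply: eq_card => j; rewrite inE.
apply/eqP/imsetP => [E|[c _ ->]]; last by rewrite /= flatten_indexKl.
have lo : (reshape_offset sh j < nth 0 sh i)%N.
  by rewrite -E; apply: reshape_offsetP; rewrite -size_flatten.
by exists (Ordinal lo) => //; apply: val_inj; rewrite /= -E reshape_indexK.
Qed.

Variables (ws : seq (seq letter)) (gs : seq nat) (g : nat).
Local Notation h := (size (flatten ws)).
Local Notation n := (size ws).

Lemma block_lt (j : 'I_h) : (reshape_index (shape ws) j < n)%N.
Proof. by rewrite -(size_map size ws); apply: reshape_indexP; rewrite -size_flatten. Qed.

Definition block : {ffun 'I_h -> 'I_n} := [ffun j => Ordinal (block_lt j)].

(** Half-edges are the letters, vertices the words, and the marking is the identity. For an exponent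
    above [g], [inord] returns a default label; [taylor_words_pairings] treats that case
    separately. *)
Definition letter_graph (iota : {ffun 'I_h -> 'I_h}) : mgraph h n g.+1 :=
  MGraph block iota [ffun i : 'I_n => inord (nth 0%N gs i)] 1%g.

Local Notation x := (tnth (in_tuple (flatten ws))).

Section OneGraph.
Variable G : mgraph h n g.+1.
Hypothesis invG : mg_involutive G.

Lemma mem_mg_half_edges e : e \in mg_half_edges G.
Proof.
apply/flattenP; exists [seq e' <- enum 'I_h | mg_at G e' == mg_at G e]; last first.
  by rewrite mem_filter eqxx mem_enum.
by apply/mapP; exists ((mg_mark G)^-1%g (mg_at G e)); rewrite ?mem_enum ?permKV.
Qed.

Lemma perm_mg_half_edges : perm_eq (mg_half_edges G) (enum 'I_h).
Proof.
have ge1 i : (1 <= count_mem i (mg_half_edges G))%N.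
  by rewrite -has_count has_pred1 mem_mg_half_edges.
apply: uniq_perm; last by move=> e; rewrite mem_mg_half_edges mem_enum.
  rewrite /mg_half_edges; have := enum_uniq 'I_n; elim: (enum 'I_n) => //= i s IH /andP[nis us].
  rewrite cat_uniq filter_uniq ?enum_uniq ?IH //= andbT.
  apply/hasPn => e /flatten_mapP[j js]; rewrite !mem_filter => /andP[/eqP E _].
  apply/negP; rewrite E => /andP[/eqP /perm_inj E' _].
  by rewrite -E' js in nis.
exact: enum_uniq.
Qed.

Lemma index_half_edge_lt e : (index e (mg_half_edges G) < h)%N.
Proof.
have E : size (mg_half_edges G) = h by rewrite (perm_size perm_mg_half_edges) size_enum_ord.
by rewrite -[X in (_ < X)%N]E index_mem mem_mg_half_edges.
Qed.

Lemma rank_half_edge_inj : injective (fun e => Ordinal (index_half_edge_lt e)).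
Proof. by move=> e e' [] /(index_inj e); apply; exact: mem_mg_half_edges. Qed.

(** The bijection underlying [deco]: half-edges in marking order are matched with the letters in the
    order of the words. *)
Definition rank_half_edge : {perm 'I_h} := perm rank_half_edge_inj.

Lemma map_rank_half_edge : map rank_half_edge (mg_half_edges G) = enum 'I_h.
Proof.
have us : uniq (mg_half_edges G) by rewrite (perm_uniq perm_mg_half_edges) enum_uniq.
have sz : size (mg_half_edges G) = h by rewrite (perm_size perm_mg_half_edges) size_enum_ord.
apply: (inj_map val_inj); rewrite val_enum_ord -map_comp.
apply: (@eq_from_nth _ 0%N) => [|i]; rewrite ?size_iota size_map ?sz // => lt.
rewrite (nth_map (Ordinal lt)) ?sz // nth_iota //= permE /=.
by rewrite index_uniq ?sz.
Qed.

Lemma deco_rank (w : 'I_h -> letter) e : deco G w e = w (rank_half_edge e).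
Proof.
rewrite /deco permE /= codomE (nth_map e) ?size_enum_ord ?index_half_edge_lt //.
by congr (w _); apply: val_inj; rewrite /= nth_enum_ord ?index_half_edge_lt.
Qed.

(** With valences equal to word lengths, the lists of half-edges at the marked vertices have the
    same shape as [ws], so matching the flattened lists respects the blocks. *)
Lemma block_rank : (forall i : 'I_n, size (nth [::] ws i) = mg_valence G (mg_mark G i)) ->
  forall e, mg_mark G (block (rank_half_edge e)) = mg_at G e.
Proof.
move=> hval e; set bb := [seq [seq e <- enum 'I_h | mg_at G e == mg_mark G i] | i <- enum 'I_n].
have sh : shape bb = shape ws.
  have sbb : size bb = n by rewrite size_map size_enum_ord.
  apply: (@eq_from_nth _ 0%N) => [|i]; first by rewrite !size_map -enumT size_enum_ord.
  rewrite size_map sbb => lt.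
  have E1 : nth [::] bb i = [seq e <- enum 'I_h | mg_at G e == mg_mark G (Ordinal lt)].
    rewrite (nth_map (Ordinal lt)) ?size_enum_ord //.
    by have -> : nth (Ordinal lt) (enum 'I_n) i = Ordinal lt by apply: val_inj; rewrite /= nth_enum_ord.
  rewrite (nth_map [::]) ?sbb // E1 (nth_map [::]) // (hval (Ordinal lt)).
  rewrite /mg_valence cardE; congr size.
  by rewrite [RHS]/enum_mem -enumT; apply: eq_filter => e'; rewrite !inE.
set i := block _; have Ei : val i = reshape_index (shape bb) (index e (mg_half_edges G)).
  by rewrite /i ffunE /= permE sh.
have lt : (index e (mg_half_edges G) < sumn (shape bb))%N.
  by rewrite sh -size_flatten index_half_edge_lt.
have := nth_flatten e bb (index e (mg_half_edges G)).
rewrite -/(mg_half_edges G) nth_index ?mem_mg_half_edges // -Ei.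
have lti : (i < size bb)%N by rewrite size_map size_enum_ord.
have lt2 : (reshape_offset (shape bb) (index e (mg_half_edges G)) < size (nth [::] bb i))%N.
  have := reshape_offsetP lt; rewrite -Ei /shape (nth_map [::]) //.
move=> E; have : e \in nth [::] bb i by rewrite [X in X \in _]E mem_nth.
rewrite /bb (nth_map i) ?size_enum_ord // nth_ord_enum mem_filter => /andP[/eqP -> //].
Qed.

Lemma pairing_list_map (phi : {perm 'I_h}) (iota : 'I_h -> 'I_h) :
  (forall e, iota (phi e) = phi (mg_inv G e)) ->
  pairing_list iota (enum 'I_h) (map phi (enum (mg_edges G))) (map phi (mg_leaves G)).
Proof.
move=> E; have /mg_involutiveP inv := invG.
have i_on : involution_on (enum 'I_h) (mg_inv G) by move=> p _; rewrite mem_enum inv.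
have /andP[p1 _] := pairing_listP (enum_uniq 'I_h) i_on.
have EE : pairing_edges (enum 'I_h) (mg_inv G) = enum (mg_edges G).
  rewrite /pairing_edges [RHS]/enum_mem -enumT; apply: eq_filter => p.
  by transitivity (p \in mg_edges G); first by rewrite inE !index_enum_ord.
rewrite EE in p1; apply/andP; split; last first.
  apply/allP => p /mapP[e]; rewrite mem_filter => /andP[/eqP fx _] ->.
  by rewrite E fx.
apply: perm_trans (perm_enum_map phi) _.
have -> : edge_word iota (map phi (enum (mg_edges G))) = map phi (edge_word (mg_inv G) (enum (mg_edges G))).
  by rewrite /edge_word map_flatten -!map_comp; congr flatten; apply: eq_map => e /=; rewrite E.
rewrite -map_cat; apply: perm_map; apply: perm_trans p1 _; rewrite perm_cat2l.
rewrite perm_sym /mg_leaves /pairing_leaves; exact: perm_filter perm_mg_half_edges.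
Qed.

(** [rank_half_edge] followed by [t] carries the edges of [G] to those of [iota]. The sign of the
    desymmetrization and that of the contraction compose by [koszul_trans], and [pairing_valueE]
    allows the edges to be listed as [G] lists them. *)
Lemma contract_value (t : {perm 'I_h}) (iota : 'I_h -> 'I_h) :
  (forall e, iota (t (rank_half_edge e)) = t (rank_half_edge (mg_inv G e))) ->
  koszul k (fun j => ldeg (x j)) (enum 'I_h) [seq t j | j <- enum 'I_h]
      *: contract form G (fun j => x (t j)) = pairing_value form x (enum 'I_h) iota.
Proof.
move=> E; pose phi := (rank_half_edge * t)%g.
have phiE e : phi e = t (rank_half_edge e) by rewrite permM.
have Ephi e : iota (phi e) = phi (mg_inv G e) by rewrite !phiE E.
have pl := pairing_list_map Ephi.
have i_on : involution_on (enum 'I_h) iota.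
  have /mg_involutiveP inv := invG.
  move=> p _; rewrite mem_enum; split=> //.
  by rewrite -(permKV phi p) !Ephi inv.
rewrite (pairing_valueE x formS formE (enum_uniq _) i_on pl) /contract scalerA mulrA.
have decoE e : deco G (fun j => x (t j)) e = x (phi e) by rewrite deco_rank phiE.
congr (_ *: _); last first.
  by rewrite -map_comp; congr (@symw k V gr _); apply: eq_map => e /=; rewrite decoE.
congr (_ * _); last first.
  rewrite big_map big_enum /=; apply: eq_bigr => e _; by rewrite !decoE Ephi.
have EH : [seq t j | j <- enum 'I_h] = map phi (mg_half_edges G).
  by rewrite -map_rank_half_edge -map_comp; apply: eq_map => e; rewrite phiE.
have EC : edge_word iota (map phi (enum (mg_edges G))) ++ map phi (mg_leaves G) = map phi (mg_contraction_order G).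
  rewrite /mg_contraction_order map_cat; congr (_ ++ _).
  by rewrite /edge_word map_flatten -!map_comp; congr flatten; apply: eq_map => e /=; rewrite Ephi.
rewrite EC EH (eq_koszul _ (p := fun e => ldeg (deco G (fun j => x (t j)) e)) (q := (fun j => ldeg (x j)) \o phi)); last by move=> e _; exact: (congr1 (@ldeg k V gr) (decoE e)).
rewrite -(koszul_map k (fun j => ldeg (x j)) _ _ (@perm_inj _ phi)).
apply: koszul_trans; first exact: enum_uniq.
  by rewrite -EH perm_enum_map.
by case/andP: pl; rewrite EC.
Qed.

End OneGraph.
End GraphOperation.

(** * Taylor coefficients as sums over pairings *)

Section TaylorPairings.
Variables (k : fieldType) (V : lmodType k) (gr : int -> V -> Prop).
Variable form : letter gr -> letter gr -> k.
Local Notation letter := (letter gr).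
Hypotheses (formS : form_symmetric form) (formE : form_even form).
Variables (ws : seq (seq letter)) (gs : seq nat) (g : nat).
Local Notation h := (size (flatten ws)).
Local Notation n := (size ws).
Local Notation x := (tnth (in_tuple (flatten ws))).
Local Notation lg := (letter_graph (ws := ws) gs g).
Local Notation block := (block ws).
Local Notation value iota := (pairing_value form x (enum 'I_h) iota).

Section OneGraph.
Variable G : mgraph h n g.+1.
Hypothesis invG : mg_involutive G.
Hypothesis gs_lt : forall i : 'I_n, (nth 0%N gs i < g.+1)%N.

Let labelled := [forall i : 'I_n, nth 0%N gs i == mg_label G (mg_mark G i)].
Let respects (phi : {perm 'I_h}) := [forall e, mg_mark G (block (phi e)) == mg_at G e].
Let transport (phi : {perm 'I_h}) := [ffun j => phi (mg_inv G (phi^-1%g j))].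

(** The marking of the letter graph is the identity, so the vertex part of an isomorphism is forced
    to be the inverse marking. Only the bijection [phi] of half-edges is free, and it determines
    [iota]. *)
Lemma card_iso_letter_graph iota :
  #|mg_iso_set G (lg iota)| =
  #|[set phi : {perm 'I_h} | [&& labelled, respects phi & iota == transport phi]]|.
Proof.
pose f (phi : {perm 'I_h}) := (phi, (mg_mark G)^-1%g).
have fI : injective f by move=> ? ? [].
rewrite -[RHS](card_imset _ fI); apply: eq_card => -[phi tau].
apply/mg_isoP/imsetP => [[/= a1 a2 a3 a4]|[phi' + []-> ->]].
  have Et : tau = (mg_mark G)^-1%g.
    by apply/permP => v; rewrite -{1}(permKV (mg_mark G) v) -a4 perm1.
  exists phi; last by rewrite /f Et.
  rewrite inE; apply/and3P; split.
  - apply/forallP => i; have := a3 (mg_mark G i).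
    rewrite ffunE Et permK => <-; by rewrite inordK.
  - by apply/forallP => e; rewrite a1 Et permKV.
  - by apply/eqP/ffunP => j; rewrite ffunE -a2 permKV.
rewrite inE => /and3P[/forallP lab /forallP res /eqP ->]; split=> /= z.
- by apply: (@perm_inj _ (mg_mark G)); rewrite permKV (eqP (res z)).
- by rewrite ffunE permK.
- have /eqP := lab ((mg_mark G)^-1%g z); rewrite permKV => E.
  by rewrite ffunE E inord_val.
- by rewrite perm1 permK.
Qed.

(* A desymmetrization of the decorations of [G] is the same as a bijection [phi]
   from its half-edges to the letters, and [(phi, mark^-1)] is then an isomorphism
   from [G] to the graph on the letters given by the transported involution. *)
Lemma graph_op_iso :
  graph_op form gs G =
  \sum_(iota : {ffun 'I_h -> 'I_h}) (#|mg_iso_set G (lg iota)|)%:R *: value iota.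
Proof.
transitivity (\sum_(phi : {perm 'I_h} | labelled && respects phi) value (transport phi)); last first.
  have E iota : (#|mg_iso_set G (lg iota)|)%:R *: value iota =
      \sum_(phi : {perm 'I_h} | labelled && respects phi && (iota == transport phi)) value (transport phi).
    rewrite card_iso_letter_graph scaler_nat -sumr_const; apply: eq_big => phi.
      by rewrite inE andbA.
    by rewrite inE => /and3P[_ _ /eqP ->].
  rewrite (eq_bigr _ (fun iota _ => E iota)) (exchange_big_dep (fun phi => labelled && respects phi)) /=; last first.
    by move=> ? ? _ /andP[].
  by apply: eq_bigr => phi ->; rewrite big_pred1_eq.
(* If labels or valences differ, no [phi] is admissible: one that respects the vertices matches the
   letters of each word with the half-edges at its vertex, forcing equal cardinalities. *)
rewrite /graph_op; case: ifPn => [cond|ncond]; last first.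
  rewrite big_pred0 // => phi; apply: contraNF ncond => /andP[/forallP lab /forallP res].
  apply/forallP => i; rewrite lab /=; apply/eqP.
  rewrite -card_reshape_index /mg_valence -[RHS](card_imset _ (@perm_inj _ phi)).
  apply: eq_card => j; rewrite inE; apply/eqP/imsetP => [E|[e He ->]].
    exists (phi^-1 j)%g; last by rewrite permKV.
    rewrite inE -(eqP (res _)) permKV; apply/eqP; congr (mg_mark G _).
    by apply: val_inj; rewrite /= ffunE.
  have := res e; rewrite inE in He; rewrite (eqP He) => /eqP /perm_inj <-.
  by rewrite ffunE.
have lab : labelled.
  by apply/forallP => i; case/andP: (forallP cond i).
have val_ok (i : 'I_n) : size (nth [::] ws i) = mg_valence G (mg_mark G i).
  by apply/eqP; case/andP: (forallP cond i).
have br := block_rank val_ok.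
(* The permutation [t] corresponds to [phi = rank_half_edge G * t]; preserving the blocks of letters
   becomes compatibility with the vertices. *)
rewrite lab /= [RHS](reindex_inj (mulgI (rank_half_edge G))) /=.
apply: eq_big => [t|t _].
  apply/forallP/forallP => H.
    move=> e; rewrite permM -br; apply/eqP; congr (mg_mark G _); apply: val_inj.
    by rewrite !ffunE /=; exact/eqP/H.
  move=> j; have := H ((rank_half_edge G)^-1%g j).
  rewrite permM -br !permKV => /eqP /perm_inj /(congr1 val).
  by rewrite !ffunE /= => ->.
apply: (contract_value formS formE invG) => e.
by rewrite ffunE -permM permK permM.
Qed.

End OneGraph.

(** Half-edges outside [D] are required to be fixed, so that the pairings for different sets of
    vertices belong to the same function type. *)
Definition connected_pairing (P W : finType) (at_ : P -> W) (D : {set W})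
    (iota : {ffun P -> P}) : bool :=
  [&& [forall e, iota (iota e) == e], [forall e, (at_ e \notin D) ==> (iota e == e)]
    & pairing_connected at_ D iota].

(* The Euler characteristic of a connected graph turns the genus condition into
   an equation on the number of its internal half-edges, [moved iota]. *)
Definition pairing_genus (P W : finType) (at_ : P -> W) (D : {set W}) (a : W -> nat) (l : nat)
    (iota : {ffun P -> P}) : bool :=
  connected_pairing at_ D iota &&
  (2 * (l + #|D|) == 2 * (\sum_(v in D) a v) + 2 + #|moved iota|)%N.

(** A connected graph on [n] vertices has at least [n - 1] edges. This excludes labels above the
    genus and, later, negative genera. *)
Lemma moved_lower_bound iota : (0 < n)%N -> mg_involutive (lg iota) -> mg_connected (lg iota) ->
  (2 * n <= #|moved iota| + 2)%N.
Proof.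
move=> n0 inv conn; have := mg_genusE inv conn n0; rewrite /mg_genus /=.
move: (\sum_v _)%N (mg_b1 _) #|_| => *; lia.
Qed.

Hypothesis char_k : [pchar k] =i pred0.

(** After exchanging the sums, the weights at each involution add up to 1 or 0 by [mg_classes_sum],
    according to whether its letter graph is connected of genus [g]. *)
Lemma taylor_words_pairings : (0 < n)%N ->
  taylor_words form ws gs g =
  \sum_(iota | pairing_genus block [set: 'I_n] (fun i => nth 0%N gs (val i)) g iota) value iota.
Proof.
move=> n0; rewrite /taylor_words.
have sumE : (\sum_(v in [set: 'I_n]) nth 0%N gs (val v) = \sum_(v < n) nth 0%N gs v)%N.
  by apply: eq_bigl => v; rewrite inE.
case: (boolP [forall i : 'I_n, nth 0%N gs i < g.+1]%N) => [/forallP gs_lt|]; last first.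
  (* A label above [g] annihilates both sides: graph labels are at most [g], and the genus of a
     connected pairing is at least the sum of its labels. *)
  move=> /forallPn[i]; rewrite -leqNgt => gi.
  rewrite big1 ?big_pred0 //.
    move=> iota; apply/negP => /andP[/and3P[inv _ conn] /eqP]; rewrite cardsT card_ord sumE (bigD1 i) //=.
    have := @moved_lower_bound iota n0 inv; rewrite mg_connectedE => /(_ conn).
    move: gi; move: (nth _ _ _) (\sum_(_ < _ | _) _)%N #|moved _| => *; lia.
  move=> G _; rewrite /graph_op ifF ?scaler0 //; apply/negbTE/forallPn; exists i.
  apply/nandP; left; apply: contraTneq gi => ->; rewrite -ltnNge; exact: ltn_ord.
rewrite (eq_bigr (fun G => \sum_(iota : {ffun 'I_h -> 'I_h})
   ((mg_aut_card G)%:R^-1 * (#|mg_iso_set G (lg iota)|)%:R) *: value iota)); last first.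
  move=> G GX; rewrite graph_op_iso // ?scaler_sumr; last first.
    by move/mg_classes_genus: GX; rewrite inE => /and3P[].
  by apply: eq_bigr => iota _; rewrite scalerA.
rewrite exchange_big [RHS]big_mkcond /=; apply: eq_bigr => iota _.
rewrite -scaler_suml mg_classes_sum // inE -[RHS]scale1r.
have -> : pairing_genus block [set: 'I_n] (fun i => nth 0%N gs (val i)) g iota =
    [&& mg_involutive (lg iota), mg_connected (lg iota) & mg_genus (lg iota) == g].
  rewrite /pairing_genus /connected_pairing mg_connectedE -/(mg_involutive (lg iota)).
  have -> : [forall e, (block e \notin [set: 'I_n]) ==> (iota e == e)] by apply/forallP => e; rewrite inE.
  case inv: (mg_involutive _) => //=; case conn: (pairing_connected _ _ _) => //=.
  have conn' : mg_connected (lg iota) by rewrite mg_connectedE.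
  have E := mg_genusE inv conn' n0.
  have lE : (\sum_v mg_label (lg iota) v = \sum_(v < n) nth 0%N gs v)%N.
    by apply: eq_bigr => v _; rewrite ffunE inordK.
  rewrite cardsT card_ord sumE -lE; move: E => /=.
  by move: (mg_genus _) (\sum_v _)%N #|moved _| => *; lia.
by case: ifP; rewrite ?scale0r ?scaler0.
Qed.

End TaylorPairings.

(** * Pairings on an arbitrary finite set of letters *)

Section Blocks.
Variables (k : fieldType) (V : lmodType k) (gr : int -> V -> Prop).
Variable form : letter gr -> letter gr -> k.
Local Notation letter := (letter gr).
Hypotheses (formS : form_symmetric form) (formE : form_even form).
Hypothesis char_k : [pchar k] =i pred0.

Variables (P W : finType) (lt : P -> letter) (at_ : P -> W) (B : W -> seq P) (vs : seq W).
Hypotheses (uvs : uniq vs) (uB : forall v, v \in vs -> uniq (B v))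
  (BE : forall v p, v \in vs -> (p \in B v) = (at_ p == v)).
Let s := flatten [seq B v | v <- vs].

Lemma mem_blocks p : (p \in s) = (at_ p \in vs).
Proof.
apply/flatten_mapP/idP => [[v vvs]|atp]; first by rewrite BE // => /eqP ->.
by exists (at_ p); rewrite ?BE.
Qed.

Lemma uniq_blocks : uniq s.
Proof.
rewrite /s; elim: vs uvs uB BE => //= v vs' IH /andP[nv uvs'] uB' BE'.
rewrite cat_uniq uB' ?mem_head // IH //; first last.
- by move=> w p wv; rewrite BE' // inE wv orbT.
- by move=> w wv; rewrite uB' // inE wv orbT.
rewrite andbT; apply/hasPn => p /flatten_mapP[w wv]; rewrite !BE' ?inE ?eqxx ?wv ?orbT //.
by move=> /eqP ->; apply: contraTneq wv => ->.
Qed.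

Variables (a : W -> nat) (gs : seq nat) (g : nat).
Hypothesis gsE : forall v, v \in vs -> nth 0%N gs (index v vs) = a v.
Hypothesis vs_gt0 : (0 < size vs)%N.

Let ws := [seq [seq lt p | p <- B v] | v <- vs].
Local Notation h := (size (flatten ws)).
Local Notation n := (size ws).

Lemma flatten_words : flatten ws = map lt s.
Proof. by rewrite /ws /s map_flatten -map_comp. Qed.

Lemma size_blocks : size s == h.
Proof. by rewrite flatten_words size_map. Qed.
Lemma size_block_words : size vs == n.
Proof. by rewrite size_map. Qed.

Let psi : 'I_h -> P := tnth (Tuple size_blocks).
Let theta : 'I_n -> W := tnth (Tuple size_block_words).

Lemma psi_inj : injective psi.
Proof. by apply/tuple_uniqP; exact: uniq_blocks. Qed.
Lemma theta_inj : injective theta.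
Proof. by apply/tuple_uniqP. Qed.

Lemma map_psi : map psi (enum 'I_h) = s.
Proof. exact: map_tnth_enum (Tuple size_blocks). Qed.

Lemma psi_mem j : psi j \in s.
Proof. exact: mem_tnth. Qed.
Lemma psi_onto p : p \in s -> exists j, p = psi j.
Proof. by rewrite -map_psi => /mapP[j _ ->]; exists j. Qed.
Lemma theta_mem i : theta i \in vs.
Proof. exact: mem_tnth. Qed.
Lemma theta_onto v : v \in vs -> exists i, v = theta i.
Proof. by move=> vvs; have /tnthP[i ->] : v \in Tuple size_block_words by []; exists i. Qed.

Lemma lt_psi j : lt (psi j) = tnth (in_tuple (flatten ws)) j.
Proof.
have lt_j : (j < size s)%N := leq_trans (ltn_ord j) (eq_leq (esym (eqP size_blocks))).
rewrite /psi (tnth_nth (psi j)) [RHS](tnth_nth (lt (psi j))) /=.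
rewrite -(nth_map (psi j) (lt (psi j)) lt lt_j); congr (nth _ _ _).
by rewrite flatten_words.
Qed.

Lemma at_psi j : at_ (psi j) = theta (block ws j).
Proof.
pose v0 := theta (block ws j).
have sh : shape [seq B v | v <- vs] = shape ws.
  by rewrite /shape /ws -!map_comp; apply: eq_map => v /=; rewrite size_map.
have E : psi j = nth (psi j) s j by rewrite {1}/psi (tnth_nth (psi j)).
have lt_j : (reshape_index (shape ws) j < size vs)%N.
  rewrite -(size_map (fun v => [seq lt p | p <- B v])); exact: block_lt.
have lo : (reshape_offset (shape ws) j < size (B (nth v0 vs (reshape_index (shape ws) j))))%N.
  have : (j < sumn (shape ws))%N by rewrite -size_flatten.
  move=> /reshape_offsetP; rewrite {3}/shape (nth_map [::]) ?size_map //.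
  by rewrite (nth_map v0) // size_map.
have : psi j \in B (nth v0 vs (reshape_index (shape ws) j)).
  by rewrite E nth_flatten sh (nth_map v0) // mem_nth.
rewrite BE ?mem_nth // => /eqP ->.
by rewrite /theta (tnth_nth v0) /= ffunE.
Qed.

(** [push] transports a pairing of the positions in [ws] to [P], extended by the identity, and
    [pull] inverts it on the pairings that fix all letters outside the blocks. There the default
    value [j] of [pull] is never reached. *)
Let push (iota' : {ffun 'I_h -> 'I_h}) : {ffun P -> P} :=
  [ffun p => if [pick j | psi j == p] is Some j then psi (iota' j) else p].
Let pull (iota : {ffun P -> P}) : {ffun 'I_h -> 'I_h} :=
  [ffun j => odflt j [pick j' | psi j' == iota (psi j)]].

Lemma push_psi iota' j : push iota' (psi j) = psi (iota' j).
Proof.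
rewrite ffunE; case: pickP => [j' /eqP /psi_inj -> //|/(_ j)]; by rewrite eqxx.
Qed.

Lemma push_out iota' p : p \notin s -> push iota' p = p.
Proof.
move=> np; rewrite ffunE; case: pickP => // j /eqP E.
by rewrite -E psi_mem in np.
Qed.

Lemma pull_psi (iota : {ffun P -> P}) j : iota (psi j) \in s -> psi (pull iota j) = iota (psi j).
Proof.
move=> /psi_onto[j' E]; rewrite ffunE; case: pickP => [j'' /eqP //|/(_ j')].
by rewrite E eqxx.
Qed.

Lemma pushK : cancel push pull.
Proof.
move=> iota'; apply/ffunP => j; apply: psi_inj.
by rewrite pull_psi ?push_psi // psi_mem.
Qed.

Let D := [set v in vs].

Lemma connected_push iota' :
  connected_pairing at_ D (push iota') = connected_pairing (block ws) [set: 'I_n] iota'.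
Proof.
rewrite /connected_pairing.
have -> : [forall e, (at_ e \notin D) ==> (push iota' e == e)].
  by apply/forallP => e; apply/implyP; rewrite inE -mem_blocks => /push_out ->.
have -> : [forall e, (block ws e \notin [set: 'I_n]) ==> (iota' e == e)].
  by apply/forallP => e; rewrite inE.
have -> : [forall e, push iota' (push iota' e) == e] = [forall e, iota' (iota' e) == e].
  apply/forallP/forallP => H e.
    by have := H (psi e); rewrite !push_psi (inj_eq psi_inj).
  have [/psi_onto[j ->]|ne] := boolP (e \in s); last by rewrite !push_out.
  by rewrite !push_psi (eqP (H j)).
congr (_ && _).
apply/forall_inP/forall_inP => H u.
  move=> _; apply/forall_inP => v _.
  have uD : theta u \in D by rewrite inE theta_mem.
  have vD : theta v \in D by rewrite inE theta_mem.
  have := forall_inP (H _ uD) _ vD.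
  (* [A] is the image of the component of [u]. It is closed under adjacency in [W], because the
     letters at its vertices lie in the blocks. *)
  pose A := [pred w | [exists u', (theta u' == w) && connect (pairing_adj (block ws) iota') u u']].
  move=> /(@connect_closed _ _ A) cl.
  have : theta v \in A.
    apply: cl; last by apply/existsP; exists u; rewrite eqxx connect0.
    move=> w w' /existsP[e /andP[/eqP Ew /eqP Ew']] /existsP[u' /andP[/eqP Eu' uu']].
    have : e \in s by rewrite mem_blocks Ew -Eu' theta_mem.
    move=> /psi_onto[j Ej]; subst e.
    rewrite push_psi in Ew'; apply/existsP; exists (block ws (iota' j)).
    rewrite -at_psi Ew' eqxx /=; apply: connect_trans uu' _; apply: connect1.
    have -> : u' = block ws j by apply: theta_inj; rewrite Eu' -Ew at_psi.
    exact: pairing_adjP.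
  by move=> /existsP[u' /andP[/eqP /theta_inj ->]].
rewrite inE => /theta_onto[i ->]; apply/forall_inP => v; rewrite inE => /theta_onto[i' ->].
apply: (@connect_homo _ _ (pairing_adj (block ws) iota')); last first.
  by have := H i (in_setT _) => /forall_inP; apply; rewrite inE.
move=> v1 v2 /existsP[e /andP[/eqP <- /eqP <-]]; apply: connect1.
by rewrite -!at_psi -push_psi; exact: pairing_adjP.
Qed.

Lemma card_moved_push iota' : #|moved (push iota')| = #|moved iota'|.
Proof.
rewrite -[RHS](card_imset _ psi_inj); apply: eq_card => p; rewrite inE.
have [/psi_onto[j ->]|ns] := boolP (p \in s).
  by rewrite push_psi (inj_eq psi_inj) mem_imset ?inE //; exact: psi_inj.
rewrite push_out // eqxx; apply/esym/imsetP => -[j _ E]; by rewrite E psi_mem in ns.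
Qed.

Lemma pushE iota' : pairing_genus at_ D a g (push iota') =
  pairing_genus (block ws) [set: 'I_n] (fun i => nth 0%N gs (val i)) g iota'.
Proof.
rewrite /pairing_genus connected_push card_moved_push; congr (_ && _).
have cD : #|D| = #|[set: 'I_n]|.
  rewrite cardsT card_ord size_map /D cardsE; exact/card_uniqP.
rewrite cD; congr (_ == 2 * _ + _ + _)%N.
have -> : (\sum_(i in [set: 'I_n]) nth 0 gs (val i) = \sum_(i < n) nth 0 gs i)%N.
  by apply: eq_bigl => i; rewrite inE.
rewrite (eq_bigl (mem vs)); last by move=> v; rewrite inE.
rewrite -big_uniq //=.
transitivity (\sum_(v <- [seq theta i | i <- enum 'I_n]) a v)%N; first by rewrite (map_tnth_enum (Tuple size_block_words)).
rewrite big_map big_enum /=.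
apply: eq_bigr => i _; rewrite -gsE ?theta_mem // /theta.
rewrite (tnth_nth (theta i)) /= index_uniq //.
exact: leq_trans (ltn_ord i) (eq_leq (esym (eqP size_block_words))).
Qed.

Lemma pullK iota : connected_pairing at_ D iota -> push (pull iota) = iota.
Proof.
move=> /and3P[/forallP inv /forallP out _].
have stab p : p \in s -> iota p \in s.
  rewrite !mem_blocks => ps; apply: contraTT ps => ns.
  have := out (iota p); rewrite inE ns (eqP (inv p)) /= => /eqP Ep.
  by rewrite Ep.
apply/ffunP => p; have [/psi_onto[j ->]|ns] := boolP (p \in s).
  by rewrite push_psi pull_psi // stab // psi_mem.
by rewrite push_out //; have := out p; rewrite inE -mem_blocks ns /= => /eqP ->.
Qed.

(** Restates [taylor_words_pairings] on a set [P] of letters with a vertex map [at_]. Sums for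
    different lists of words can then be taken over the same type, as merging and splitting
    require. *)
Theorem taylor_words_blocks :
  taylor_words form ws gs g =
  \sum_(iota | pairing_genus at_ D a g iota) pairing_value form lt s iota.
Proof.
rewrite taylor_words_pairings //; last by rewrite size_map.
rewrite [RHS](reindex_onto push pull); last first.
  by move=> iota /andP[/pullK].
apply: eq_big => [iota'|iota' _]; first by rewrite pushE pushK eqxx andbT.
rewrite -[in RHS]map_psi.
rewrite (pairing_value_map form lt (iota := iota') psi_inj); last by move=> j _; rewrite push_psi.
suff E : lt \o psi =1 tnth (in_tuple (flatten ws)) by rewrite (funext E).
by move=> j; rewrite /= lt_psi.
Qed.

Lemma connected_pairing_card iota : connected_pairing at_ D iota ->
  (2 * size vs <= #|moved iota| + 2)%N.
Proof.
move=> cp; have := cp; rewrite -(pullK cp) connected_push => /and3P[inv _ conn].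
rewrite card_moved_push (eqP size_block_words).
apply: (@moved_lower_bound _ _ _ _ gs g) => //; first by rewrite size_map.
by rewrite mg_connectedE.
Qed.

End Blocks.

(** * Multilinearity *)

Section Positions.
Variables (k : fieldType) (V : lmodType k) (gr : int -> V -> Prop).
Local Notation letter := (letter gr).
Variables (W : finType) (w : W -> seq letter).

Definition position := {l : W & 'I_(size (w l))}.
Definition position_letter (p : position) : letter := tnth (in_tuple (w (tag p))) (tagged p).
Definition position_block (l : W) : seq position :=
  [seq Tagged (fun l => 'I_(size (w l))) i | i <- enum 'I_(size (w l))].

Lemma position_block_letters l : map position_letter (position_block l) = w l.
Proof.
rewrite -map_comp -[RHS](map_tnth_enum (in_tuple (w l))).
by apply: eq_map => i; rewrite /= /position_letter.
Qed.

Lemma mem_position_block l p : (p \in position_block l) = (tag p == l).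
Proof.
apply/mapP/eqP => [[i _ ->] //|<-]; exists (tagged p); first by rewrite mem_enum.
by case: p.
Qed.

Lemma uniq_position_block l : uniq (position_block l).
Proof. by rewrite map_inj_uniq ?enum_uniq // => i j /eqP; rewrite eq_Tagged => /eqP. Qed.

End Positions.

Section LinearPairings.
Variables (k : fieldType) (V : lmodType k) (gr : int -> V -> Prop).
Variable form : letter gr -> letter gr -> k.
Local Notation letter := (letter gr).
Hypotheses (formL : form_linear form) (formS : form_symmetric form) (formE : form_even form).

Lemma form_linear_r (l l1 l2 : letter) c b : ldeg l1 = ldeg l -> ldeg l2 = ldeg l ->
  lval l = c *: lval l1 + lval l2 -> form b l = c * form b l1 + form b l2.
Proof.
move=> d1 d2 E; rewrite (formS b l) (formS b l1) (formS b l2) d1 d2 (formL b d1 d2 E).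
by rewrite mulrDr mulrCA.
Qed.

(** The position [p0] occurs exactly once: among the leaves, where [symw] is multilinear, or in one
    edge, which is moved to the front so that only its form factor changes. The degrees agree, hence
    so do the Koszul signs. *)
Lemma pairing_value_linear (P : eqType) (lt lt1 lt2 : P -> letter) (c : k) (s : seq P) (iota : P -> P) p0 :
  uniq s -> involution_on s iota -> p0 \in s ->
  (forall p, p != p0 -> lt1 p = lt p /\ lt2 p = lt p) ->
  ldeg (lt1 p0) = ldeg (lt p0) -> ldeg (lt2 p0) = ldeg (lt p0) ->
  lval (lt p0) = c *: lval (lt1 p0) + lval (lt2 p0) ->
  pairing_value form lt s iota = c *: pairing_value form lt1 s iota + pairing_value form lt2 s iota.
Proof.
move=> us inv ps off d1 d2 El.
have k1 t : koszul k (fun p => ldeg (lt1 p)) s t = koszul k (fun p => ldeg (lt p)) s t.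
  by apply: eq_koszul => p _; have [->//|/off[->]] := eqVneq p p0.
have k2 t : koszul k (fun p => ldeg (lt2 p)) s t = koszul k (fun p => ldeg (lt p)) s t.
  by apply: eq_koszul => p _; have [->//|/off[_ ->]] := eqVneq p p0.
have words F : p0 \notin F -> map lt1 F = map lt F /\ map lt2 F = map lt F.
  move=> nF; split; apply/eq_in_map => p pF.
    by case: (off p) => //; apply: contraNneq nF => <-.
  by case: (off p) => //; apply: contraNneq nF => <-.
have prods E : p0 \notin edge_word iota E ->
    \prod_(e <- E) form (lt1 e) (lt1 (iota e)) = \prod_(e <- E) form (lt e) (lt (iota e)) /\
    \prod_(e <- E) form (lt2 e) (lt2 (iota e)) = \prod_(e <- E) form (lt e) (lt (iota e)).
  move=> nE; have neq e : e \in E -> e != p0 /\ iota e != p0.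
    move=> eE; split; apply: contraNneq nE => <-; apply/flatten_mapP; exists e => //.
      by rewrite mem_head.
    by rewrite !inE eqxx orbT.
  split; rewrite big_seq [RHS]big_seq; apply: eq_bigr => e /neq[/off[E1 E2] /off[E3 E4]].
    by rewrite E1 E3.
  by rewrite E2 E4.
have pl := pairing_listP us inv; have /andP[pEF aF] := pl.
set E := pairing_edges s iota in pl pEF *; set F := pairing_leaves s iota in pl pEF aF *.
have uEF : uniq (edge_word iota E ++ F) by rewrite -(perm_uniq pEF).
have [pF|npF] := boolP (p0 \in F).
  have npE : p0 \notin edge_word iota E.
    by apply/negP => pE; move: uEF; rewrite cat_uniq => /and3P[_ /hasP[]]; exists p0.
  rewrite !(pairing_valueE _ formS formE us inv pl) /pairing_term k1 k2.
  have [-> ->] := prods _ npE; rewrite scalerA [c * (_ * _)]mulrC -[X in _ = X + _]scalerA -scalerDr; congr (_ *: _).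
  have uF : uniq F by move: uEF; rewrite cat_uniq => /and3P[].
  case/splitPr: pF uF => F1 F2; rewrite cat_uniq /= negb_or => /and3P[_ /andP[n1 _] /andP[n2 _]].
  have [w1 w1'] := words _ n1; have [w2 w2'] := words _ n2.
  rewrite !map_cat /= w1 w1' w2 w2'.
  exact: (proj1 (@symw_multilinear k V gr)).
have pE : p0 \in edge_word iota E by move: ps; rewrite (perm_mem pEF) mem_cat (negPf npF) orbF.
have /flatten_mapP[e eE p0e] := pE.
have [E' pl'] : exists E', pairing_list iota s (e :: E') F.
  case/splitPr: eE pEF => E1 E2 pEF'; exists (E1 ++ E2); apply/andP; split=> //.
  rewrite (permPl pEF') perm_cat2r -[e :: E2]cat1s -[e :: E1 ++ E2]cat1s !edge_word_cat.
  exact: permEl (perm_catCA _ _ _).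
rewrite !(pairing_valueE _ formS formE us inv pl') /pairing_term k1 k2.
have [-> ->] := words _ npF.
have := us; rewrite (perm_uniq (proj1 (andP pl'))) => /= /andP[ne /andP[nie _]].
have nE' : p0 \notin edge_word iota E'.
  move: p0e; rewrite !inE => /orP[]/eqP->.
    by apply: contra ne; rewrite inE mem_cat => ->; rewrite orbT.
  by apply: contra nie; rewrite mem_cat => ->.
rewrite !big_cons; have [-> ->] := prods _ nE'.
rewrite scalerA -scalerDl; congr (_ *: _).
rewrite !mulrA -mulrDl; congr (_ * _); rewrite [c * _]mulrC -mulrA -mulrDr; congr (_ * _).
move: ne; rewrite !inE negb_or eq_sym => /andP[ne _].
move: p0e; rewrite !inE => /orP[]/eqP E0; subst p0.
  by have [-> ->] := off _ ne; exact: formL.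
by rewrite eq_sym in ne; have [-> ->] := off _ ne; exact: form_linear_r.
Qed.

Hypothesis char_k : [pchar k] =i pred0.

Lemma map_cat_inv (A A' : Type) (f : A -> A') s t1 y t2 : map f s = t1 ++ y :: t2 ->
  exists s1 x s2, [/\ s = s1 ++ x :: s2, map f s1 = t1, f x = y & map f s2 = t2].
Proof.
elim: t1 s => [|z t1 IH] [|x s] //= [Ex Es].
  by exists [::], x, s.
have [s1 [x' [s2 [-> <- <- <-]]]] := IH s Es.
by exists (x :: s1), x', s2; rewrite /= Ex.
Qed.

Lemma pairing_genus_involution (P W : finType) (at_ : P -> W) (D : {set W}) a l (iota : {ffun P -> P}) (s : seq P) :
  (forall p, (p \in s) = (at_ p \in D)) -> pairing_genus at_ D a l iota -> involution_on s iota.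
Proof.
move=> sD /andP[/and3P[/forallP inv /forallP out _] _] p; rewrite !sD => pD.
split; last exact/eqP.
apply: contraTT pD => nD; have := out (iota p); rewrite nD (eqP (inv p)) /= => /eqP E.
by rewrite E.
Qed.

(** Changing a letter or exchanging two neighbours leaves the admissible pairings unchanged, so both
    laws are checked on each [pairing_value]. This is what makes [multilift] of this function well
    defined on [SymAlg]. *)
Lemma taylor_words_multilinear gs g ws1 ws2 :
  graded_multilinear (fun w => taylor_words form (ws1 ++ w :: ws2) gs g).
Proof.
have setup ws : (0 < size ws)%N -> exists (P W : finType) (lt : P -> letter) (at_ : P -> W)
    (B : W -> seq P) (vs : seq W) (a : W -> nat),
    [/\ uniq vs, forall v, v \in vs -> uniq (B v),
        forall v p, v \in vs -> (p \in B v) = (at_ p == v),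
        forall v, v \in vs -> nth 0%N gs (index v vs) = a v
      & [seq map lt (B v) | v <- vs] = ws].
  move=> n0; exists (position (fun i : 'I_(size ws) => nth [::] ws i)), 'I_(size ws).
  exists (@position_letter _ _ _ _ _), (fun p => tag p), (@position_block _ _ _ _ _).
  exists (enum 'I_(size ws)), (fun i => nth 0%N gs (val i)); split.
  - exact: enum_uniq.
  - by move=> v _; exact: uniq_position_block.
  - by move=> v p _; exact: mem_position_block.
  - by move=> v _; rewrite index_enum_ord.
  - rewrite -[RHS](map_tnth_enum (in_tuple ws)); apply: eq_map => i.
    by rewrite position_block_letters (tnth_nth [::]).
split=> [u v c l l1 l2 d1 d2 El|u v l1 l2].
  have [|P [W [lt [at_ [B [vs [a [uvs uB BE gsE Ews]]]]]]]] := setup (ws1 ++ (u ++ l :: v) :: ws2).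
    by rewrite size_cat addnS.
  have [vs1 [v0 [vs2 [Evs E1 Ew E2]]]] := map_cat_inv Ews.
  have [Bu [p0 [Bv [EB Eu El0 Ev]]]] := map_cat_inv Ew.
  have vs0 : (0 < size vs)%N by rewrite Evs size_cat addnS.
  have v0vs : v0 \in vs by rewrite Evs mem_cat mem_head orbT.
  pose upd l' := fun p => if p == p0 then l' else lt p.
  have updE l' : [seq map (upd l') (B v) | v <- vs] = ws1 ++ (u ++ l' :: v) :: ws2.
    have off s : p0 \notin s -> map (upd l') s = map lt s.
      move=> ns; apply/eq_in_map => p pin; rewrite /upd ifN //.
      by apply: contraNneq ns => <-.
    have offB vs' : {subset vs' <= vs} -> v0 \notin vs' ->
        [seq map (upd l') (B v) | v <- vs'] = [seq map lt (B v) | v <- vs'].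
      move=> sub nv; apply/eq_in_map => v' v'in; apply: off; rewrite BE ?sub //.
      have : p0 \in B v0 by rewrite EB mem_cat mem_head orbT.
      by rewrite BE // => /eqP ->; apply: contraNneq nv => ->.
    have := uvs; rewrite Evs cat_uniq /= negb_or => /and3P[_ /andP[n1 _] /andP[n2 _]].
    have s1 : {subset vs1 <= vs} by move=> z zin; rewrite Evs mem_cat zin.
    have s2 : {subset vs2 <= vs} by move=> z zin; rewrite Evs mem_cat inE zin !orbT.
    rewrite map_cat /= (offB _ s1 n1) (offB _ s2 n2) E1 E2.
    have := uB _ v0vs; rewrite EB cat_uniq /= negb_or => /and3P[_ /andP[m1 _] /andP[m2 _]].
    by rewrite map_cat /= !off // Eu Ev /upd eqxx.
  have main l' := taylor_words_blocks formS formE char_k (upd l') uvs uB BE g gsE vs0.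
  rewrite -!updE !main scaler_sumr -big_split /=; apply: eq_bigr => iota pg.
  apply: (@pairing_value_linear _ _ _ _ _ _ _ p0).
  - exact: uniq_blocks uvs uB BE.
  - apply: pairing_genus_involution pg => p; by rewrite (mem_blocks BE) inE.
  - by apply/flatten_mapP; exists v0 => //; rewrite EB mem_cat mem_head orbT.
  - by move=> p /negPf np; rewrite /upd np.
  - by rewrite /upd eqxx.
  - by rewrite /upd eqxx.
  - by rewrite /upd eqxx.
have [|P [W [lt [at_ [B [vs [a [uvs uB BE gsE Ews]]]]]]]] := setup (ws1 ++ (u ++ l1 :: l2 :: v) :: ws2).
  by rewrite size_cat addnS.
have [vs1 [v0 [vs2 [Evs E1 Ew E2]]]] := map_cat_inv Ews.
have [Bu [p1 [Bv' [EB Eu El1 Ev']]]] := map_cat_inv Ew.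
have [Bn [p2 [Bv [EB' En El2 Ev]]]] := map_cat_inv (Ev' : _ = [::] ++ l2 :: v).
case: Bn En EB' => // _ /= EB'; subst Bv'.
have vs0 : (0 < size vs)%N by rewrite Evs size_cat addnS.
have v0vs : v0 \in vs by rewrite Evs mem_cat mem_head orbT.
(* Letters stay attached to their positions; exchanging [p1] and [p2] in the block of [v0] changes
   only the order in which positions are listed. *)
pose B2 v := if v == v0 then Bu ++ p2 :: p1 :: Bv else B v.
have pB z : perm_eq (B z) (B2 z).
  rewrite /B2; case: eqP => [->|//]; rewrite EB perm_cat2l.
  exact: permEl (perm_catCA [:: p1] [:: p2] Bv).
have uB2 z : z \in vs -> uniq (B2 z) by move=> vin; rewrite -(perm_uniq (pB z)) uB.
have BE2 z p : z \in vs -> (p \in B2 z) = (at_ p == z) by move=> vin; rewrite -(perm_mem (pB z)) BE.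
have := uvs; rewrite Evs cat_uniq /= negb_or => /and3P[_ /andP[n1 _] /andP[n2 _]].
have offB vs' : v0 \notin vs' -> [seq B2 v | v <- vs'] = [seq B v | v <- vs'].
  move=> nv; apply/eq_in_map => v' v'in; rewrite /B2 ifN //; by apply: contraNneq nv => <-.
have Ews2 : [seq map lt (B2 v) | v <- vs] = ws1 ++ (u ++ l2 :: l1 :: v) :: ws2.
  rewrite [in LHS]Evs map_cat /= -E1 -E2; congr (_ ++ _ :: _).
  - by rewrite (map_comp (map lt) B2) offB // -map_comp.
  - by rewrite /B2 eqxx map_cat /= Eu El1 El2 Ev.
  - by rewrite (map_comp (map lt) B2) offB // -map_comp.
rewrite -Ews -Ews2 (taylor_words_blocks formS formE char_k lt uvs uB BE g gsE vs0).
rewrite (taylor_words_blocks formS formE char_k lt uvs uB2 BE2 g gsE vs0) scaler_sumr.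
apply: eq_bigr => iota pg.
have us := uniq_blocks uvs uB BE.
have io : involution_on (flatten [seq B v | v <- vs]) iota.
  by apply: pairing_genus_involution pg => p; rewrite (mem_blocks BE) inE.
have Es : flatten [seq B v | v <- vs] = flatten [seq B v | v <- vs1] ++ (Bu ++ [:: p1; p2] ++ Bv) ++ flatten [seq B v | v <- vs2].
  by rewrite Evs map_cat flatten_cat /= EB.
have Es2 : flatten [seq B2 v | v <- vs] = flatten [seq B v | v <- vs1] ++ (Bu ++ [:: p2; p1] ++ Bv) ++ flatten [seq B v | v <- vs2].
  by rewrite Evs map_cat flatten_cat /= !offB // /B2 eqxx.
have p12 : perm_eq [:: p1; p2] [:: p2; p1] := permEl (perm_catC [:: p1] [:: p2]).
have ps : perm_eq (flatten [seq B v | v <- vs]) (flatten [seq B2 v | v <- vs]).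
  by rewrite Es Es2 perm_cat2l perm_cat2r perm_cat2l perm_cat2r.
rewrite (pairing_value_perm lt formS formE us io ps); congr (_ *: _).
rewrite Es Es2; rewrite Es in us.
rewrite koszul_catl //; last by rewrite perm_cat2r perm_cat2l perm_cat2r.
have u2 : uniq ((Bu ++ [:: p1; p2] ++ Bv) ++ flatten [seq B v | v <- vs2]).
  by move: us; rewrite cat_uniq => /and3P[].
rewrite (koszul_catr u2); last by rewrite perm_cat2l perm_cat2r.
have u3 : uniq (Bu ++ [:: p1; p2] ++ Bv) by move: u2; rewrite cat_uniq => /and3P[].
rewrite (koszul_catl u3); last by rewrite perm_cat2r.
have u4 : uniq ([:: p1; p2] ++ Bv) by move: u3; rewrite cat_uniq => /and3P[].
rewrite (koszul_catr u4) //.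
rewrite (@koszul_catC _ _ _ [:: p1] [:: p2]); last by move: u4; rewrite /= !inE negb_or => /andP[/andP[-> _] _].
by rewrite !big_seq1 El1 El2.
Qed.

End LinearPairings.

(** * Multilinear extension from words to the symmetric algebra *)

Section Multilift.
Variables (k : fieldType) (V : lmodType k) (gr : int -> V -> Prop).
Local Notation letter := (letter gr).
Local Notation SymAlg := (SymAlg gr).

Definition slotwise_multilinear (F : seq (seq letter) -> SymAlg) :=
  forall ws1 ws2, graded_multilinear (fun w => F (ws1 ++ w :: ws2)).

Lemma slotwise_multilinear_cons F w : slotwise_multilinear F -> slotwise_multilinear (fun ws => F (w :: ws)).
Proof. by move=> mF ws1 ws2; exact: (mF (w :: ws1) ws2). Qed.

Lemma multilift_fun_linear c (F F1 F2 : seq (seq letter) -> SymAlg) ys :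
  (forall ws, F ws = c *: F1 ws + F2 ws) ->
  multilift F ys = c *: multilift F1 ys + multilift F2 ys.
Proof.
elim: ys F F1 F2 => [|y ys IH] F F1 F2 E /=; first exact: E.
by apply: plift_funP => w; apply: IH => ws; exact: E.
Qed.

Lemma multilift_fun0 (F : seq (seq letter) -> SymAlg) ys : (forall ws, F ws = 0) -> multilift F ys = 0.
Proof.
elim: ys F => [|y ys IH] F E /=; first exact: E.
by apply: plift_fun0 => w; apply: IH => ws; exact: E.
Qed.

Lemma multilift_compatible F ys : slotwise_multilinear F ->
  compatible (@Symrel k V gr) (fun w => multilift (fun ws => F (w :: ws)) ys).
Proof.
move=> mF; apply: graded_multilinearP; split=> [u v c l l1 l2 d1 d2 E|u v l1 l2].
  by apply: multilift_fun_linear => ws; exact: (proj1 (mF [::] ws)).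
rewrite -[RHS]addr0 -(@multilift_fun0 (fun=> 0) ys) //.
by apply: multilift_fun_linear => ws; rewrite addr0; exact: (proj2 (mF [::] ws)).
Qed.

Lemma multilift_linear F ys1 c y z ys2 : slotwise_multilinear F ->
  multilift F (ys1 ++ (c *: y + z) :: ys2) =
  c *: multilift F (ys1 ++ y :: ys2) + multilift F (ys1 ++ z :: ys2).
Proof.
elim: ys1 F => [|y1 ys1 IH] F mF /=; first exact: (plift_linear (multilift_compatible ys2 mF)).
by apply: plift_funP => w; apply: IH; exact: slotwise_multilinear_cons.
Qed.

Lemma multilift_slot0 F ys1 ys2 : slotwise_multilinear F -> multilift F (ys1 ++ 0 :: ys2) = 0.
Proof.
move=> mF; have := multilift_linear ys1 (-1) 0 0 ys2 mF.
by rewrite scaler0 addr0 scaleN1r addNr.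
Qed.

End Multilift.

(** * Power series, truncation and monomials *)

Section PowerSeries.
Variables (k : fieldType) (V : lmodType k) (gr : int -> V -> Prop).
Local Notation letter := (letter gr).
Local Notation SymAlg := (SymAlg gr).
Local Notation pser := (pser gr).
Local Notation symw := (@symw k V gr).

Definition monomial (a : nat) (y : SymAlg) : pser := fun g => if g == a then y else 0.

Lemma psmul_linl (z : pser) : linear (fun x : pser => psmul x z).
Proof.
move=> c x y; apply/funext => g; rewrite /psmul -[RHS]/(c *: _ + _).
by apply: sum_lin => t; exact: symmul_linl.
Qed.

Lemma psmul_linr (x : pser) : linear (psmul x).
Proof.
move=> c y z; apply/funext => g; rewrite /psmul -[RHS]/(c *: _ + _).
by apply: sum_lin => t; exact: symmul_linr.
Qed.

Lemma psmul_local (x x' y y' : pser) g :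
  (forall t, (t <= g)%N -> x t = x' t) -> (forall t, (t <= g)%N -> y t = y' t) ->
  psmul x y g = psmul x' y' g.
Proof.
move=> Ex Ey; apply: eq_bigr => t _.
by rewrite Ex ?Ey ?leq_subr // -ltnS.
Qed.

Lemma psmul_monomial a b y z : psmul (monomial a y) (monomial b z) = monomial (a + b) (symmul y z).
Proof.
apply/funext => g; rewrite /psmul /monomial; case: eqP => [->|ne].
  have lt : (a < (a + b).+1)%N by rewrite ltnS leq_addr.
  rewrite (bigD1 (Ordinal lt)) //= eqxx addKn eqxx big1 ?addr0 // => t nt.
  by rewrite ifN ?symmul0l // -(inj_eq val_inj).
rewrite big1 // => t _; case: eqP => [ta|_]; last by rewrite symmul0l.
case: eqP => [tb|_]; last by rewrite symmul0r.
by case: ne; rewrite -ta -tb subnKC // -ltnS.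
Qed.

Variable form : letter -> letter -> k.
Hypotheses (formL : form_linear form) (formS : form_symmetric form) (formE : form_even form).
Hypothesis char_k : [pchar k] =i pred0.
Variable I : eqType.
Implicit Types (ls : seq I) (f : I -> pser).

Lemma taylor_map f ls g :
  taylor form (map f ls) g =
  \sum_(gs : (size ls).-tuple 'I_g.+1)
    multilift (fun ws => taylor_words form ws [seq val i | i <- gs] g)
      [seq f lt.1 (val lt.2) | lt <- zip ls gs].
Proof.
rewrite /taylor; move: (size_map f ls) => E; rewrite -E; apply: eq_bigr => gs _.
congr multilift; have {E} sz : size ls = size gs by rewrite size_tuple size_map.
by elim: (ls) (tval gs) sz => [|l ls' IH] [|t ts] //= [sz]; rewrite IH.
Qed.

(** All exponents in the sum are at most [g], so higher coefficients of the arguments do not enter.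
    This permits truncation to finite sums of monomials. *)
Lemma taylor_local f f' ls g : (forall l t, l \in ls -> (t <= g)%N -> f l t = f' l t) ->
  taylor form (map f ls) g = taylor form (map f' ls) g.
Proof.
move=> E; rewrite !taylor_map; apply: eq_bigr => gs _; congr multilift.
apply/eq_in_map => -[l t] /= lt; rewrite E //; last by rewrite -ltnS.
have : l \in unzip1 (zip ls gs) by apply/mapP; exists (l, t).
by rewrite unzip1_zip // size_tuple.
Qed.

Lemma taylor_slot_linear f f1 f2 c ls l g : uniq ls -> l \in ls ->
  (forall l', l' != l -> f1 l' = f l' /\ f2 l' = f l') ->
  f l = c *: f1 l + f2 l ->
  taylor form (map f ls) g = c *: taylor form (map f1 ls) g + taylor form (map f2 ls) g.
Proof.
move=> uls lls off El; rewrite !taylor_map; apply: sum_lin => gs.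
have : size ls = size gs by rewrite size_tuple.
case/splitPr: lls uls gs => ls1 ls2; rewrite cat_uniq /= negb_or => /and3P[_ /andP[n1 _] /andP[n2 _]] gs.
set F := (fun ws : seq (seq letter) => taylor_words form ws [seq val i | i <- gs] g).
have mF : slotwise_multilinear F by move=> ws1 ws2; exact: taylor_words_multilinear.
move: (tval gs) => ts; rewrite -(cat_take_drop (size ls1) ts) size_cat /=.
rewrite size_cat => sz.
have s1 : size ls1 = size (take (size ls1) ts) by rewrite size_takel //; move: sz; rewrite size_take size_drop; case: ltnP; lia.
case: (drop _ ts) sz => [|t ts2] /= sz; first by lia.
rewrite !zip_cat //= !map_cat /=.
have out ls' ts' : l \notin ls' -> [seq f1 lt.1 (val lt.2) | lt <- zip ls' ts'] = [seq f lt.1 (val lt.2) | lt <- zip ls' ts']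
    /\ [seq f2 lt.1 (val lt.2) | lt <- zip ls' ts'] = [seq f lt.1 (val lt.2) | lt <- zip ls' ts' : seq (I * 'I_g.+1)].
  elim: ls' ts' => [|l' ls' IH] [|t' ts'] //=; rewrite inE negb_or => /andP[nl' /(IH ts')[-> ->]].
  by have [-> ->] := off l' (contra_neq esym nl').
have [-> ->] := out _ (take (size ls1) ts) n1; have [-> ->] := out _ ts2 n2.
by rewrite El; exact: multilift_linear.
Qed.

Lemma taylor_words_label_gt ws gs g i : (i < size ws)%N -> (g < nth 0%N gs i)%N ->
  taylor_words form ws gs g = 0.
Proof.
move=> iw gi; rewrite /taylor_words big1 // => G _; rewrite /graph_op ifF ?scaler0 //.
apply/negbTE/forallPn; exists (Ordinal iw); apply/nandP; left.
apply: contraTneq gi => /= ->; rewrite -leqNgt -ltnS; exact: ltn_ord.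
Qed.

Lemma multilift_monomials F (ps : seq (nat * seq letter)) (gs : seq nat) :
  slotwise_multilinear F -> size gs = size ps ->
  multilift F [seq monomial pg.1.1 (symw pg.1.2) pg.2 | pg <- zip ps gs] =
  if gs == map fst ps then F (map snd ps) else 0.
Proof.
elim: ps gs F => [|p ps IH] [|t gs] F mF //= [sz].
rewrite eqseq_cons [monomial p.1 _ t]/monomial; case: eqP => [_|_] /=.
  rewrite (plift_gen (multilift_compatible _ mF)) (IH gs (fun ws => F (p.2 :: ws))) //.
  exact: slotwise_multilinear_cons.
exact: (@multilift_slot0 _ _ _ F [::]).
Qed.

(** Only the tuple of the exponents [a] survives. If one of them exceeds [g], there is no such
    tuple, and the right side vanishes by [taylor_words_label_gt]. *)
Lemma taylor_monomials (a : I -> nat) (w : I -> seq letter) ls g :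
  taylor form [seq monomial (a l) (symw (w l)) | l <- ls] g =
  taylor_words form (map w ls) (map a ls) g.
Proof.
rewrite taylor_map.
have E (gs : (size ls).-tuple 'I_g.+1) :
    multilift (fun ws => taylor_words form ws [seq val i | i <- gs] g)
      [seq monomial (a lt.1) (symw (w lt.1)) (val lt.2) | lt <- zip ls gs] =
    if [seq val i | i <- gs] == map a ls then taylor_words form (map w ls) (map a ls) g else 0.
  have := @multilift_monomials (fun ws => taylor_words form ws [seq val i | i <- gs] g)
    [seq (a l, w l) | l <- ls] [seq val i | i <- gs].
  rewrite -!map_comp; have -> : [seq (fst \o (fun l => (a l, w l))) i | i <- ls] = map a ls by exact: eq_map.
  have -> : [seq (snd \o (fun l => (a l, w l))) i | i <- ls] = map w ls by exact: eq_map.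
  have -> : [seq monomial pg.1.1 (symw pg.1.2) pg.2 | pg <- zip [seq (a l, w l) | l <- ls] [seq val i | i <- gs]] =
     [seq monomial (a lt.1) (symw (w lt.1)) (val lt.2) | lt <- zip ls gs].
    have : size ls = size gs by rewrite size_tuple.
    by elim: (ls) (tval gs) => [|l ls' IH] [|t ts] //= [sz]; rewrite IH.
  move=> ->; first by case: eqP => // ->.
    by move=> ws1 ws2; exact: taylor_words_multilinear.
  by rewrite !size_map size_tuple.
rewrite (eq_bigr _ (fun gs _ => E gs)).
case: (boolP (all (fun t => t < g.+1)%N (map a ls))) => [ale|].
  have szt : size [seq inord t : 'I_g.+1 | t <- map a ls] == size ls by rewrite !size_map.
  have Ev : [seq val i | i <- [seq inord t : 'I_g.+1 | t <- map a ls]] = map a ls.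
    rewrite -(map_comp val) -[RHS]map_id; apply/eq_in_map => t /(allP ale) lt; by rewrite /= inordK.
  rewrite (bigD1 (Tuple szt)) //= Ev eqxx big1 ?addr0 // => gs ne; rewrite ifN //.
  apply: contra_neq ne => Eg; apply: val_inj => /=.
  by apply: (inj_map val_inj); rewrite Ev Eg.
move=> /allPn[t tin]; rewrite -leqNgt => gt.
rewrite big1; last first.
  move=> gs _; case: eqP => // Eg; move: tin; rewrite -Eg => /mapP[i _ Et].
  by move: gt; rewrite Et leqNgt ltn_ord.
rewrite (@taylor_words_label_gt _ _ _ (index t (map a ls))) //.
  by rewrite size_map -(size_map a) index_mem.
by rewrite nth_index.
Qed.

End PowerSeries.

(** * Reduction of multilinear identities to generators *)

Section SlotReduction.
Variables (k : fieldType) (M N : lmodType k) (m : nat).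

Definition set_slot (x : 'I_m -> M) (l : 'I_m) (y : M) : 'I_m -> M :=
  fun l' => if l' == l then y else x l'.

Definition slot_linear (Phi : ('I_m -> M) -> N) := forall x l c y z,
  Phi (set_slot x l (c *: y + z)) = c *: Phi (set_slot x l y) + Phi (set_slot x l z).

(** Slots are reduced one at a time: in the induction the first [n] slots lie in the span, while the
    remaining ones are already generators. *)
Lemma slot_linear_span (Phi : ('I_m -> M) -> N) (S : 'I_m -> M -> Prop) : slot_linear Phi ->
  (forall x, (forall l, S l (x l)) -> Phi x = 0) ->
  forall x, (forall l, lspan (S l) (x l)) -> Phi x = 0.
Proof.
move=> lin gen.
have set_id x l : set_slot x l (x l) = x by apply/funext => l'; rewrite /set_slot; case: eqP => [->|].
suff H n x : (forall l : 'I_m, (l < n)%N -> lspan (S l) (x l)) ->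
    (forall l : 'I_m, (n <= l)%N -> S l (x l)) -> Phi x = 0.
  move=> x Hx; apply: (H m) => // l; by rewrite leqNgt ltn_ord.
elim: n x => [|n IH] x Hs Hg; first by apply: gen => l; exact: Hg.
have [mn|nm] := leqP m n.
  apply: IH => l ln; first by apply: Hs; exact: leq_trans ln _.
  by move: (leq_trans mn ln); rewrite leqNgt ltn_ord.
pose l0 := Ordinal nm; rewrite -(set_id x l0).
have step y : S l0 y -> Phi (set_slot x l0 y) = 0.
  move=> Sy; apply: IH => l ln; rewrite /set_slot.
    by rewrite ifN -?(inj_eq val_inj) /= ?ltn_eqF //; apply: Hs; exact: leq_trans ln _.
  case: eqP => [-> //|/eqP ne]; apply: Hg; rewrite ltn_neqAle ln andbT eq_sym.
  by rewrite -(inj_eq val_inj) in ne.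
elim: (Hs l0 (ltnSn n)) => [|c r y Sr _ IHy].
  by have := lin x l0 (-1) 0 0; rewrite scaler0 addr0 scaleN1r addNr.
by rewrite lin step // IHy scaler0 addr0.
Qed.

End SlotReduction.

(** * Merging two vertices *)

Section MergeVertices.
Variables (P W : finType) (at_ : P -> W).
Implicit Types (iota : {ffun P -> P}) (A D : {set W}).

Definition restrict_pairing A iota : {ffun P -> P} := [ffun p => if at_ p \in A then iota p else p].

Lemma connected_pairing_stable D iota p : connected_pairing at_ D iota -> at_ p \in D -> at_ (iota p) \in D.
Proof.
move=> /and3P[/forallP inv /forallP out _] pD; apply: contraTT pD => nD.
by have := out (iota p); rewrite nD (eqP (inv p)) /= => /eqP E; rewrite E.
Qed.

Lemma pairing_adj_restrict A iota u v :
  pairing_adj at_ (restrict_pairing A iota) u v -> connect (pairing_adj at_ iota) u v.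
Proof.
move=> /existsP[e /andP[/eqP <- /eqP <-]]; rewrite ffunE.
by case: ifP => _; [apply/connect1/pairing_adjP | exact: connect0].
Qed.

(** Stability keeps every path that starts in [A] inside [A], where [iota] and its restriction
    agree. *)
Lemma connected_restrict_pairing A iota : involutive iota ->
  (forall p, at_ p \in A -> at_ (iota p) \in A) ->
  {in A &, forall u v, connect (pairing_adj at_ iota) u v} ->
  connected_pairing at_ A (restrict_pairing A iota).
Proof.
move=> inv stab conn; apply/and3P; split.
- apply/forallP => e; rewrite !ffunE; have [eA|/negPf eA] := boolP (at_ e \in A); last by rewrite eA.
  by rewrite stab // inv.
- by apply/forallP => e; apply/implyP => /negPf eA; rewrite ffunE eA.
apply/forall_inP => u uA; apply/forall_inP => v vA.
pose S := [pred z in A | connect (pairing_adj at_ (restrict_pairing A iota)) u z].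
have : v \in S.
  apply: (@connect_closed _ (pairing_adj at_ iota) S u) => //; last by rewrite inE /= uA connect0.
    move=> x y /existsP[e /andP[/eqP <- /eqP <-]]; rewrite !inE => /andP[eA ue].
    rewrite stab //=; apply: connect_trans ue _; apply: connect1.
    by have := pairing_adjP at_ (restrict_pairing A iota) e; rewrite ffunE eA.
  exact: conn.
by rewrite inE => /andP[].
Qed.

Variables (i j : W).
Hypothesis neq_ij : i != j.

Definition merge (v : W) : W := if v == j then i else v.

Definition splits_at (L : {set W} * {set W}) : bool :=
  [&& L.1 :|: L.2 == [set: W], [disjoint L.1 & L.2], i \in L.1 & j \in L.2].

Definition connected_split iota (L : {set W} * {set W}) : bool :=
  connected_pairing at_ L.1 (restrict_pairing L.1 iota) &&
  connected_pairing at_ L.2 (restrict_pairing L.2 iota).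

Lemma splits_atP L : splits_at L ->
  [/\ forall v, (v \in L.2) = (v \notin L.1), i \in L.1 & j \in L.2].
Proof.
move=> /and4P[/eqP U dis iL jL]; split=> // v.
have := in_setT v; rewrite -U inE => /orP[v1|v2].
  by rewrite v1 (disjointFr dis v1).
by rewrite v2 (disjointFl dis v2).
Qed.

Lemma connected_split_involutive iota L : splits_at L -> connected_split iota L -> involutive iota.
Proof.
move=> /splits_atP[LE _ _] /andP[c1 c2] p; have := LE (at_ p).
have [pL _|pL] := boolP (at_ p \in L.1).
  have := connected_pairing_stable c1 pL; rewrite ffunE pL => ipL.
  by case/and3P: c1 => /forallP /(_ p); rewrite !ffunE pL ipL => /eqP.
move=> /= pL2; have := connected_pairing_stable c2 pL2; rewrite ffunE pL2 => ipL.
by case/and3P: c2 => /forallP /(_ p); rewrite !ffunE pL2 ipL => /eqP.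
Qed.

(** The restriction sends letters at [A] to letters at [A], so no edge of [iota] leaves [A]: being
    connected, [A] is a whole component. *)
Lemma connected_restrict_closed A iota u v : connected_pairing at_ A (restrict_pairing A iota) ->
  u \in A -> connect (pairing_adj at_ iota) u v = (v \in A).
Proof.
move=> cA uA; apply/idP/idP => [uv|vA].
  apply: (@connect_closed _ (pairing_adj at_ iota) (mem A) u) => // x y.
  move=> /existsP[e /andP[/eqP <- /eqP <-]] eA.
  by have := connected_pairing_stable cA eA; rewrite ffunE eA.
case/and3P: cA => _ _ /forall_inP /(_ u uA) /forall_inP /(_ v vA).
by apply: (@connect_homo _ _ _ _ id) => x y; exact: pairing_adj_restrict.
Qed.

(** A path in the merged graph lifts to the original one until it meets the merged vertex, where it
    may continue from [i] or from [j]. *)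
Lemma connected_mergeP iota : involutive iota ->
  pairing_connected (fun p => merge (at_ p)) [set v | v != j] iota =
  [forall v, connect (pairing_adj at_ iota) i v || connect (pairing_adj at_ iota) j v].
Proof.
move=> inv; have symA := pairing_adj_sym at_ inv.
have csym : connect_sym (pairing_adj at_ iota) := sym_connect_sym symA.
have iD : i \in [set v | v != j] by rewrite inE.
have homo u v : connect (pairing_adj at_ iota) u v ->
    connect (pairing_adj (fun p => merge (at_ p)) iota) (merge u) (merge v).
  apply: connect_homo => x y /existsP[e /andP[/eqP <- /eqP <-]].
  by apply: connect1; exact: (pairing_adjP (fun p => merge (at_ p))).
have mi : merge i = i by rewrite /merge (negPf neq_ij).
have mj : merge j = i by rewrite /merge eqxx.
apply/forall_inP/forallP => [H v|H u].
  have [->|nv] := eqVneq v j; first by rewrite connect0 orbT.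
  have vD : v \in [set v | v != j] by rewrite inE.
  have := forall_inP (H i iD) v vD.
  pose S := [pred z | connect (pairing_adj at_ iota) i z || connect (pairing_adj at_ iota) j z].
  move=> iv; have := @connect_closed _ _ S _ _ _ iv; rewrite !inE connect0 /=; apply=> //.
  move=> x y /existsP[e /andP[/eqP <- /eqP <-]]; rewrite !inE /merge => He.
  have {}He : connect (pairing_adj at_ iota) i (at_ e) || connect (pairing_adj at_ iota) j (at_ e).
    by move: He; case: eqP => // -> _; rewrite connect0 orbT.
  case: eqP => [_|_]; first by rewrite connect0.
  by case/orP: He => He; rewrite (connect_trans He (connect1 (pairing_adjP at_ iota e))) ?orbT.
have to_i v : v \in [set v | v != j] -> connect (pairing_adj (fun p => merge (at_ p)) iota) i v.
  rewrite inE => nv; have mv : merge v = v by rewrite /merge (negPf nv).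
  by case/orP: (H v) => /homo; rewrite ?mi ?mj mv.
have csym' : connect_sym (pairing_adj (fun p => merge (at_ p)) iota) := sym_connect_sym (pairing_adj_sym _ inv).
move=> uD; apply/forall_inP => v vD; apply: connect_trans (to_i v vD).
by rewrite csym'; exact: to_i.
Qed.

(* If the merged graph is connected, then either the original graph is, or it has
   exactly two components, namely those of [i] and [j]. *)
Lemma connected_merge iota :
  (connected_pairing (fun p => merge (at_ p)) [set v | v != j] iota =
   connected_pairing at_ [set: W] iota + \sum_(L | splits_at L) connected_split iota L :> nat)%N.
Proof.
case inv : [forall e, iota (iota e) == e]; last first.
  rewrite /connected_pairing inv /= big1 // => L sL; case cs: (connected_split iota L) => //.
  have inv' := connected_split_involutive sL cs.
  by move/negP: inv; case; apply/forallP => e; rewrite inv'.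
have {}invP : involutive iota by move=> e; apply/eqP; exact: (forallP inv).
have -> : connected_pairing (fun p => merge (at_ p)) [set v | v != j] iota =
   [forall v, connect (pairing_adj at_ iota) i v || connect (pairing_adj at_ iota) j v].
  rewrite /connected_pairing inv connected_mergeP //=.
  have -> // : [forall e, (merge (at_ e) \notin [set v | v != j]) ==> (iota e == e)].
  apply/forallP => e; rewrite inE negbK /merge; by have [_|/negPf ne] := eqVneq (at_ e) j; rewrite ?(negPf neq_ij) ?ne.
have -> : connected_pairing at_ [set: W] iota =
   [forall v, connect (pairing_adj at_ iota) i v || connect (pairing_adj at_ iota) j v] && connect (pairing_adj at_ iota) i j.
  rewrite /connected_pairing inv /=.
  have -> /= : [forall e, (at_ e \notin [set: W]) ==> (iota e == e)] by apply/forallP => e; rewrite inE.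
  have csym : connect_sym (pairing_adj at_ iota) := sym_connect_sym (pairing_adj_sym at_ invP).
  apply/forall_inP/andP => [H|[/forallP H ij] u _].
    split; last by have := forall_inP (H i (in_setT _)) j (in_setT _).
    by apply/forallP => v; rewrite (forall_inP (H i (in_setT _)) v (in_setT _)).
  have to_i v : connect (pairing_adj at_ iota) i v.
    by case/orP: (H v) => //; exact: connect_trans.
  apply/forall_inP => v _; apply: connect_trans (to_i v); by rewrite csym.
(* A split with both halves connected consists of the components of [i] and of [j], so at most one
   [L] contributes. *)
have Qclosed L v : splits_at L -> connected_split iota L ->
    (connect (pairing_adj at_ iota) i v = (v \in L.1)) * (connect (pairing_adj at_ iota) j v = (v \in L.2)).
  move=> sL /andP[c1 c2]; have [LE iL jL] := splits_atP sL.
  by rewrite (connected_restrict_closed v c1 iL) (connected_restrict_closed v c2 jL).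
case conn : [forall v, _] => /=; last first.
  rewrite big1 // => L sL; case cs: (connected_split iota L) => //.
  case/negP: (negbT conn); apply/forallP => v; rewrite !(Qclosed L v sL cs).
  by have [LE _ _] := splits_atP sL; rewrite LE; case: (v \in L.1).
have csym : connect_sym (pairing_adj at_ iota) := sym_connect_sym (pairing_adj_sym at_ invP).
case ij : (connect _ i j).
  rewrite big1 // => L sL; case cs: (connected_split iota L) => //.
  have := Qclosed L j sL cs; rewrite ij; have [LE _ jL] := splits_atP sL.
  by rewrite LE in jL; case=> + _; rewrite (negPf jL).
pose L0 := ([set v | connect (pairing_adj at_ iota) i v], [set v | connect (pairing_adj at_ iota) j v]).
have excl v : connect (pairing_adj at_ iota) i v -> connect (pairing_adj at_ iota) j v -> False.
  move=> iv jv; move/negP: ij; apply; apply: connect_trans iv _; by rewrite csym.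
have s0 : splits_at L0.
  apply/and4P; split; rewrite ?inE ?connect0 //.
    by apply/eqP/setP => v; rewrite !inE (forallP conn v).
  rewrite -setI_eq0; apply/eqP/setP => v; rewrite !inE; apply/negP => /andP[]; exact: excl.
rewrite (bigD1 L0) //= big1 ?addn0; last first.
  move=> L /andP[sL ne]; case cs: (connected_split iota L) => //.
  case/eqP: ne; case: L sL cs => [L1 L2] sL cs; congr pair; apply/setP => v; rewrite inE;
    by rewrite (Qclosed _ v sL cs).
have comp u : connected_pairing at_ [set v | connect (pairing_adj at_ iota) u v]
    (restrict_pairing [set v | connect (pairing_adj at_ iota) u v] iota).
  apply: connected_restrict_pairing => // [p|x y]; rewrite !inE.
    move=> H; exact: connect_trans H (connect1 (pairing_adjP at_ iota p)).
  by move=> ux uy; apply: connect_trans uy; rewrite csym.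
by rewrite /connected_split !comp.
Qed.

End MergeVertices.

Lemma natr_sum_andb (R : pzSemiRingType) (J : finType) (S : pred J) (b c t : bool) (f : J -> bool) :
  (b = c + \sum_(x | S x) f x :> nat)%N ->
  (b && t)%:R = (c && t)%:R + \sum_(x | S x) (f x && t)%:R :> R.
Proof.
move=> E; case: t; last by rewrite !andbF big1 ?addr0 // => x _; rewrite andbF.
rewrite !andbT E natrD natr_sum; congr (_ + _); by apply: eq_bigr => x _; rewrite andbT.
Qed.

(** * The identity on words *)

Section WordsIdentity.
Variables (k : fieldType) (V : lmodType k) (gr : int -> V -> Prop).
Variable form : letter gr -> letter gr -> k.
Local Notation letter := (letter gr).
Hypotheses (formL : form_linear form) (formS : form_symmetric form) (formE : form_even form).
Hypothesis char_k : [pchar k] =i pred0.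
Variables (m : nat) (w : 'I_m -> seq letter) (a : 'I_m -> nat) (dx : 'I_m -> int).
Hypothesis dxE : forall l, ksgn k (dx l) = ksgn k (\sum_(z <- w l) ldeg z).

Local Notation P := (position w).
Local Notation lt := (@position_letter _ _ _ _ w).
Local Notation B := (@position_block _ _ _ _ w).
Local Notation vertex := (fun p : P => tag p).
Local Notation word_of ls := (flatten [seq B l | l <- ls]).

Lemma nth_index_map (T : eqType) (f : T -> nat) (ls : seq T) v : v \in ls -> nth 0%N (map f ls) (index v ls) = f v.
Proof. by move=> vin; rewrite (nth_map v) ?index_mem // nth_index. Qed.

Lemma taylor_words_positions ls t : uniq ls -> ls != [::] ->
  taylor_words form (map w ls) (map a ls) t =
  \sum_(iota | pairing_genus vertex [set v in ls] a t iota) pairing_value form lt (word_of ls) iota.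
Proof.
move=> uls ls0; have -> : map w ls = [seq map lt (B l) | l <- ls].
  by apply: eq_map => l; rewrite position_block_letters.
apply: taylor_words_blocks => //.
- by move=> v _; exact: uniq_position_block.
- by move=> v p _; exact: mem_position_block.
- by move=> v; exact: nth_index_map.
- by rewrite lt0n size_eq0.
Qed.

Lemma uniq_word_of ls : uniq ls -> uniq (word_of ls).
Proof.
move=> uls; apply: (@uniq_blocks _ _ vertex) => // v => [_|p _].
  exact: uniq_position_block.
exact: mem_position_block.
Qed.

Lemma mem_word_of ls p : (p \in word_of ls) = (tag p \in ls).
Proof. by apply: (@mem_blocks _ _ vertex) => v q _; exact: mem_position_block. Qed.

Lemma koszul_words ls ls' : uniq ls -> perm_eq ls ls' ->
  koszul k dx ls ls' = koszul k (fun p => ldeg (lt p)) (word_of ls) (word_of ls').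
Proof.
move=> uls ps; apply: koszul_blocks => //; last exact: uniq_word_of.
by move=> l _; rewrite dxE -(position_block_letters w l) big_map.
Qed.

Lemma perm_word_of ls ls' : perm_eq ls ls' -> perm_eq (word_of ls) (word_of ls').
Proof. by move=> ps; apply/perm_flatten/perm_map. Qed.

Lemma connected_pairing_bound (D : {set 'I_m}) (iota : {ffun P -> P}) : D != set0 ->
  connected_pairing vertex D iota -> (2 * #|D| <= #|moved iota| + 2)%N.
Proof.
move=> D0; have -> : D = [set v in enum D] by apply/setP => v; rewrite inE mem_enum.
move=> cp; rewrite cardsE (card_uniqP (enum_uniq _)).
apply: (@connected_pairing_card _ _ _ _ _ lt vertex B (enum D) _ _ _ [::] 0%N _ _ cp).
- exact: enum_uniq.
- by move=> v _; exact: uniq_position_block.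
- by move=> v p _; exact: mem_position_block.
- by rewrite -cardE card_gt0.
Qed.

Variables i j : 'I_m.
Hypothesis neq_ij : i != j.

(** The genus equation common to all terms. Merging leaves [m - 1] vertices, the term with $\gamma$
    has genus [g - 1], and the two equations of a split add up; in each case the constant 2 of
    [pairing_genus] becomes 4. *)
Definition total_genus g (iota : {ffun P -> P}) : bool :=
  (2 * (g + m) == 2 * (\sum_l a l) + 4 + #|moved iota|)%N.

Let all_word := word_of (enum 'I_m).

Section Split.
Variable L : {set 'I_m} * {set 'I_m}.
Hypothesis sL : splits_at i j L.

Let LE v : (v \in L.2) = (v \notin L.1). Proof. by have [] := splits_atP sL. Qed.

Definition join_pairings (io : {ffun P -> P} * {ffun P -> P}) : {ffun P -> P} :=
  [ffun p => if tag p \in L.1 then io.1 p else io.2 p].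
Definition split_pairing (iota : {ffun P -> P}) :=
  (restrict_pairing vertex L.1 iota, restrict_pairing vertex L.2 iota).

Lemma split_pairingK : cancel split_pairing join_pairings.
Proof. by move=> iota; apply/ffunP => p; rewrite !ffunE LE; case: (tag p \in L.1). Qed.

Lemma join_pairingsK io : connected_pairing vertex L.1 io.1 -> connected_pairing vertex L.2 io.2 ->
  split_pairing (join_pairings io) = io.
Proof.
case: io => io1 io2 /= /and3P[_ /forallP o1 _] /and3P[_ /forallP o2 _]; congr pair; apply/ffunP => p; rewrite !ffunE /=.
  by case: ifP => // np; have := o1 p; rewrite np /= => /eqP.
have := o2 p; rewrite LE; case: (tag p \in L.1) => //= /eqP -> //.
Qed.

Lemma card_moved_split (iota : {ffun P -> P}) :
  #|moved iota| = (#|moved (split_pairing iota).1| + #|moved (split_pairing iota).2|)%N.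
Proof.
rewrite -(cardsID [set p | tag p \in L.1] (moved iota)); congr (_ + _)%N; apply: eq_card => p; rewrite !inE !ffunE.
  by case: (tag p \in L.1); rewrite ?andbT ?andbF ?eqxx.
by rewrite LE; case: (tag p \in L.1); rewrite /= ?eqxx.
Qed.

Lemma sum_split (f : 'I_m -> nat) : (\sum_l f l = \sum_(l in L.1) f l + \sum_(l in L.2) f l)%N.
Proof. by rewrite (bigID (mem L.1)) /=; congr (_ + _)%N; apply: eq_bigl => l; rewrite LE. Qed.

Lemma card_split : (#|L.1| + #|L.2| = m)%N.
Proof. by have := sum_split (fun=> 1%N); rewrite !sum1_card card_ord. Qed.

(** The genus of the first half determines [t], so the sum over [t] contributes one term or none.
    The edge bounds guarantee that both genera are nonnegative. *)
Lemma genus_split g iota : connected_split vertex iota L ->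
  (\sum_(t < g.+1)
     ((pairing_genus vertex L.1 a t (split_pairing iota).1)
       && (pairing_genus vertex L.2 a (g - t) (split_pairing iota).2) : nat) = total_genus g iota)%N.
Proof.
move=> /andP[c1 c2]; have [_ iL jL] := splits_atP sL.
rewrite /pairing_genus c1 c2 /=.
have b1 : (2 * #|L.1| <= #|moved (split_pairing iota).1| + 2)%N.
  by apply: connected_pairing_bound c1; apply/set0Pn; exists i.
have b2 : (2 * #|L.2| <= #|moved (split_pairing iota).2| + 2)%N.
  by apply: connected_pairing_bound c2; apply/set0Pn; exists j.
rewrite /total_genus (card_moved_split iota) sum_split -[X in (g + X)%N]card_split.
(* Both numbers of moved half-edges are even, so the doubled equations can be solved for [t]. *)
have half (D : {set 'I_m}) : connected_pairing vertex D (restrict_pairing vertex D iota) ->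
    exists r, #|moved (restrict_pairing vertex D iota)| = (2 * r)%N.
  move=> /and3P[/forallP inv _ _]; have rI : injective (fun p : P => val (enum_rank p)).
    by move=> p q /val_inj /enum_rank_inj.
  by eexists; apply: card_moved rI _ => p; apply/eqP.
have [r1 E1] := half _ c1; have [r2 E2] := half _ c2.
move: b1 b2; rewrite /= E1 E2.
move: #|L.1| #|L.2| (\sum_(l in L.1) a l)%N (\sum_(l in L.2) a l)%N => n1 n2 s1 s2 b1 b2.
case tot : (2 * (g + (n1 + n2)) == _)%N; last by rewrite big1 // => t _; have := ltn_ord t; lia.
(* The genus of the first half, which has label sum [s1], [r1] edges and [n1] vertices. *)
have lt_t0 : (s1 + 1 + r1 - n1 < g.+1)%N by lia.
rewrite (bigD1 (Ordinal lt_t0)) //= big1 ?addn0; first by lia.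
by move=> t; rewrite -(inj_eq val_inj) /= => ne; have := ltn_ord t; lia.
Qed.

(** Pairs of connected pairings of the two halves correspond to pairings of all letters with
    connected halves. Values multiply by [pairing_value_cat], and the shuffle sign is absorbed by
    [pairing_value_perm]. *)
Lemma split_contribution g :
  koszul k dx (enum 'I_m) (enum L.1 ++ enum L.2) *:
    (\sum_(t < g.+1) symmul (taylor_words form (map w (enum L.1)) (map a (enum L.1)) t)
                            (taylor_words form (map w (enum L.2)) (map a (enum L.2)) (g - t)))
  = \sum_iota (connected_split vertex iota L && total_genus g iota)%:R *:
      pairing_value form lt all_word iota.
Proof.
have [_ iL jL] := splits_atP sL.
have ps : perm_eq (enum 'I_m) (enum L.1 ++ enum L.2).
  apply: uniq_perm; first exact: enum_uniq.
    rewrite cat_uniq !enum_uniq andbT /=; apply/hasPn => v; by rewrite !mem_enum LE.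
  by move=> v; rewrite mem_cat !mem_enum LE orbN.
have e0 (D : {set 'I_m}) v : v \in D -> enum D != [::].
  by move=> vD; apply: contraTneq vD => D0; rewrite -mem_enum D0.
have sE (D : {set 'I_m}) : [set v in enum D] = D by apply/setP => v; rewrite inE mem_enum.
rewrite (eq_bigr (fun t : 'I_g.+1 => \sum_(io : {ffun P -> P} * {ffun P -> P} |
    pairing_genus vertex L.1 a t io.1 && pairing_genus vertex L.2 a (g - t) io.2)
      symmul (pairing_value form lt (word_of (enum L.1)) io.1)
             (pairing_value form lt (word_of (enum L.2)) io.2))); last first.
  move=> t _; rewrite !(taylor_words_positions _ (enum_uniq _)) ?(e0 _ i iL) ?(e0 _ j jL) // !sE.
  rewrite symmul_suml; under eq_bigr do rewrite symmul_sumr.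
  by rewrite pair_big.
pose Q io := connected_pairing vertex L.1 io.1 && connected_pairing vertex L.2 io.2.
rewrite (exchange_big_dep Q); last by move=> t io _ /andP[/andP[c1 _] /andP[c2 _]]; rewrite /Q c1 c2.
rewrite scaler_sumr (reindex_onto split_pairing join_pairings) /=; last first.
  by move=> io /andP[]; exact: join_pairingsK.
rewrite [RHS](bigID (fun iota => connected_split vertex iota L)) /= [X in _ = _ + X]big1 ?addr0; last first.
  by move=> iota /negPf ->; rewrite scale0r.
apply: eq_big => [iota|iota]; first by rewrite split_pairingK eqxx andbT.
move=> /andP[cs _]; have cs' : connected_split vertex iota L by [].
rewrite cs' /= sumr_const -scaler_nat scalerA mulrC -scalerA; congr (_ *: _).
  rewrite -(genus_split g cs') -sum1_card; congr _%:R.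
  rewrite big_mkcond; by apply: eq_bigr => t _; rewrite unfold_in; case: (_ && _).
have inv := connected_split_involutive sL cs'.
have stab (D : {set 'I_m}) : connected_pairing vertex D (restrict_pairing vertex D iota) -> involution_on (word_of (enum D)) iota.
  move=> cD p; rewrite !mem_word_of !mem_enum => pD; split; last exact: inv.
  by have := connected_pairing_stable cD pD; rewrite ffunE pD.
have [c1 c2] := andP cs'.
have eqr (D : {set 'I_m}) : {in word_of (enum D), restrict_pairing vertex D iota =1 iota}.
  by move=> p; rewrite mem_word_of mem_enum ffunE => ->.
rewrite !(eq_pairing_value _ _ (eqr _)).
have uw : uniq (word_of (enum L.1) ++ word_of (enum L.2)).
  rewrite -flatten_cat -map_cat; apply: uniq_word_of.
  by rewrite -(perm_uniq ps) enum_uniq.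
rewrite -(pairing_value_cat lt formS formE uw (stab _ c1) (stab _ c2)).
rewrite -flatten_cat -map_cat koszul_words ?enum_uniq //.
rewrite -pairing_value_perm //; first exact/uniq_word_of/enum_uniq.
  by move=> p _; rewrite mem_word_of mem_enum; split=> //; exact: inv.
exact: perm_word_of.
Qed.

End Split.

Local Notation others := [seq l <- enum 'I_m | (l != i) && (l != j)].

Lemma perm_others : perm_eq (enum 'I_m) [:: i, j & others].
Proof.
apply: uniq_perm; first exact: enum_uniq.
  by rewrite /= !inE !mem_filter negb_or neq_ij !eqxx ?andbF /= filter_uniq ?enum_uniq.
move=> l; rewrite mem_enum !inE mem_filter mem_enum andbT.
by case: eqP => //=; case: eqP.
Qed.

(** Multiplying words concatenates their letters, so the block of [i] becomes [B i ++ B j] over the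
    same positions. The sign of moving [i] and [j] to the front is absorbed by reordering the
    letters. *)
Lemma merged_contribution g :
  koszul k dx (enum 'I_m) [:: i, j & others] *:
    taylor_words form [seq (if l == i then w i ++ w j else w l) | l <- i :: others]
                      [seq (if l == i then a i + a j else a l)%N | l <- i :: others] g
  = \sum_iota (connected_pairing (fun p => merge i j (tag p)) [set v | v != j] iota && total_genus g iota)%:R *:
      pairing_value form lt all_word iota.
Proof.
pose B' l := if l == i then B i ++ B j else B l.
have -> : [seq (if l == i then w i ++ w j else w l) | l <- i :: others] = [seq map lt (B' l) | l <- i :: others].
  apply: eq_map => l; rewrite /B'; case: ifP => _; by rewrite ?map_cat !position_block_letters.
have nj l : l \in i :: others -> l != j.
  by rewrite inE => /orP[/eqP -> //|]; rewrite mem_filter => /andP[/andP[]].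
have uls : uniq (i :: others).
  by rewrite /= mem_filter eqxx filter_uniq ?enum_uniq.
have uB' v : v \in i :: others -> uniq (B' v).
  move=> _; rewrite /B'; case: ifP => _; last exact: uniq_position_block.
  rewrite cat_uniq !uniq_position_block andbT; apply/hasPn => p.
  by rewrite !mem_position_block => /eqP ->; rewrite eq_sym.
have BE' v p : v \in i :: others -> (p \in B' v) = (merge i j (tag p) == v).
  move=> /nj nv; rewrite /B' /merge; case: (eqVneq v i) => [->|ni].
    rewrite mem_cat !mem_position_block; case: (eqVneq (tag p) j) => [_|_]; by rewrite ?orbT ?orbF ?eqxx.
  rewrite mem_position_block; case: (eqVneq (tag p) j) => [->|//].
  by rewrite eq_sym (negPf nv) eq_sym (negPf ni).
rewrite (taylor_words_blocks formS formE char_k lt uls uB' BE' g (a := fun l => if l == i then (a i + a j)%N else a l)) //; last first.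
  by move=> v vin; rewrite (nth_index_map (fun l => if l == i then (a i + a j)%N else a l)).
have -> : flatten [seq B' l | l <- i :: others] = word_of [:: i, j & others].
  rewrite /= /B' eqxx -catA; congr (_ ++ _ ++ flatten _); apply/eq_in_map => l.
  by rewrite mem_filter => /andP[/andP[/negPf -> _] _].
have -> : [set v in i :: others] = [set v | v != j].
  apply/setP => v; rewrite !inE mem_filter mem_enum andbT.
  by case: eqP => // ->; rewrite neq_ij.
rewrite koszul_words ?enum_uniq ?perm_others // scaler_sumr [RHS](bigID (fun iota =>
  pairing_genus (fun p => merge i j (tag p)) [set v | v != j] (fun l => if l == i then (a i + a j)%N else a l) g iota)) /=.
have genE iota : pairing_genus (fun p => merge i j (tag p)) [set v | v != j] (fun l => if l == i then (a i + a j)%N else a l) g iota =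
   connected_pairing (fun p => merge i j (tag p)) [set v | v != j] iota && total_genus g iota.
  rewrite /pairing_genus /total_genus; congr (_ && _).
  have -> : (\sum_(v in [set v | v != j]) (if v == i then a i + a j else a v) = \sum_l a l)%N.
    rewrite [RHS](bigD1 j) //= (bigD1 i neq_ij) /= (bigD1 i) ?inE //= eqxx.
    rewrite addnCA -addnA; congr (_ + (_ + _))%N; apply: eq_big => [v|v]; first by rewrite inE.
    by move=> /andP[_ /negPf ->].
  have -> : #|[set v | v != j]| = m.-1.
    by have := cardsC1 j; rewrite card_ord => <-; apply: eq_card => v; rewrite !inE.
  have m0 : (0 < m)%N by apply: leq_ltn_trans (ltn_ord i).
  move: (\sum_l a l)%N #|moved _| => s r; lia.
rewrite [X in _ = _ + X]big1 ?addr0; last first.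
  by move=> iota; rewrite genE => /negPf ->; rewrite scale0r.
apply: eq_bigr => iota pg; rewrite -genE pg scale1r.
rewrite -pairing_value_perm //; first exact/uniq_word_of/enum_uniq; last exact: (perm_word_of perm_others).
move=> p _; rewrite mem_word_of mem_enum; split=> //.
by case/andP: pg => /and3P[/forallP /(_ p) /eqP].
Qed.

(** The genus equation is shifted by one. For [g = 0] a connected pairing would need genus -1, which
    the edge bound excludes. *)
Lemma unmerged_contribution g :
  (if g is g'.+1 then taylor_words form (map w (enum 'I_m)) (map a (enum 'I_m)) g' else 0)
  = \sum_iota (connected_pairing vertex [set: 'I_m] iota && total_genus g iota)%:R *:
      pairing_value form lt all_word iota.
Proof.
have sT : [set v in enum 'I_m] = [set: 'I_m] by apply/setP => v; rewrite !inE mem_enum.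
have ne : enum 'I_m != [::] by rewrite -size_eq0 size_enum_ord -lt0n; apply: leq_ltn_trans (ltn_ord i).
have T0 : [set: 'I_m] != set0 by apply/set0Pn; exists i.
have sE : (\sum_(v in [set: 'I_m]) a v = \sum_v a v)%N by apply: eq_bigl => v; rewrite inE.
case: g => [|g].
  rewrite big1 // => iota _; case: (boolP (connected_pairing _ _ _)) => [c|_]; last by rewrite scale0r.
  have := connected_pairing_bound T0 c; rewrite cardsT card_ord /total_genus => b.
  suff -> : (2 * (0 + m) == 2 * (\sum_l a l) + 4 + #|moved iota|)%N = false by rewrite scale0r.
  by move: b; move: #|moved _| (\sum_l a l)%N => r s; lia.
rewrite taylor_words_positions ?enum_uniq // sT big_mkcond /=; apply: eq_bigr => iota _.
have -> : pairing_genus vertex [set: 'I_m] a g iota = connected_pairing vertex [set: 'I_m] iota && total_genus g.+1 iota.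
  rewrite /pairing_genus /total_genus cardsT card_ord sE; congr (_ && _).
  by move: #|moved _| (\sum_l a l)%N => r s; lia.
by case: ifP; rewrite ?scale1r ?scale0r.
Qed.

(** All terms are now sums of the same values over involutions of the same set; the identity reduces
    to the count in [connected_merge] at each involution. *)
Theorem taylor_words_merge g :
  koszul k dx (enum 'I_m) [:: i, j & others] *:
    taylor_words form [seq (if l == i then w i ++ w j else w l) | l <- i :: others]
                      [seq (if l == i then a i + a j else a l)%N | l <- i :: others] g
  = (if g is g'.+1 then taylor_words form (map w (enum 'I_m)) (map a (enum 'I_m)) g' else 0)
    + \sum_(L | splits_at i j L)
        koszul k dx (enum 'I_m) (enum L.1 ++ enum L.2) *:
        \sum_(t < g.+1) symmul (taylor_words form (map w (enum L.1)) (map a (enum L.1)) t)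
                               (taylor_words form (map w (enum L.2)) (map a (enum L.2)) (g - t)).
Proof.
rewrite merged_contribution unmerged_contribution (eq_bigr _ (fun L sL => split_contribution sL g)).
rewrite exchange_big -big_split /=; apply: eq_bigr => iota _.
rewrite -scaler_suml -scalerDl; congr (_ *: _).
exact: natr_sum_andb (connected_merge vertex neq_ij iota).
Qed.

End WordsIdentity.

(** * Reduction to monomials *)

Section SeriesIdentity.
Variables (k : fieldType) (V : lmodType k) (gr : int -> V -> Prop).
Variable form : letter gr -> letter gr -> k.
Local Notation letter := (letter gr).
Local Notation pser := (pser gr).
Hypotheses (formL : form_linear form) (formS : form_symmetric form) (formE : form_even form).
Hypothesis char_k : [pchar k] =i pred0.

Lemma pser_sum (J : Type) (r : seq J) (S : pred J) (F : J -> pser) g :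
  (\sum_(x <- r | S x) F x) g = \sum_(x <- r | S x) F x g.
Proof. by elim: r => [|x r IH]; rewrite ?big_nil // !big_cons -IH; case: (S x). Qed.

Lemma monomial_linear a : linear (@monomial k V gr a).
Proof.
move=> c y z; apply/funext => g; rewrite -[RHS]/(c *: monomial a y g + monomial a z g) /monomial.
by case: ifP; rewrite // scaler0 addr0.
Qed.

Section Slots.
Variables (I : eqType).

Lemma taylor_slot_linear_pser (f f1 f2 : I -> pser) c ls l : uniq ls -> l \in ls ->
  (forall l', l' != l -> f1 l' = f l' /\ f2 l' = f l') ->
  f l = c *: f1 l + f2 l ->
  taylor form (map f ls) = c *: taylor form (map f1 ls) + taylor form (map f2 ls) :> pser.
Proof.
move=> uls lin off E; apply/funext => g.
exact: (taylor_slot_linear formL formS formE char_k _ uls lin off E).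
Qed.

End Slots.

Variables (m : nat) (dx : 'I_m -> int) (i j : 'I_m).
Hypothesis neq_ij : i != j.
Local Notation others := [seq l <- enum 'I_m | (l != i) && (l != j)].
Implicit Types x : 'I_m -> pser.

(* The value at [j], which does not occur in the list of slots, is made independent
   of [x] so that this family depends on [x j] at [i] only. *)
Definition merged_series x l : pser :=
  if l == i then psmul (x i) (x j) else if l == j then 0 else x l.

Lemma others_neq l : l \in others -> (l != i) && (l != j).
Proof. by rewrite mem_filter => /andP[]. Qed.

Lemma uniq_merged : uniq (i :: others).
Proof. by rewrite /= mem_filter eqxx filter_uniq ?enum_uniq. Qed.

Lemma map_merged_series x :
  psmul (x i) (x j) :: map x others = map (merged_series x) (i :: others).
Proof.
rewrite /= {1}/merged_series eqxx; congr (_ :: _); apply/eq_in_map => l /others_neq/andP[].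
by rewrite /merged_series => /negPf -> /negPf ->.
Qed.

Definition split_sum g x : SymAlg gr :=
  \sum_(L | splits_at i j L) koszul k dx (enum 'I_m) (enum L.1 ++ enum L.2) *:
    psmul (taylor form (map x (enum L.1))) (taylor form (map x (enum L.2))) g.

(** The difference of the two sides at $\gamma^g$. It is linear in each argument, so vanishing on
    monomials suffices once the arguments are truncated. *)
Definition defect g x : SymAlg gr :=
  koszul k dx (enum 'I_m) [:: i, j & others] *: taylor form (map (merged_series x) (i :: others)) g
  - (psgamma (taylor form (map x (enum 'I_m))) g + split_sum g x).

Lemma set_slot_at x l y : set_slot x l y l = y.
Proof. by rewrite /set_slot eqxx. Qed.

Lemma set_slot_off x l y l' : l' != l -> set_slot x l y l' = x l'.
Proof. by rewrite /set_slot => /negPf ->. Qed.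

Lemma taylor_set_slot_linear x l c y z ls : uniq ls -> l \in ls ->
  taylor form (map (set_slot x l (c *: y + z)) ls) =
  c *: taylor form (map (set_slot x l y) ls) + taylor form (map (set_slot x l z) ls) :> pser.
Proof.
move=> uls lls; apply: (taylor_slot_linear_pser uls lls) => [l' nl|].
  by rewrite !set_slot_off.
by rewrite !set_slot_at.
Qed.

Lemma map_set_slot_out x l y ls : l \notin ls -> map (set_slot x l y) ls = map x ls.
Proof.
move=> nl; apply/eq_in_map => l' lin; apply: set_slot_off; by apply: contraNneq nl => <-.
Qed.

Lemma merged_slot_linear x l c y z :
  taylor form (map (merged_series (set_slot x l (c *: y + z))) (i :: others)) =
  c *: taylor form (map (merged_series (set_slot x l y)) (i :: others))
  + taylor form (map (merged_series (set_slot x l z)) (i :: others)) :> pser.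
Proof.
have nji : j != i by rewrite eq_sym.
have [->|nli] := eqVneq l i.
  apply: (taylor_slot_linear_pser uniq_merged (mem_head _ _)) => [l' nl|].
    by rewrite /merged_series (negPf nl); case: eqP => // _; rewrite !set_slot_off.
  by rewrite /merged_series eqxx !set_slot_at !(set_slot_off _ _ nji); exact: psmul_linl.
have [->|nlj] := eqVneq l j.
  apply: (taylor_slot_linear_pser uniq_merged (mem_head _ _)) => [l' nl|].
    by rewrite /merged_series (negPf nl); case: eqP => // /eqP nj; rewrite !set_slot_off.
  by rewrite /merged_series eqxx !set_slot_at !(set_slot_off _ _ neq_ij); exact: psmul_linr.
apply: (@taylor_slot_linear_pser _ _ _ _ _ _ l uniq_merged).
- by rewrite inE mem_filter nli nlj mem_enum orbT.
- move=> l' nl; rewrite /merged_series !(set_slot_off _ _ nl).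
  have [nil njl] : i != l /\ j != l by rewrite !(eq_sym _ l).
  by rewrite !(set_slot_off _ _ nil) !(set_slot_off _ _ njl).
- by rewrite /merged_series (negPf nli) (negPf nlj) !set_slot_at.
Qed.

(** [L.1] and [L.2] partition the slots, so each slot occurs in exactly one factor of every product;
    in the merged term it occurs in one factor of [psmul (x i) (x j)] or in one other argument. *)
Lemma defect_slot_linear g : slot_linear (defect g).
Proof.
move=> x l c y z; rewrite /defect.
have lin3E (b b1 b2 d d1 d2 e e1 e2 : SymAlg gr) :
    b = c *: b1 + b2 -> d = c *: d1 + d2 -> e = c *: e1 + e2 ->
    b - (d + e) = c *: (b1 - (d1 + e1)) + (b2 - (d2 + e2)).
  move=> -> -> ->; rewrite scalerBr [RHS]addrACA -opprD scalerDr.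
  by rewrite [c *: d1 + _ + _]addrACA.
apply: lin3E.
- rewrite merged_slot_linear; set T1 := taylor _ _; set T2 := taylor _ _.
  by rewrite -[(_ + _ : pser) g]/(c *: T1 g + T2 g) scalerDr !scalerA mulrC.
- rewrite (taylor_set_slot_linear _ _ _ _ (enum_uniq _)) ?mem_enum //.
  by case: g => [|g]; rewrite /psgamma ?scaler0 ?addr0.
rewrite /split_sum scaler_sumr -big_split /=; apply: eq_bigr => L /splits_atP[LE _ _].
set a := koszul _ _ _ _.
pose T D u := taylor form (map (set_slot x l u) (enum (D : {set 'I_m}))) : pser.
have key : psmul (T L.1 (c *: y + z)) (T L.2 (c *: y + z)) =
    c *: psmul (T L.1 y) (T L.2 y) + psmul (T L.1 z) (T L.2 z).
  have [l1|l1] := boolP (l \in L.1).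
    have out u : T L.2 u = taylor form (map x (enum L.2)).
      by rewrite /T map_set_slot_out // mem_enum LE l1.
    by rewrite !out /T (taylor_set_slot_linear _ _ _ _ (enum_uniq _)) ?mem_enum //; exact: psmul_linl.
  have out u : T L.1 u = taylor form (map x (enum L.1)).
    by rewrite /T map_set_slot_out // mem_enum.
  by rewrite !out /T (taylor_set_slot_linear _ _ _ _ (enum_uniq _)) ?mem_enum ?LE //; exact: psmul_linr.
rewrite -!/(T _ _) key; set T1 := psmul _ _; set T2 := psmul _ _.
by rewrite -[(_ + _ : pser) g]/(c *: T1 g + T2 g) scalerDr !scalerA mulrC.
Qed.

Lemma defect_monomials g x :
  (forall l, exists a w, ksgn k (\sum_(z <- w) ldeg z) = ksgn k (dx l) /\ x l = monomial a (symw w)) ->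
  defect g x = 0.
Proof.
move=> /(choice (P := fun l a => _))[a] /(choice (P := fun l w => _))[w H].
have Ex : x = fun l => monomial (a l) (symw (w l)) by apply/funext => l; case: (H l).
have T ls t : taylor form (map x ls) t = taylor_words form (map w ls) (map a ls) t.
  by rewrite Ex; exact: taylor_monomials.
have E : map (merged_series x) (i :: others) =
    [seq monomial (if l == i then a i + a j else a l)%N (symw (if l == i then w i ++ w j else w l)) | l <- i :: others].
  apply/eq_in_map => l; rewrite inE /merged_series; case: eqP => [_ _|_ /others_neq/andP[_ /negPf ->]].
    by rewrite Ex psmul_monomial symmul_words.
  by rewrite Ex.
have dxE l : ksgn k (dx l) = ksgn k (\sum_(z <- w l) ldeg z) by case: (H l).
have E1 : psgamma (taylor form (map x (enum 'I_m))) g =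
    if g is g'.+1 then taylor_words form (map w (enum 'I_m)) (map a (enum 'I_m)) g' else 0.
  by case: g => [|g']; rewrite /= ?T.
have E2 (L : {set 'I_m} * {set 'I_m}) : psmul (taylor form (map x (enum L.1))) (taylor form (map x (enum L.2))) g =
    \sum_(t < g.+1) symmul (taylor_words form (map w (enum L.1)) (map a (enum L.1)) t)
                           (taylor_words form (map w (enum L.2)) (map a (enum L.2)) (g - t)).
  by apply: eq_bigr => t _; rewrite !T.
have := taylor_words_merge formS formE char_k a dxE neq_ij g.
rewrite /defect E taylor_monomials // => ->; rewrite E1.
rewrite /split_sum; under [X in _ - (_ + X)]eq_bigr do rewrite E2.
exact: subrr.
Qed.

Lemma defect_local g x x' : (forall l t, (t <= g)%N -> x l t = x' l t) -> defect g x = defect g x'.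
Proof.
move=> E; have T (ls : seq 'I_m) t : (t <= g)%N -> taylor form (map x ls) t = taylor form (map x' ls) t.
  move=> tg; apply: taylor_local => // l t' _ t't; apply: E; exact: leq_trans t't tg.
have E1 : taylor form (map (merged_series x) (i :: others)) g = taylor form (map (merged_series x') (i :: others)) g.
  apply: taylor_local => // l t _ tg; rewrite /merged_series; case: ifP => _.
    by apply: psmul_local => t' t't; apply: E; exact: leq_trans t't tg.
  by case: ifP => // _; exact: E.
have E2 : psgamma (taylor form (map x (enum 'I_m))) g = psgamma (taylor form (map x' (enum 'I_m))) g.
  by case: g {E E1} T => [|g'] T //=; apply: T.
have E3 (L : {set 'I_m} * {set 'I_m}) : psmul (taylor form (map x (enum L.1))) (taylor form (map x (enum L.2))) g =
    psmul (taylor form (map x' (enum L.1))) (taylor form (map x' (enum L.2))) g.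
  by apply: psmul_local => t tg; exact: T.
have E4 : split_sum g x = split_sum g x' by apply: eq_bigr => L _; rewrite E3.
by rewrite /defect E1 E2 E4.
Qed.

Theorem taylor_merge x :
  (forall l g, lspan (fun y => exists2 w, ksgn k (\sum_(z <- w) ldeg z) = ksgn k (dx l) & y = @symw k V gr w) (x l g)) ->
  koszul k dx (enum 'I_m) [:: i, j & others] *: taylor form (psmul (x i) (x j) :: map x others)
  = psgamma (taylor form (map x (enum 'I_m)))
    + \sum_(L | splits_at i j L) koszul k dx (enum 'I_m) (enum L.1 ++ enum L.2) *:
         psmul (taylor form (map x (enum L.1))) (taylor form (map x (enum L.2))) :> pser.
Proof.
move=> hx; apply/funext => g; rewrite map_merged_series.
rewrite -[LHS]/(_ *: taylor _ _ g) -[RHS]/(psgamma _ g + (\sum_(_ | _) _ : pser) g) pser_sum.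
apply/eqP; rewrite -subr_eq0; apply/eqP; rewrite -/(defect g x).
(* Truncation at $\gamma^g$: the coefficient under consideration does not change, and each argument
   becomes a finite sum of monomials. *)
pose x' l : pser := \sum_(t < g.+1) monomial t (x l t).
rewrite (@defect_local g x x'); last first.
  move=> l t tg; rewrite /x' pser_sum (bigD1 (Ordinal (tg : (t < g.+1)%N))) //= /monomial eqxx big1 ?addr0 //.
  move=> t' ne; rewrite ifN //; apply: contraNneq ne => E0; apply/eqP/val_inj; by rewrite /= E0.
apply: (slot_linear_span (S := fun l y => exists a w, ksgn k (\sum_(z <- w) ldeg z) = ksgn k (dx l) /\ y = monomial a (symw w)) (@defect_slot_linear g)).
  exact: defect_monomials.
move=> l; rewrite /x'; elim/big_rec: _ => [|t y _]; first exact: span0.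
apply: spanDD; elim: (hx l t) => [|c r z [w dw ->] _ IH].
  by have := @monomial_linear t (-1) 0 0; rewrite scaler0 addr0 scaleN1r addNr => ->; exact: span0.
by rewrite monomial_linear; apply: spanD IH; exists t, w.
Qed.

End SeriesIdentity.

(** * The form H_s^sym *)

Section MukaiDegree.
Variables (k : fieldType) (d : int) (C : cyclicAinf k d).
Local Notation arrow := (arrow (@mor k d C)).
Implicit Types (w v A B : seq arrow).

Lemma wsdeg_cat w v : wsdeg (w ++ v) = wsdeg w + wsdeg v.
Proof. by rewrite /wsdeg big_cat. Qed.

Lemma wsdeg_rotr r w : wsdeg (rotr r w) = wsdeg w.
Proof. by rewrite /rotr /rot wsdeg_cat addrC -wsdeg_cat cat_take_drop. Qed.

Lemma wsdeg_mword w : w != [::] -> wsdeg (mword (mu C) w) = wsdeg w + 1.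
Proof. by case: w => // a w _; rewrite /mword {1}/wsdeg big_seq1 /sdeg /= /odeg /deg /= -addrA. Qed.

(** A diagonal entry is nonzero only if the endomorphism preserves the degree of [c]. The two
    operations raise the shifted degree by 1 each, so the words must have total shifted degree -2,
    equivalently total [hdeg] zero. *)
Lemma muk_trace_degree A i B j : muk_trace (C := C) A i B j != 0 -> wsdeg A + wsdeg B = - 2%:Z.
Proof.
case: A => [|a A]; first by rewrite eqxx.
case: B => [|b B]; first by rewrite eqxx.
rewrite /muk_trace => nz; apply/eqP; apply: contraNT nz => nE; apply/eqP.
apply: fsbigop.fsbig1 => e _; rewrite trace0 ?mulr0 // => c; apply/eqP; apply: contraNT nE.
move=> /mu_supported/andP[_ /eqP]; rewrite /odeg !wsdeg_cat wsdeg_mword; last by case: (drop _ _).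
rewrite wsdeg_cat -[arr c :: _]cat1s wsdeg_cat.
have -> : wsdeg [:: arr c] = e - 1 by rewrite /wsdeg big_seq1.
rewrite -[in X in _ -> X](cat_take_drop i (a :: A)) -[in X in _ -> X](cat_take_drop j (b :: B)) !wsdeg_cat.
move: (wsdeg _) (wsdeg _) (wsdeg _) (wsdeg _) => *; lia.
Qed.

Lemma mukai_word_degree w v : hdeg w + hdeg v != 0 -> mukai_word (C := C) w v = 0.
Proof.
move=> nE; rewrite /mukai_word; do 4 (apply: big1 => ? _).
apply/eqP; apply: contraNT nE; rewrite !mulf_eq0 !negb_or => /andP[_ /muk_trace_degree].
by rewrite !wsdeg_rotr /hdeg => E; apply/eqP; lia.
Qed.

Lemma mukai_linear2 (x : CH C) : linear_for *%R (mukai x).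
Proof.
move=> c y z; apply: (@plift_funP k _ (@CHrel k d C) k^o c) => w.
exact: (plift_linear (@mukai_compatible2 k d C w)).
Qed.

Lemma mukai0l (y : CH C) : mukai 0 y = 0.
Proof. by have := mukai_linear1 y (-1) 0 0; rewrite scaler0 addr0 mulN1r addNr. Qed.

Lemma mukai0r (x : CH C) : mukai x 0 = 0.
Proof. by have := mukai_linear2 x (-1) 0 0; rewrite scaler0 addr0 mulN1r addNr. Qed.

Lemma mukai_degree p q (x y : CH C) : CHgr p x -> CHgr q y -> mukai x y != 0 -> p + q = 0.
Proof.
move=> hx hy nz; apply/eqP; apply: contraNT nz => npq; apply/eqP.
elim: hx => [|c r z [w <- ->] _ IH] in npq *; first exact: mukai0l.
rewrite mukai_linear1 /= IH // addr0; apply/eqP; rewrite mulf_eq0; apply/orP; right; apply/eqP.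
elim: hy npq => [|c' r' z' [v <- ->] _ IH'] npq; first exact: mukai0r.
by rewrite mukai_linear2 /= IH' // mukai_words mukai_word_degree // mulr0 addr0.
Qed.

Variable s : splitting C.

Lemma spl_T_upto_linear n j : linear (spl_T_upto s n j).
Proof.
elim: n j => [|n IH] j c x y //=; case: ifP => _; first exact: IH.
rewrite scalerN -opprD; congr (- _).
by apply: sum_lin => a; rewrite IH linearP.
Qed.

Lemma spl_T_upto_degree n j p x : (j <= n)%N -> CHgr p x -> CHgr (p + 2 * j%:Z) (spl_T_upto s n j x).
Proof.
elim: n j p x => [|n IH] j p x.
  by rewrite leqn0 => /eqP -> /=; rewrite mulr0 addr0.
move=> jn hx /=; case: ifP => [le|gt]; first exact: IH.
have Ej : j = n.+1 by apply/eqP; rewrite eqn_leq jn ltnNge gt.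
rewrite -scaleN1r; apply: spanZ; elim/big_rec: _ => [|a y _ hy]; first exact: span0.
apply: spanDD hy; have := spl_deg s a.+1 (IH (n - a)%N p x (leq_subr _ _) hx).
by have := ltn_ord a; rewrite Ej => lt; congr CHgr; lia.
Qed.

Lemma spl_T_linear n : linear (spl_T s n).
Proof. exact: spl_T_upto_linear. Qed.

Lemma spl_T_degree n p x : CHgr p x -> CHgr (p + 2 * n%:Z) (spl_T s n x).
Proof. exact: spl_T_upto_degree. Qed.

Lemma Hs_mon_linear1 c (al be ga : CH C) i j :
  Hs_mon s (c *: al + be) i ga j = c * Hs_mon s al i ga j + Hs_mon s be i ga j.
Proof.
rewrite /Hs_mon mulrCA -mulrDr; congr (_ * _); apply: sum_linr => l.
by rewrite spl_T_linear linearP mukai_linear1.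
Qed.

Lemma Hs_mon_linear2 c (al be ga : CH C) i j :
  Hs_mon s ga i (c *: al + be) j = c * Hs_mon s ga i al j + Hs_mon s ga i be j.
Proof.
rewrite /Hs_mon mulrCA -mulrDr; congr (_ * _); apply: sum_linr => l.
by rewrite mukai_linear2.
Qed.

Lemma Hs_mon0l (ga : CH C) i j : Hs_mon s 0 i ga j = 0.
Proof. by have := Hs_mon_linear1 (-1) 0 0 ga i j; rewrite scaler0 addr0 mulN1r addNr. Qed.

Lemma Hs_mon0r (ga : CH C) i j : Hs_mon s ga i 0 j = 0.
Proof. by have := Hs_mon_linear2 (-1) 0 0 ga i j; rewrite scaler0 addr0 mulN1r addNr. Qed.

Lemma big_msupp_widen (x : Hmod C) (D : {fset nat}) (F : CH C -> nat -> k) :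
  (forall i, F 0 i = 0) -> (msupp x `<=` D)%fset ->
  \sum_(i <- msupp x) F x@_i i = \sum_(i <- D) F x@_i i.
Proof.
move=> F0 sub; rewrite [RHS](big_fsetID _ (mem (msupp x))) /=.
rewrite [X in _ = _ + X]big1_fset ?addr0 => [|i]; last first.
  by rewrite !inE /= => /andP[_] /mcoeff_outdom ->; rewrite F0.
apply: eq_fbigl => i; rewrite !inE /=.
by case: (boolP (i \in msupp x)) => [/(fsubsetP sub) ->|]; rewrite ?andbF.
Qed.

Lemma mcoeff_lin c (x y : Hmod C) i : (c *: x + y)@_i = c *: x@_i + y@_i.
Proof. by rewrite mcoeffD uscaleE. Qed.

(** Cancellation makes the supports of [x], [y] and their combination differ, so the three sums are
    first widened to a common index set. *)
Lemma big_msupp_linear c (x y : Hmod C) (F : CH C -> nat -> k) :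
  (forall al be i, F (c *: al + be) i = c * F al i + F be i) -> (forall i, F 0 i = 0) ->
  \sum_(i <- msupp (c *: x + y)) F (c *: x + y)@_i i =
  c * (\sum_(i <- msupp x) F x@_i i) + \sum_(i <- msupp y) F y@_i i.
Proof.
move=> FL F0; pose D := (msupp x `|` msupp y `|` msupp (c *: x + y : Hmod C))%fset.
have s1 : (msupp x `<=` D)%fset by rewrite /D -fsetUA; exact: fsubsetUl.
have s2 : (msupp y `<=` D)%fset by rewrite /D fsetUAC; exact: fsubsetUr.
have s3 : (msupp (c *: x + y : Hmod C) `<=` D)%fset by exact: fsubsetUr.
rewrite (big_msupp_widen F0 s1) (big_msupp_widen F0 s2) (big_msupp_widen F0 s3).
by apply: sum_linr => i; rewrite mcoeff_lin FL.
Qed.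

Lemma Hs_linear1 c (x y z : Hmod C) : Hs s (c *: x + y) z = c * Hs s x z + Hs s y z.
Proof.
rewrite /Hs; apply: (@big_msupp_linear c x y (fun al i => \sum_(j <- msupp z) Hs_mon s al i z@_j j)).
  by move=> al be i; apply: sum_linr => j; exact: Hs_mon_linear1.
by move=> i; rewrite big1 // => j _; exact: Hs_mon0l.
Qed.

Lemma Hs_linear2 c (x y z : Hmod C) : Hs s z (c *: x + y) = c * Hs s z x + Hs s z y.
Proof.
rewrite /Hs; apply: sum_linr => i.
apply: (@big_msupp_linear c x y (fun al j => Hs_mon s z@_i i al j)).
  by move=> al be j; exact: Hs_mon_linear2.
by move=> j; exact: Hs_mon0r.
Qed.

(** Homological degrees cancel in a nonzero Mukai pairing. With the degree shifts of [spl_R] and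
    [spl_T] and the grading of $\mathcal{H}$ this gives [p + q = 6 - 2 * d]. *)
Lemma Hs_degree p q (x y : Hmod C) : Hgr p x -> Hgr q y -> Hs s x y != 0 -> ~~ odd `|(p + q)%R|%N.
Proof.
move=> hx hy; apply: contraR => odd_pq; apply/eqP.
rewrite /Hs big1 // => i _; rewrite big1 // => j _; rewrite /Hs_mon big1 ?mulr0 // => l _.
apply/eqP; apply: contraTT odd_pq => nz.
have := mukai_degree (spl_deg s l (spl_T_degree (i + j + 1 - l) (hx i))) (hy j) nz.
by have := ltn_ord l; lia.
Qed.

Lemma Hsym_linear : form_linear (Hsym s).
Proof.
move=> l l1 l2 c b d1 d2 E; rewrite /Hsym E d1 d2 Hs_linear1 Hs_linear2.
rewrite mulrCA -mulrDr; congr (_ * _); rewrite !mulrDr addrACA; congr (_ + _ + _).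
by rewrite mulrCA.
Qed.

Lemma Hsym_symmetric : form_symmetric (Hsym s).
Proof.
move=> a b; rewrite /Hsym mulrCA; congr (_ * _).
by rewrite mulrDr mulrA [ldeg b * ldeg a]mulrC ksgnK mul1r addrC.
Qed.

Lemma Hsym_even : form_even (Hsym s).
Proof.
move=> a b; have ha : Hgr (ldeg a) (lval a) := asboolP _ (valP a).
have hb : Hgr (ldeg b) (lval b) := asboolP _ (valP b).
apply: contraR => od; rewrite /Hsym.
have -> : Hs s (lval a) (lval b) = 0.
  by apply/eqP; apply: contraNT od; exact: Hs_degree.
have -> : Hs s (lval b) (lval a) = 0.
  by apply/eqP; apply: contraNT od; rewrite addrC; exact: Hs_degree.
by rewrite mulr0 addr0 mulr0.
Qed.

End MukaiDegree.

Lemma sub_lspan (k : fieldType) (M : lmodType k) (S S' : M -> Prop) x :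
  (forall y, S y -> S' y) -> lspan S x -> lspan S' x.
Proof. by move=> sub; elim=> [|c r y Sr _ IH]; [exact: span0 | exact: spanD (sub _ Sr) IH]. Qed.

Theorem theorem12p3p16 (k : fieldType) (char_k : [pchar k] =i pred0) (d : int)
    (C : cyclicAinf k d) (s : splitting C) (m : nat) (m_gt1 : (1 < m)%N)
    (x : 'I_m -> Fc C) (dx : 'I_m -> int)
    (hx : forall l, Fc_shift_deg (dx l) (x l))
    (i j : 'I_m) (neq_ij : i != j) :
  let others := [seq l <- enum 'I_m | (l != i) && (l != j)] in
  koszul k dx (enum 'I_m) [:: i, j & others] *:
    Kcoef s (psmul (x i) (x j) :: [seq x l | l <- others])
  = psgamma (Kcoef s [seq x l | l <- enum 'I_m])
    + \sum_(L : {set 'I_m} * {set 'I_m} |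
              [&& L.1 :|: L.2 == [set: 'I_m], [disjoint L.1 & L.2],
                  i \in L.1 & j \in L.2])
        koszul k dx (enum 'I_m) (enum L.1 ++ enum L.2) *:
          psmul (Kcoef s [seq x l | l <- enum L.1])
                (Kcoef s [seq x l | l <- enum L.2]).
Proof.
apply: (taylor_merge (@Hsym_linear k d C s) (@Hsym_symmetric k d C s) (@Hsym_even k d C s)) => // l g.
apply: sub_lspan (hx l g) => y [w dw ->]; exists w => //.
(* In the coefficient of $\gamma^g$ the degree of a word differs from [dx l] by a multiple of
   [6 - 2 * d], an even number, so the signs agree. *)
rewrite dw -addrA ksgnD [X in _ * X]ksgn_even ?mulr1 //.
lia.
Qed.
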